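(* Let $E$ be a finite alphabet, $g$ a regular $g$-function on $E$ and $(X_i)_{i\in\mathbb{Z}}$ a $g$-chain. Suppose there exist $a\in\mathbb{R}$, $b\in[1,\infty)$, $C>0$ and $K\ge 2$ such that for all $k\ge K$ $$a_k\ \ge\ 1-C\,\frac{(\log k)^a}{k^b}.$$ Let $f\colon E\to\mathbb{R}$ satisfy $\mathbb{E}(f(X_0))=0$ and put $S_n=\sum_{i=0}^{n-1}f(X_i)$. (i) If ($a\in\mathbb{R}$ and $b>1$) or ($a<-1$ and $b=1$), then $S_n/\sqrt n\to\mathcal{N}(0,\sigma^2)$ in distribution as $n\to\infty$, with $$0\le\sigma^2=\frac{\mathbb{E}\Big(\big(\sum_{i=T_1}^{T_2-1}f(X_i)\big)^2\Big)}{\mathbb{E}(T_2-T_1)}<\infty,$$ where $(T_i)_{i\in\mathbb{Z}}$ is a regeneration process for $(X_i)_{i\in\mathbb{Z}}$. (ii) If ($a\in\mathbb{R}$ and $b>2$) or ($a<-1$ and $b=2$), then $S_n/\sqrt n\to\mathcal{N}(0,\sigma^2)$ in distribution as $n\to\infty$, with $$\sigma^2=\mathbb{E}\big(f^2(X_0)\big)+2\sum_{i\ge1}\mathbb{E}\big(f(X_0)f(X_i)\big)<\infty.$$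
   Context: Notation. $E$ is a finite set with the discrete $\sigma$-algebra; $\Omega=E^{\mathbb{Z}}$ with its product $\sigma$-algebra $\mathcal{F}$. For $\omega\in\Omega$ and $-\infty\le k\le n<\infty$, $\omega_k^n=(\omega_i)_{k\le i\le n}$, and $\Omega_k^n$ is the set of all such configurations. Juxtaposition $\sigma_{-k}^{-1}\,\omega_{-\infty}^{-k-1}$ denotes the configuration on $(-\infty,-1]$ that equals $\sigma$ on $[-k,-1]$ and $\omega$ on $(-\infty,-k-1]$. $\mathcal{F}_{\le -1}$ is the $\sigma$-algebra generated by coordinates with index $\le -1$. $\mathcal{N}(0,0)$ means the point mass at $0$. A $g$-function is a probability kernel $g\colon E\times\Omega_{-\infty}^{-1}\to[0,1]$, $\sum_{\omega_0\in E}g(\omega_0\mid\omega_{-\infty}^{-1})=1$ for all $\omega_{-\infty}^{-1}$. It is regular if it is (a) continuous: for all $\epsilon>0$ there is $n\ge0$ with $|g(\omega_0\mid\omega_{-\infty}^{-1})-g(\sigma_0\mid\sigma_{-\infty}^{-1})|<\epsilon$ whenever $\omega_{-n}^0=\sigma_{-n}^0$; and (b) bounded away from zero: $g(\omega_0\mid\cdot)\ge c>0$ for each $\omega_0\in E$. A probability measure $\mathbb{P}$ on $(\Omega,\mathcal{F})$ is consistent with $g$ if it is shift-invariant and $\int h(\omega)g(x\mid\omega)\,\mathbb{P}(d\omega)=\int_{\{\omega_0=x\}}h(\omega)\,\mathbb{P}(d\omega)$ for all $x\in E$ and all $\mathcal{F}_{\le -1}$-measurable $h$ (bounded, say). A $g$-chain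 is the coordinate process $(X_i)_{i\in\mathbb{Z}}$ under a consistent $\mathbb{P}$. For $k\ge 0$, $$a_k=\inf_{\sigma_{-k}^{-1}\in\Omega_{-k}^{-1}}\ \sum_{\xi_0\in E}\ \inf_{\omega_{-\infty}^{-k-1}\in\Omega_{-\infty}^{-k-1}} g\big(\xi_0\mid\sigma_{-k}^{-1}\,\omega_{-\infty}^{-k-1}\big),$$ with $\sigma_0^{-1}=\emptyset$ when $k=0$. Let $\rho_M$, $M\ge 0$, be the probability that the Markov chain on $\{0,1,2,\dots\}$ started at $0$ with transition probabilities $p(k,k+1)=a_k$, $p(k,0)=1-a_k$, is at $0$ at time $M$ (so $\rho_0=1$). A regeneration process for $(X_i)$ is a sequence of integer-valued random times $(T_i)_{i\in\mathbb{Z}}$, defined on the same (possibly enlarged) probability space as $(X_i)$, such that: $T_i<T_{i+1}$ for all $i$ and $T_0\le 0<T_1$; $(T_i)$ is a shift-invariant (stationary) renewal process, i.e. the law of the random set $\{T_i\}\subset\mathbb{Z}$ is translation invariant, with $\mathbb{P}(T_{i+1}-T_i\ge M)=\rho_{M-1}$ for all integers $M\ge1$ and $i\ne 0$; and the random blocks $\{(X_j\colon T_i\le j<T_{i+1})\}_{i\in\mathbb{Z}}$ (of random length) are independent and, except for $i=0$, identically distributed. It is known (Comets, Fernández, Ferrari) that if $g$ is regular and $\prod_{k\ge0}a_k>0$ then there is a unique $\mathbb{P}$ consistent with $g$, a regeneration process exists, and $\mathbb{E}(T_2-T_1)=\sum_{M\ge 1}\mathbb{P}(T_2-T_1\ge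 M)<\infty$. *)

(* Defs.v *)
From HB Require Import structures.
From mathcomp Require Import all_boot all_order all_algebra.
From mathcomp Require Import all_classical all_reals all_analysis.

Set Implicit Arguments.
Unset Strict Implicit.
Unset Printing Implicit Defensive.

Import Order.TTheory GRing.Theory Num.Theory.
Import numFieldNormedType.Exports.

Local Open Scope classical_set_scope.
Local Open Scope ring_scope.

(* A measurableType is pointed, so a finite alphabet is taken together with a
   point.  The empty alphabet is thereby left out; it carries no probability
   measure on E^Z. *)
#[short(type="pointedFinType")]
HB.structure Definition PointedFinite := {T of Pointed T & Finite T}.

(* Events depending on a single coordinate with index in J. *)
Definition coord_events (I : Type) (E : Type) (J : set I) : set (set (I -> E)) :=
  [set A | exists2 i, J i & exists B : set E, A = [set w | B (w i)]].

(* E^I with the product sigma-algebra, E being discrete. *)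
Notation config I E := (g_sigma_algebraType (@coord_events I E [set: I])).

(* A configuration on (-oo, -1] is coded by a function on nat:
   entry n sits at site -(n+1). *)
Notation past E := (config nat E).

Definition past_of (E : Type) (w : int -> E) : nat -> E := fun n => w (- n.+1%:Z).

(* sigma_{-k}^{-1} omega_{-oo}^{-k-1}; entry n of s is the symbol at site -(n+1)
   and entry n of w the symbol at site -(k+1+n). *)
Definition juxt (E : Type) (k : nat) (s : k.-tuple E) (w : nat -> E) : nat -> E :=
  fun n => nth (w (n - k)%N) s n.

Definition config_shift (E : Type) (w : int -> E) : int -> E := fun i => w (i + 1).

Section g_functions.
Context {R : realType} {E : pointedFinType}.
Implicit Types (g : E -> past E -> R) (P : probability (config int E) R).

Definition g_function g : Prop :=
  [/\ forall x, measurable_fun [set: past E] (g x),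
      forall x w, 0 <= g x w <= 1
    & forall w, \sum_(x : E) g x w = 1].

Definition g_continuous g : Prop :=
  forall eps : R, 0 < eps -> exists n : nat, forall (x : E) (w s : past E),
    (forall k, (k < n)%N -> w k = s k) -> `|g x w - g x s| < eps.

Definition g_bounded_away g : Prop :=
  exists2 c : R, 0 < c & forall (x : E) (w : past E), c <= g x w.

Definition regular g : Prop := g_continuous g /\ g_bounded_away g.

Definition shift_invariant P : Prop :=
  forall A : set (config int E), measurable A -> P (@config_shift E @^-1` A) = P A.

(* Measurability with respect to the sigma-algebra generated by the
   coordinates with index <= -1. *)
Definition past_measurable (h : config int E -> R) : Prop :=
  measurable_fun
    [set: g_sigma_algebraType (@coord_events int E [set i | i <= -1])] h.

Definition consistent g P : Prop :=
  shift_invariant P /\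
  forall (x : E) (h : config int E -> R),
    past_measurable h -> (exists M : R, forall w, `|h w| <= M) ->
    (\int[P]_w (h w * g x (past_of w))%:E =
     \int[P]_(w in [set w : config int E | w 0%R = x]) (h w)%:E)%E.

Definition a_coef g (k : nat) : R :=
  inf [set \sum_(x : E) inf [set g x (juxt s w) | w in [set: past E]]
      | s in [set: k.-tuple E]].

End g_functions.

Section house_of_cards.
Context {R : realType}.
Variable a : nat -> R.

Definition house_step (k j : nat) : R :=
  if j == k.+1 then a k else if j == 0%N then 1 - a k else 0.

(* Law at time M of the chain started at 0; the sum is over 0, ..., M only, as
   the chain is at most at M at time M. *)
Fixpoint house_law (M j : nat) : R :=
  if M is M'.+1 then \sum_(k < M'.+1) house_law M' k * house_step k j
  else (j == 0%N)%:R.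

Definition return_prob (M : nat) : R := house_law M 0.

End house_of_cards.

(* Meant for variables with values in a countable set V, with the discrete
   sigma-algebra. *)
Definition discrete_independent d (W : measurableType d) (R : realType)
    (Q : probability W R) (I : eqType) (V : Type) (Y : I -> W -> V) : Prop :=
  forall (s : seq I) (A : I -> set V), uniq s ->
    (Q (\bigcap_(i in [set` s]) (Y i @^-1` A i)) =
     \prod_(i <- s) Q (Y i @^-1` A i))%E.

Section regeneration.
Context {R : realType} {E : pointedFinType} {d} {W : measurableType d}.
Variables (g : E -> past E -> R) (P : probability (config int E) R).
Variables (Q : probability W R) (X : {RV Q >-> config int E}).
Variable T : int -> W -> int.

Definition gap (i : int) (w : W) : int := T (i + 1) w - T i w.

(* The word (X_j : T_i <= j < T_{i+1}). *)
Definition block (i : int) (w : W) : seq E :=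
  [seq (X w : int -> E) (T i w + j%:Z) | j <- iota 0 `|gap i w|%N].

Definition renewal_set (w : W) : config int bool :=
  fun n => `[< exists i, T i w = n >].

(* X is a copy, on a possibly larger space W, of the coordinate process under
   P, and T is a regeneration process for it.  The inequalities between random
   times are only required almost surely. *)
Definition is_regeneration : Prop :=
  [/\ forall A : set (config int E), measurable A -> distribution Q X A = P A,
      forall i n, measurable [set w | T i w = n],
      {ae Q, forall w, [/\ forall i, T i w < T (i + 1) w, T 0 w <= 0 & 0 < T 1 w]},
      [/\ forall A : set (config int bool), measurable A ->
            Q [set w | A (@config_shift bool (renewal_set w))] =
            Q [set w | A (renewal_set w)]
        & forall (i : int) (M : nat), i != 0 -> (1 <= M)%N ->
            Q [set w | M%:Z <= gap i w] = (return_prob (a_coef g) M.-1)%:E]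
    & discrete_independent Q block /\
      forall (i j : int) (A : set (seq E)), i != 0 -> j != 0 ->
        Q (block i @^-1` A) = Q (block j @^-1` A)].

End regeneration.

(* N(0, v), with the point mass at 0 for v = 0 (normal_prob is a uniform law
   when its standard deviation is 0). *)
Definition centered_normal (R : realType) (v : R) : probability (measurableTypeR R) R :=
  if v == 0 then [the probability _ _ of \d_(0 : measurableTypeR R)]
  else [the probability _ _ of normal_prob 0 (Num.sqrt v)].

Definition cvg_in_distribution d (W : measurableType d) (R : realType)
    (Q : probability W R) (Y : nat -> W -> R) (mu : probability (measurableTypeR R) R) : Prop :=
  forall h : R -> R, continuous h -> (exists M : R, forall x, `|h x| <= M) ->
    ('E_Q[h \o Y n] @[n --> \oo] --> \int[mu]_x (h x)%:E)%E.

Definition normalized_sum (R : realType) (E : Type) (f : E -> R) (n : nat)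
    (w : int -> E) : R :=
  (\sum_(i < n) f (w i%:Z)) / Num.sqrt n%:R.

(* Main.v *)
(* A transition of the chain couples the pasts [w] and [s] that agree to depth [k] so that
   they agree to depth [k + 1] with probability at least [a_k]: the oscillations of the iterates
   of the transfer operator [L phi w = \sum_x g x w phi (x w)] are thus dominated by the
   house-of-cards chain.  When [1 - a_k] is summable that chain is transient, so the series
   [\sum_n L^n f] converges uniformly and [S_n] is, up to a bounded term, a martingale with
   continuous bounded differences.  Its characteristic function is
   [exp (- n t^2 sigma2 / 2)] up to [n (o(t^2)) + O(t)], which gives the central limit theorem
   and, summing the correlations, the series for [sigma2].

   For the regeneration formula, sum [r^n E cos (s S_n + th)] over [n] with [r = exp (-1/m)]
   and [s = m^(-1/2)].  The martingale estimate gives the limit [m cos th / (1 + sigma2 / 2)];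
   splitting at the first regeneration gives a renewal equation for the same quantity.
   Comparing them, [m (1 - E (r^tau cos (s Y)))] tends to [E tau (1 + sigma2 / 2)], where [tau]
   is the length and [Y] the sum of a block.  The terms [m E (1 - r^tau)] contribute [E tau],
   so [E Y^2 = sigma2 E tau], finiteness coming from Fatou's lemma. *)
Require Import Defs.
From HB Require Import structures.
From mathcomp Require Import all_boot all_order all_algebra.
From mathcomp Require Import all_classical all_reals all_analysis.
From mathcomp Require Import measurable_realfun ring lra zify.

Set Implicit Arguments.
Unset Strict Implicit.
Unset Printing Implicit Defensive.

Import Order.TTheory GRing.Theory Num.Theory.
Import numFieldNormedType.Exports.

Local Open Scope classical_set_scope.
Local Open Scope ring_scope.

(** * Summability and the house-of-cards chain *)

Section summable.
Context {R : realType}.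
Implicit Types e h : nat -> R.

(** In case (i) the length of a block is only known to have a finite mean, so the second moment of a
    block sum cannot be presupposed, and a central limit theorem for sums of independent blocks has
    nothing to start from. The limit is therefore found from the chain alone, and every regeneration
    process, on whatever space it lives, is compared with it afterwards. The discount [r] keeps all
    the quantities compared bounded, so no moment of a block sum is used in advance. As [1 - r] and
    [s^2] are both of order [1/m], the length of a block and the square of its sum enter at the same
    order; [1 + sigma2 / 2] appears because [r * exp (- s^2 sigma2 / 2)] equals
    [exp (- (1 + sigma2 / 2) / m)]. Blocks with a common law start at [T 1] and not at 0; that
    offset alters a partial sum by a bounded multiple of [T 1], which the small frequency [s] makes
    negligible. Complex exponentials are avoided throughout: the free phase [th] supplies sines as
    well as cosines, and the renewal equation becomes a rotation system for the phases [0] and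
    [pi / 2]. *)

Definition bounded_sums e := exists S : R, forall n, \sum_(k < n) e k <= S.

Lemma bounded_sums_eventually_le e h (c : R) (K : nat) :
  0 <= c -> (forall k, 0 <= h k) ->
  (forall k, (K <= k)%N -> e k <= c * h k) -> bounded_sums h -> bounded_sums e.
Proof.
move=> c0 h0 eh [S hS].
exists (\sum_(k < K) `|e k| + c * S) => n.
apply: (@le_trans _ _ (\sum_(k < n) ((if (k < K)%N then `|e k| else 0) + c * h k))).
  apply: ler_sum => k _; case: ifPn => [kK|]; last by rewrite -leqNgt add0r; exact: eh.
  by rewrite (le_trans (ler_norm _))// lerDl mulr_ge0.
rewrite big_split/= -mulr_sumr lerD//; last by rewrite ler_wpM2l//; exact: hS.
rewrite -(big_mkord predT (fun k => if (k < K)%N then `|e k| else 0)).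
rewrite -(big_mkord predT (fun k => `|e k|)).
case: (leqP n K) => nK.
  rewrite [leRHS](big_cat_nat (leq0n n) nK)/= -[leLHS]addr0 lerD// ?sumr_ge0//.
  by apply: ler_sum => i _; case: ifP.
rewrite [leLHS](big_cat_nat (leq0n K) (ltnW nK))/= -[leRHS]addr0 lerD//.
  by apply: ler_sum => i _; case: ifP.
rewrite big_nat_cond big1// => i /andP[/andP[Ki _] _]; by rewrite ltnNge Ki.
Qed.

Lemma bounded_sums_condensation e :
  (forall k, 0 <= e k) -> (forall k, e k.+1 <= e k) ->
  bounded_sums (fun j => 2 ^+ j * e (2 ^ j)%N) -> bounded_sums e.
Proof.
move=> e0 ed [S hS]; exists (e 0%N + S) => n.
have ed' i j : (i <= j)%N -> e j <= e i.
  by move=> /subnK <-; elim: (j - i)%N => // k; apply: le_trans; exact: ed.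
have block m : \sum_(0 <= k < 2 ^ m) e k <= e 0%N + \sum_(j < m) 2 ^+ j * e (2 ^ j)%N.
  elim: m => [|m IH]; first by rewrite expn0 big_nat1 big_ord0 addr0.
  rewrite (@big_cat_nat _ _ _ (2 ^ m)%N)//=; last by rewrite leq_exp2l.
  rewrite big_ord_recr/= addrA lerD//.
  apply: (@le_trans _ _ (\sum_(2 ^ m <= i < 2 ^ m.+1) e (2 ^ m)%N)).
    by apply: ler_sum_nat => i /andP[? _]; exact: ed'.
  by rewrite big_const_nat iter_addr_0 expnS mul2n -addnn addnK -[leLHS]mulr_natl natrX.
apply: (@le_trans _ _ (\sum_(0 <= k < 2 ^ n) e k)).
  rewrite -(big_mkord predT e) (@big_cat_nat _ _ _ n 0 (2 ^ n))//=.
    by rewrite lerDl sumr_ge0.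
  exact/ltnW/ltn_expl.
by rewrite (le_trans (block n))// lerD2l.
Qed.

Lemma geometric_sum_le (r : R) n : 0 <= r < 1 -> \sum_(i < n) r ^+ i <= (1 - r)^-1.
Proof.
move=> /andP[r0 r1]; elim: n => [|n IH]; first by rewrite big_ord0 invr_ge0; lra.
rewrite big_ord_recl/= expr0; under eq_bigr do rewrite exprS.
rewrite -mulr_sumr; apply: (@le_trans _ _ (1 + r * (1 - r)^-1)).
  by rewrite lerD2l ler_wpM2l.
by rewrite le_eqVlt; apply/orP; left; apply/eqP; field; lra.
Qed.

Lemma bounded_sums_powR (a : R) : a < -1 -> bounded_sums (fun j => j.+1%:R `^ a).
Proof.
move=> a1; apply: bounded_sums_condensation.
- by move=> k; exact: powR_ge0.
- move=> k; rewrite -[a]opprK !(powRN _ (- a)) lef_pV2 ?posrE ?powR_gt0// .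
  by apply: ge0_ler_powR; rewrite ?nnegrE ?ler_nat//; lra.
(* Condensation leaves a series dominated by the powers of [q], and [q < 1] because [a < -1]. *)
- pose q : R := 2 `^ (1 + a).
  apply: (@bounded_sums_eventually_le _ (fun j => q ^+ j) 1 0) => //.
  + by move=> k; rewrite exprn_ge0// powR_ge0.
  + move=> k _; rewrite mul1r.
    have -> : q ^+ k = 2 ^+ k * (2 ^+ k) `^ a.
      rewrite /q powRD; last by apply/implyP => _; rewrite pnatr_eq0.
      rewrite powRr1// exprMn; congr (_ * _).
      by elim: k => [|k IH]; rewrite ?expr0 ?powR1// !exprS powRM ?exprn_ge0// IH.
    rewrite ler_wpM2l ?exprn_ge0//.
    rewrite -[a]opprK !(powRN _ (- a)) lef_pV2 ?posrE ?powR_gt0// ?exprn_gt0//.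
    by apply: ge0_ler_powR; rewrite ?nnegrE ?exprn_ge0// -?natrX ?ler_nat//; lra.
  + exists (1 - q)^-1 => n; apply: geometric_sum_le; rewrite powR_ge0/= /q.
    rewrite -[ltRHS](powRr0 2) /powR pnatr_eq0/= ltr_expR ltr_pM2r ?ln_gt0 ?ltr1n//.
    by lra.
Qed.

(** For [a > 0] this is the [a]-th power of [ln y <= y] at [y = k^(d/a)], up to the factor [d / a].
    For [a <= 0] the left side is largest at [k = 2]. *)
Lemma ln_powR_le (a d : R) : 0 < d ->
  exists2 c, 0 < c & forall k, (2 <= k)%N -> ln k%:R `^ a <= c * k%:R `^ d.
Proof.
move=> d0; have ln2 : 0 < ln 2 :> R by rewrite ln_gt0// ltr1n.
have lnk (k : nat) : (2 <= k)%N -> ln 2 <= ln k%:R :> R.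
  by move=> k2; rewrite ler_ln ?posrE ?ltr0n ?ler_nat// (leq_trans _ k2).
have [a0|a0] := leP a 0.
  exists (ln 2 `^ a); first by rewrite powR_gt0.
  move=> k k2; apply: (@le_trans _ _ (ln 2 `^ a)).
    rewrite -[a]opprK !(powRN _ (- a)) lef_pV2 ?posrE ?powR_gt0//; last exact: lt_le_trans (lnk _ k2).
    apply: ge0_ler_powR; rewrite ?nnegrE ?oppr_ge0 ?(ltW ln2)//.
      exact: le_trans (ltW ln2) (lnk _ k2).
    exact: lnk.
  rewrite ler_peMr ?powR_ge0// -[leLHS](powRr0 k%:R) ler_powR// ?(ltW d0)//.
  by rewrite (ler_nat _ 1) ltnW.
have ed : 0 < d / a by rewrite divr_gt0.
exists ((d / a)^-1 `^ a); first by rewrite powR_gt0 ?invr_gt0.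
move=> k k2.
have k0 : 0 < k%:R :> R by rewrite ltr0n (leq_trans _ k2).
have -> : k%:R `^ d = (k%:R `^ (d / a)) `^ a.
  by rewrite -powRrM divfK// gt_eqF.
rewrite -powRM ?invr_ge0 ?powR_ge0 ?(ltW ed)//.
have lk : ln k%:R <= (d / a)^-1 * k%:R `^ (d / a).
  rewrite mulrC ler_pdivlMr// mulrC -ln_powR.
  rewrite (le_trans _ (_ : k%:R `^ (d/a) - 1 <= _))//; last by rewrite gerBl.
  have := @le_ln1Dx R (k%:R `^ (d / a) - 1).
  rewrite addrCA subrr addr0 ln_powR; apply.
  by rewrite ltrBrDr addNr powR_gt0.
apply: ge0_ler_powR => //; rewrite ?nnegrE ?(ltW a0)//.
  exact: le_trans (ltW ln2) (lnk _ k2).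
by rewrite mulr_ge0 ?powR_ge0// invr_ge0 ltW.
Qed.

Lemma bounded_sums_log e (a b C : R) (K : nat) :
  (forall k, 0 <= e k) -> (forall k, e k.+1 <= e k) -> 0 < C -> (2 <= K)%N ->
  (1 < b \/ a < -1 /\ b = 1) ->
  (forall k, (K <= k)%N -> e k <= C * (ln k%:R `^ a / k%:R `^ b)) ->
  bounded_sums e.
Proof.
move=> e0 ed C0 K2 ab he.
(* The case [b > 1] reduces to the exponents [(-2, 1)]: split [(ln k)^a] as
   [(ln k)^(a+2) (ln k)^(-2)] and absorb the first factor in [k^(b-1)]. *)
wlog [a1 b1] : a b C C0 he {ab} / a < -1 /\ b = 1.
  move=> wl; case: ab => [b1|ab]; last exact: (wl a b C).
  have [c c0 hc] := @ln_powR_le (a + 2) (b - 1) (ltac:(lra)).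
  apply: (wl (- 2) 1 (C * c)); [by rewrite mulr_gt0| |split=> //; lra].
  move=> k Kk; have k2 := leq_trans K2 Kk.
  apply: (le_trans (he _ Kk)); rewrite -mulrA ler_pM2l//.
  have k0 : 0 < k%:R :> R by rewrite ltr0n (leq_trans _ k2).
  have lk0 : 0 < ln k%:R :> R by rewrite ln_gt0// ltr1n.
  rewrite ler_pdivrMr ?powR_gt0//.
  have -> : k%:R `^ b = k%:R `^ (b - 1) * k%:R `^ 1.
    by rewrite -powRD ?subrK//; apply/implyP => _; rewrite gt_eqF.
  have -> : ln k%:R `^ a = ln k%:R `^ (a + 2) * ln k%:R `^ (-2).
    by rewrite -powRD ?addrK//; apply/implyP => _; rewrite gt_eqF.
  have := hc _ k2; set u := _ `^ (a + 2); set v := _ `^ (b - 1).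
  set l := _ `^ -2; set w := _ `^ 1 => uv.
  have w0 : w != 0 by rewrite gt_eqF// powR_gt0.
  have -> : c * (l / w) * (v * w) = (c * v) * l by field.
  by rewrite ler_wpM2r ?powR_ge0.
(* At [k = 2^j] the factor [2^j] cancels the denominator and [C (j ln 2)^a] remains. *)
apply: bounded_sums_condensation => //.
have ln2 : 0 < ln 2 :> R by rewrite ln_gt0// ltr1n.
have Cl : 0 <= C * ln 2 `^ a by rewrite mulr_ge0 ?powR_ge0 ?ltW.
have [S hS] := bounded_sums_powR a1.
apply: (@bounded_sums_eventually_le _ (fun j => j%:R `^ a) (C * ln 2 `^ a) K) => //.
- move=> j Kj; have j2 : (K <= 2 ^ j)%N by rewrite (leq_trans Kj)// ltnW// ltn_expl.
  rewrite mulrC -ler_pdivlMr ?exprn_gt0// (le_trans (he _ j2))//.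
  rewrite b1 powRr1 ?ler0n// natrX lnXn ?ltr0n// -[ln 2 *+ j]mulr_natl powRM ?ler0n ?(ltW ln2)//.
  by rewrite -!mulrA ler_pM2l// mulrCA mulrA.
(* [bounded_sums_powR] sums over [j + 1], so the term at [j = 0], a conventional power of 0, is set
   apart. *)
- exists (0 `^ a + S) => -[|n]; first by rewrite big_ord0 addr_ge0 ?powR_ge0// (le_trans _ (hS 0%N))// big_ord0.
  by rewrite big_ord_recl/= lerD2l; exact: hS.
Qed.

End summable.

Section house_of_cards_potential.
Context {R : realType}.
Variable a : nat -> R.
Hypothesis a_nondecreasing : forall k, a k <= a k.+1.
Hypothesis a0_gt0 : 0 < a 0%N.
Hypothesis a_le1 : forall k, a k <= 1.
Hypothesis a_summable : bounded_sums (fun k => 1 - a k).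

Let a_ge_a0 k : a 0%N <= a k.
Proof. by elim: k => // k /le_trans; apply. Qed.

Let a_ge0 k : 0 <= a k.
Proof. exact: le_trans (ltW a0_gt0) (a_ge_a0 k). Qed.

(* [p k] bounds from below the probability of never returning to 0 from [k]. *)
Lemma house_survival : exists p : nat -> R,
  [/\ 0 < p 0%N, forall k, 0 <= p k <= 1 & forall k, p k <= a k * p k.+1].
Proof.
have [S hS] := a_summable.
(* This is a lower bound for the product of the [a j] over [j >= k], since
   [a j >= exp (- (1 - a j) / a 0)]. The latter follows from [(a j - a 0) (1 - a j) >= 0] and
   [1 + x <= exp x]. *)
exists (fun k => expR (- ((S - \sum_(j < k) (1 - a j)) / a 0%N))); split.
- exact: expR_gt0.
- move=> k; rewrite expR_ge0/= -[leRHS]expR0 ler_expR oppr_le0 divr_ge0 ?(ltW a0_gt0)//.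
  by rewrite subr_ge0; exact: hS.
- move=> k; rewrite big_ord_recr/=; set r := \sum_(_ < _) _.
  have -> : - ((S - r) / a 0%N) =
     - ((1 - a k) / a 0%N) + - ((S - (r + (1 - a k))) / a 0%N).
    by field; rewrite gt_eqF.
  rewrite expRD ler_wpM2r ?expR_ge0// expRN.
  rewrite -[leRHS]invrK lef_pV2 ?posrE ?expR_gt0 ?invr_gt0//; last exact: lt_le_trans (a_ge_a0 k).
  apply: le_trans (expR_ge1Dx _).
  have ak : 0 < a k := lt_le_trans a0_gt0 (a_ge_a0 k).
  rewrite -(ler_pM2l ak) mulfV ?gt_eqF// -(ler_pM2l a0_gt0).
  have -> : a 0%N * (a k * (1 + (1 - a k) / a 0%N)) = a k * (a 0%N + (1 - a k)).
    by field; rewrite gt_eqF.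
  by have := a_ge_a0 k; have := a_le1 k; nra.
Qed.

(** The transition operator of the house-of-cards chain acting on functions: [iter m house_op B k]
    is the mean of [B] at time [m] for the chain started at [k]. *)
Definition house_op (B : nat -> R) (k : nat) : R := a k * B k.+1 + (1 - a k) * B 0%N.

(* [u] dominates the expected time spent below [J]: each excursion below [J] lasts
   at most [J] steps, and there are at most [1 / p 0] of them on average. *)
Lemma house_potential (J : nat) : exists (u : nat -> R) (c : R),
  [/\ forall k, 0 <= u k <= c & forall k, (k < J)%N%:R + house_op u k <= u k].
Proof.
have [p [p0 p01 pa]] := house_survival.
(* [J - k] bounds the steps spent below [J] before the next return to 0, [1 - p k] bounds the
   probability of that return, and [J / p 0] is the charge for everything that follows it. *)
exists (fun k => (J - k)%:R + J%:R / p 0%N * (1 - p k)), (J%:R + J%:R / p 0%N).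
have c0 : 0 <= J%:R / p 0%N by rewrite divr_ge0// ltW.
split=> k.
  have /andP[pk0 pk1] := p01 k.
  apply/andP; split; first by rewrite addr_ge0// mulr_ge0// subr_ge0.
  rewrite lerD ?ler_nat ?leq_subr//.
  by rewrite ler_piMr// lerBlDr lerDl.
rewrite /house_op subn0.
set c := J%:R / p 0%N in c0 *.
have cp : c * p 0%N = J%:R by rewrite /c divfK// gt_eqF.
have H : (k < J)%N%:R + a k * (J - k.+1)%:R <= (J - k)%:R :> R.
  case: ltnP => kJ; last first.
    have -> : (J - k.+1)%N = 0%N by apply/eqP; rewrite subn_eq0 leqW.
    by rewrite mulr0 addr0.
  rewrite subnS -[in leRHS](@prednK (J - k)) ?subn_gt0// -natr1 addrC lerD2r.
  by rewrite ler_piMl// ler0n.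
have := pa k; have := a_le1 k; have := a_ge0 k.
set x := (J - k)%:R in H *; set y := (J - k.+1)%:R in H *; set i := _%:R in H *.
move=> ak0 ak1 pk.
have : c * (p k) <= c * (a k * p k.+1) by rewrite ler_wpM2l.
by rewrite -cp; nra.
Qed.

Lemma house_op_le (B B' : nat -> R) k :
  (forall j, B j <= B' j) -> house_op B k <= house_op B' k.
Proof. by move=> BB; rewrite /house_op lerD// ler_wpM2l// subr_ge0. Qed.

(** The partial sums of the Green function of [[0, J)]: a nonnegative [u] with indicator plus
    [house_op u] at most [u] dominates them all, by induction on [n]. *)
Lemma house_op_iter_sum (J : nat) : exists c : R, forall n,
  \sum_(m < n) iter m house_op (fun k => (k < J)%N%:R) 0%N <= c.
Proof.
have [u [c [uc Hu]]] := house_potential J; exists c => n.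
set B := fun k => (k < J)%N%:R.
suff H : forall k, \sum_(m < n) iter m house_op B k <= u k.
  by apply: le_trans (H _) _; have /andP[] := uc 0%N.
elim: n => [|n IH] k; first by rewrite big_ord0; have /andP[] := uc k.
rewrite big_ord_recl/=; apply: le_trans (Hu k); rewrite lerD2l.
apply: le_trans (house_op_le k IH).
by rewrite /house_op !mulr_sumr -big_split.
Qed.

(** Transience: [B] is at most [B 0] below level [J] and at most [eps / 2] above it, and the
    probability of being below [J] at time [l] is the general term of a convergent series. *)
Lemma house_op_iter_small (B : nat -> R) (eps : R) :
  (forall k, 0 <= B k) -> (forall k, B k.+1 <= B k) ->
  (forall e, 0 < e -> exists k, B k < e) ->
  0 < eps -> exists N, forall l, (N <= l)%N -> iter l house_op B 0%N < eps.
Proof.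
move=> B0 Bd Bs eps0; have [J BJ] := Bs _ (divr_gt0 eps0 (ltr0Sn R 1)).
have Bd' i j : (i <= j)%N -> B j <= B i.
  by move=> /subnK <-; elim: (j - i)%N => // k; apply: le_trans; exact: Bd.
pose I := fun k => (k < J)%N%:R : R.
have comp l k : iter l house_op B k <= B 0%N * iter l house_op I k + B J.
  elim: l k => [|l IH] k /=.
    rewrite /I; case: ltnP => kJ; first by rewrite mulr1 (le_trans (Bd' 0%N k _))// lerDl.
    by rewrite mulr0 add0r Bd'.
  apply: le_trans (house_op_le k IH) _.
  by rewrite /house_op; set x := iter _ _ _ _; set y := iter _ _ _ _; lra.
have [c hc] := house_op_iter_sum J.
have it0 l k : 0 <= iter l house_op I k.
  elim: l k => [|l IH] k //=.
  by rewrite /house_op addr_ge0// mulr_ge0// subr_ge0.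
have cs : cvgn (series (fun m => iter m house_op I 0%N)).
  apply: nondecreasing_is_cvgn.
    by apply: nondecreasing_series => n _ _; exact: it0.
  exists c => _ [n _ <-]; rewrite /series/= big_mkord; exact: hc.
have /cvgrPdist_lt/(_ (eps / 2 / (B 0%N + 1))) := cvg_series_cvg_0 cs.
have B1 : 0 < B 0%N + 1 by have := B0 0%N; lra.
case; first by rewrite !divr_gt0.
move=> N _ HN; exists N => l Nl; have := HN l Nl.
rewrite sub0r normrN ger0_norm// ltr_pdivlMr// => H.
apply: le_lt_trans (comp l 0%N) _.
by have := it0 l 0%N; have := B0 0%N; nra.
Qed.

Lemma house_law_ge0 M j : 0 <= house_law a M j.
Proof.
elim: M j => [|M IH] j /=; first by rewrite ler0n.
apply: sumr_ge0 => k _; rewrite mulr_ge0// /house_step.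
by case: ifP => // _; case: ifP => // _; rewrite subr_ge0.
Qed.

Lemma return_prob_summable : bounded_sums (return_prob a).
Proof.
have [u [c [uc Hu]]] := house_potential 1; exists c => n.
have u0 k : 0 <= u k by have /andP[] := uc k.
suff H : \sum_(k < n.+1) house_law a n k * u k + \sum_(m < n) return_prob a m <= u 0%N.
  apply: (@le_trans _ _ (u 0%N)); last by have /andP[] := uc 0%N.
  apply: le_trans H; rewrite lerDr sumr_ge0// => k _.
  by rewrite mulr_ge0// house_law_ge0.
elim: n => [|n IH].
  by rewrite big_ord_recl !big_ord0 !addr0/= mul1r.
apply: le_trans IH.
have -> : \sum_(k < n.+2) (\sum_(i < n.+1) house_law a n i * house_step a i k) * u k
  = \sum_(i < n.+1) house_law a n i * house_op u i.
  under eq_bigr do rewrite mulr_suml.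
  rewrite exchange_big/=; apply: eq_bigr => i _.
  under eq_bigr do rewrite -mulrA.
  rewrite -mulr_sumr; congr (_ * _).
  rewrite big_ord_recl/= {1}/house_step/= addrC /house_op.
  congr (_ + _); rewrite (bigD1 i)//= /house_step/= eqxx big1 ?addr0// => j ji.
  by rewrite /bump/= add1n eqSS (inj_eq val_inj) (negbTE ji) mul0r.
have -> : \sum_(m < n.+1) return_prob a m = \sum_(m < n) return_prob a m + house_law a n 0.
  by rewrite big_ord_recr.
rewrite addrCA [leRHS]addrC lerD2l 2!big_ord_recl/= addrAC lerD//.
  rewrite -[X in _ + X <= _]mulr1 -mulrDr ler_wpM2l ?house_law_ge0// addrC.
  exact: Hu 0%N.
apply: ler_sum => i _; rewrite ler_wpM2l ?house_law_ge0//.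
by have := Hu (lift ord0 i); rewrite /= add0r.
Qed.

End house_of_cards_potential.

(** * Trigonometric approximation and convergence in distribution *)

Section trigo_bounds.
Context {R : realType}.
Implicit Types x y : R.

Lemma sin_lipschitz x y : `|sin x - sin y| <= `|x - y|.
Proof.
wlog xy : x y / y <= x.
  by move=> H; have [/H//|/ltW/H] := leP y x; rewrite distrC [leRHS]distrC.
have [|z _ ->] := @MVT_segment R sin cos y x xy.
- exact/continuous_subspaceT/continuous_sin.
- by rewrite normrM ler_piMl// cos_max.
Qed.

Lemma cos_lipschitz x y : `|cos x - cos y| <= `|x - y|.
Proof. by rewrite -2!sinDpihalf (le_trans (sin_lipschitz _ _))// opprD addrACA subrr addr0. Qed.

Lemma norm_sin_le x : `|sin x| <= `|x|.
Proof. by have := sin_lipschitz x 0; rewrite sin0 !subr0. Qed.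

Lemma cos_ge_quad x : 1 - x ^+ 2 / 2 <= cos x.
Proof.
have -> : cos x = 1 - 2 * sin (x / 2) ^+ 2.
  rewrite {1}(splitr x) cosD -!expr2 cos2sin2; ring.
have : sin (x / 2) ^+ 2 <= (x / 2) ^+ 2.
  by rewrite -[leLHS]real_normK ?num_real// -[leRHS]real_normK ?num_real// lerXn2r ?nnegrE// norm_sin_le.
set s := sin _; have -> : (x / 2) ^+ 2 = x ^+ 2 / 4 by field.
lra.
Qed.

Lemma sin_taylor x : `|sin x - x| <= `|x| ^+ 3 / 2.
Proof.
wlog x0 : x / 0 <= x.
  move=> H; have [/H//|/ltW x0] := leP 0 x.
  have := H (- x); rewrite oppr_ge0 => /(_ x0).
  by rewrite sinN -opprD !normrN.
have [|z + E] := @MVT_segment R (fun x => sin x - x) (fun x => cos x - 1) 0 x x0.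
- apply: continuous_subspaceT => z; apply: cvgB; [exact: continuous_sin|exact: cvg_id].
- rewrite in_itv/= => /andP[z0 zx].
  move: E; rewrite sin0 !subr0 => ->; rewrite normrM exprSr mulrAC ler_wpM2r//.
  rewrite distrC ger0_norm ?subr_ge0 ?cos_le1//.
  have := cos_ge_quad z; have : z ^+ 2 <= x ^+ 2 by rewrite lerXn2r// nnegrE.
  by rewrite ger0_norm//; lra.
Qed.

Lemma cos_taylor x : `|cos x - (1 - x ^+ 2 / 2)| <= `|x| ^+ 3.
Proof.
wlog x0 : x / 0 <= x.
  move=> H; have [/H//|/ltW x0] := leP 0 x.
  have := H (- x); rewrite oppr_ge0 => /(_ x0).
  by rewrite cosN sqrrN normrN.
have [||z + E] := @MVT_segment R (fun x => cos x - (1 - x ^+ 2 / 2)) (fun x => x - sin x) 0 x x0.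
- move=> z _; apply: is_derive_eq.
  by rewrite /GRing.scale/=; field.
- apply: continuous_subspaceT => z; apply: cvgB; first exact: continuous_cos.
  apply: cvgB; first exact: cvg_cst.
  by apply: cvgMr_tmp; exact: sqr_continuous.
- rewrite in_itv/= => /andP[z0 zx].
  move: E; rewrite cos0 expr0n/= mul0r !subr0 subrr subr0 => ->.
  rewrite normrM exprSr ler_wpM2r// distrC (@le_trans _ _ (z ^+ 2))//; last first.
    by rewrite ger0_norm// lerXn2r// nnegrE.
  have := sin_taylor z; have := norm_sin_le z; have := ler_normB (sin z) z.
  rewrite (ger0_norm z0); have [z2|/ltW z2] := leP z 2 => ? ? ?.
    have : z ^+ 3 <= 2 * z ^+ 2 by rewrite exprS ler_wpM2r// sqr_ge0.
    lra.
  have : 2 * z <= z ^+ 2 by rewrite expr2 ler_wpM2r.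
  lra.
Qed.

Lemma cos_add_taylor x d :
  `|cos (x + d) - (cos x * (1 - d ^+ 2 / 2) - sin x * d)| <= 2 * `|d| ^+ 3.
Proof.
have -> : cos (x + d) - (cos x * (1 - d ^+ 2 / 2) - sin x * d) =
   cos x * (cos d - (1 - d ^+ 2 / 2)) - sin x * (sin d - d) by rewrite cosD; ring.
rewrite (le_trans (ler_normB _ _))// !normrM mulr_natl mulr2n lerD//.
  by rewrite (le_trans _ (cos_taylor d))// ler_piMl// cos_max.
rewrite (le_trans _ (_ : `|d| ^+ 3 / 2 <= _)) ?ler_pdivrMr ?ler_peMr ?exprn_ge0 ?ler1n//.
by rewrite (le_trans _ (sin_taylor d))// ler_piMl// sin_max.
Qed.

(** On [[-1, 1]] the derivative [cos] is at least 1/2, by [cos_ge_quad]. *)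
Lemma sin_expanding x y : `|x| <= 1 -> `|y| <= 1 -> `|x - y| <= 2 * `|sin x - sin y|.
Proof.
move=> + +; wlog xy : x y / y <= x.
  move=> H x1 y1; have [/H|/ltW/H] := leP y x; first exact.
  by rewrite distrC [`|sin y - _|]distrC; apply.
move=> x1 y1; have [|z + E] := @MVT_segment R sin cos y x xy.
- exact/continuous_subspaceT/continuous_sin.
- rewrite in_itv/= E normrM mulrA => /andP[yz zx]; rewrite ler_peMl//.
  have z1 : `|z| <= 1.
    by move: x1 y1; rewrite !ler_norml => /andP[? ?] /andP[? ?]; apply/andP; split; lra.
  have : z ^+ 2 <= 1 by rewrite -real_normK ?num_real// expr_le1.
  have := cos_ge_quad z; have := ler_norm (cos z); lra.
Qed.

End trigo_bounds.

Section bernstein.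
Context {R : realType}.

(* Bernstein polynomials by de Casteljau's recursion: [bern n h x] is
   [\sum_k 'C(n, k) x^k (1 - x)^(n - k) h k]. *)
Fixpoint bern (n : nat) (h : nat -> R) (x : R) : R :=
  if n is n'.+1 then (1 - x) * bern n' h x + x * bern n' (fun k => h k.+1) x else h 0%N.

Lemma bern_le n h h' x : 0 <= x <= 1 -> (forall k, (k <= n)%N -> h k <= h' k) ->
  bern n h x <= bern n h' x.
Proof.
move=> /andP[x0 x1]; elim: n h h' => [|n IH] h h' hh /=; first exact: hh.
rewrite lerD// ler_wpM2l ?subr_ge0//; apply: IH => k kn; apply: hh => //.
exact: leqW.
Qed.

Lemma bern_linear n h h' (c c' : R) x :
  bern n (fun k => c * h k + c' * h' k) x = c * bern n h x + c' * bern n h' x.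
Proof. elim: n h h' => [|n IH] h h' //=; rewrite !IH; ring. Qed.

Lemma bern_cst n c x : bern n (fun=> c) x = c.
Proof. elim: n => [|n IH] //=; rewrite IH; ring. Qed.

(** The second moment of a binomial variable shifted by [d], as variance plus squared mean. The
    shift is what the recursion of [bern] needs. *)
Lemma bern_sqr n (d x : R) :
  bern n (fun k => (k%:R + d) ^+ 2) x = n%:R * x * (1 - x) + (n%:R * x + d) ^+ 2.
Proof.
elim: n d => [|n IH] d /=; first ring.
have -> : (fun k => (k.+1%:R + d) ^+ 2) = (fun k => (k%:R + (d + 1)) ^+ 2).
  by apply/funext => k; rewrite -natr1 -addrA [1 + d]addrC.
by rewrite !IH -natr1; ring.
Qed.

(** Chebyshev's inequality: within distance [d] of [x] the error is at most [e]; elsewhere [2 M] is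
    at most [c] times the squared deviation [q k], whose binomial mean is [n x (1 - x)]. *)
Lemma bern_approx (phi : R -> R) (M e d : R) (n : nat) x :
  (forall y, `|phi y| <= M) -> 0 < d -> 0 <= e ->
  (forall y z, `|y - z| < d -> `|phi y - phi z| <= e) -> 0 <= x <= 1 ->
  (0 < n)%N ->
  `|bern n (fun k => phi (k%:R / n%:R)) x - phi x| <= e + 2 * M / (n%:R * d ^+ 2).
Proof.
move=> phiM d0 e0 phid x01 n0.
have nR : 0 < n%:R :> R by rewrite ltr0n.
have M0 : 0 <= M := le_trans (normr_ge0 _) (phiM 0).
pose q k := (k%:R + - (n%:R * x)) ^+ 2 : R.
pose c := 2 * M / (n%:R * d) ^+ 2.
have nd0 : 0 < (n%:R * d) ^+ 2 by rewrite exprn_gt0// mulr_gt0.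
have c0 : 0 <= c by rewrite divr_ge0 ?(ltW nd0)// mulr_ge0.
have bq : bern n q x <= n%:R.
  rewrite /q bern_sqr subrr expr0n addr0/= -mulrA ler_piMr ?ler0n//.
  by case/andP: x01; nra.
have H (k : nat) : `|phi (k%:R / n%:R) - phi x| <= e * 1 + c * q k.
  have [kd|kd] := ltP `|k%:R / n%:R - x| d.
    by rewrite mulr1 (le_trans (phid _ _ kd))// lerDl mulr_ge0// sqr_ge0.
  rewrite (le_trans (ler_normB _ _))// (le_trans (lerD (phiM _) (phiM _)))//.
  rewrite mulr1 -[leLHS]add0r lerD// /c /q.
  have -> : k%:R - n%:R * x = n%:R * (k%:R / n%:R - x) by field; rewrite gt_eqF.
  set t := _ - x in kd *.
  have t2 : d ^+ 2 <= t ^+ 2.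
    by rewrite -[leRHS]real_normK ?num_real// lerXn2r ?nnegrE ?(ltW d0).
  rewrite mulrAC ler_pdivlMr// !exprMn.
  have n2 : 0 <= n%:R ^+ 2 :> R by rewrite sqr_ge0.
  have -> : M + M = 2 * M by ring.
  by rewrite ler_wpM2l ?mulr_ge0// ler_wpM2l.
have E : bern n (fun k => phi (k%:R / n%:R)) x - phi x =
    bern n (fun k => 1 * phi (k%:R / n%:R) + (- phi x) * 1) x.
  by rewrite bern_linear bern_cst; ring.
have up : e * 1 + c * bern n q x <= e + 2 * M / (n%:R * d ^+ 2).
  rewrite mulr1 lerD2l (le_trans (ler_wpM2l c0 bq))// /c.
  by rewrite le_eqVlt; apply/orP; left; apply/eqP; field; rewrite !gt_eqF.
rewrite E ler_norml; apply/andP; split; last first.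
  apply: le_trans up; rewrite -[in leRHS](bern_cst n 1 x) -bern_linear.
  apply: bern_le => // k _; have := H k; have := ler_norm (phi (k%:R / n%:R) - phi x); lra.
rewrite lerNl; apply: le_trans up; rewrite -[in leRHS](bern_cst n 1 x) -bern_linear.
have -> (h : nat -> R) : - bern n h x = bern n (fun k => (-1) * h k + 0 * 0) x.
  by rewrite (bern_linear n h (fun=> 0)); ring.
apply: bern_le => // k _; have := H k.
have := ler_norm (- (phi (k%:R / n%:R) - phi x)); rewrite normrN; lra.
Qed.

End bernstein.

Section trigonometric_polynomials.
Context {R : realType}.

(** Frequencies are arbitrary reals and the phase [c] accounts for the sines. By linearity,
    convergence of the means of all [cos (t * Y + c)] extends to this class. *)
Inductive trigpoly : (R -> R) -> Prop :=
| trigpoly_cos t c : trigpoly (fun x => cos (t * x + c))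
| trigpoly_linear a p b q : trigpoly p -> trigpoly q ->
    trigpoly (fun x => a * p x + b * q x).

Lemma trigpoly_cst (c : R) : trigpoly (fun=> c).
Proof.
have H := trigpoly_linear c 0 (trigpoly_cos 0 0) (trigpoly_cos 0 0).
apply: eq_ind H _ _; apply/funext => x.
by rewrite mul0r add0r cos0; ring.
Qed.

Lemma trigpoly_mul_sin (b : R) p : trigpoly p -> trigpoly (fun x => sin (b * x) * p x).
Proof.
elim => [t c|a {}p a' q _ IHp _ IHq].
  have H := trigpoly_linear (- 1 / 2) (1 / 2)
     (trigpoly_cos (t + b) (c + pi / 2)) (trigpoly_cos (t - b) (c + pi / 2)).
  apply: eq_ind H _ _; apply/funext => x.
  rewrite !addrA !cosDpihalf.
  have -> : (t + b) * x + c = (t * x + c) + b * x by ring.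
  have -> : (t - b) * x + c = (t * x + c) - b * x by ring.
  by rewrite sinD sinB; field.
apply: eq_ind (trigpoly_linear a a' IHp IHq) _ _; apply/funext => x; ring.
Qed.

Lemma trigpoly_bern n h b : trigpoly (fun x => bern n h ((1 + sin (b * x)) / 2)).
Proof.
elim: n h => [|n IH] h; first exact: trigpoly_cst.
have H1 := trigpoly_linear (1 / 2) (1 / 2) (IH h) (IH (fun k => h k.+1)).
have H2 := trigpoly_linear (- 1 / 2) (1 / 2)
   (trigpoly_mul_sin b (IH h)) (trigpoly_mul_sin b (IH (fun k => h k.+1))).
apply: eq_ind (trigpoly_linear 1 1 H1 H2) _ _; by apply/funext => x /=; field.
Qed.

Lemma bern_bounded n h (M x : R) : 0 <= x <= 1 -> (forall k, `|h k| <= M) ->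
  `|bern n h x| <= M.
Proof.
move=> x01 hM; rewrite ler_norml -[X in X <= _ <= _](bern_cst n _ x).
rewrite -[X in _ <= _ <= X](bern_cst n _ x); apply/andP.
by split; apply: bern_le => // k _; have := hM k; rewrite ler_norml => /andP[].
Qed.

Lemma uniformly_continuous_segment (h : R -> R) (A e : R) : continuous h -> 0 < e ->
  exists2 d, 0 < d &
    forall x y, `|x| <= A -> `|x - y| < d -> `|h x - h y| < e.
Proof.
move=> ch e0.
have /compact_near_coveringP ncA := @segment_compact R (- A) A.
have := ncA R 0^'+ (fun d x => forall y, `|x - y| < d -> `|h x - h y| < e) _.
case; last first.
  move=> d /= d0 H; exists (d / 2); first exact: divr_gt0.
  move=> x y xA; apply: (H (d / 2)).
  + by rewrite /ball_/= sub0r normrN gtr0_norm ?divr_gt0// ltr_pdivrMr// ltr_pMr// ltr1n.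
  + exact: divr_gt0.
  + by rewrite /= in_itv/= -ler_norml.
move=> x _; have /cvgrPdist_lt/(_ (e / 2)) := ch x.
case; first exact: divr_gt0.
move=> r /= r0 H.
exists (ball x (r / 2), [set d | 0 < d < r / 2]) => /=.
  split; first by apply: nbhsx_ballx; exact: divr_gt0.
  exists (r / 2); first exact: divr_gt0.
  move=> d; rewrite /ball_/= sub0r normrN => dr d0; rewrite d0/=.
  by rewrite gtr0_norm in dr.
case=> x' d [] /= xx' /andP[d0 dr] y yd.
have := H x' _; have := H y _; rewrite /ball_/=.
move: xx'; rewrite /ball/= => xx'.
have h1 : `|x - x'| < r by lra.
have h2 : `|x - y| < r.
  by rewrite (le_lt_trans (ler_distD x' _ _))//; lra.
move=> /(_ h2) H2 /(_ h1) H1.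
rewrite (le_lt_trans (ler_distD (h x) _ _))//.
by rewrite [`|h x' - _|]distrC; lra.
Qed.

(* The arcsine of the argument clipped to [-sin 1, sin 1]. *)
Lemma sin_lipschitz_inverse : exists u : R -> R,
  [/\ forall s, `|u s| <= 1, forall s t, `|u s - u t| <= 2 * `|s - t|
     & forall x, `|x| <= 1 -> u (sin x) = x].
Proof.
have pi1 := @pihalf_ge1 R.
have s1 : 0 < sin 1 :> R.
  by rewrite -sin0 ltr_sin ?in_itv/= ?ltr01// ?pi1 ?andbT; lra.
have s1' : sin 1 <= 1 :> R by exact: sin_le1.
pose clip (s : R) := Num.max (- sin 1) (Num.min s (sin 1)).
have clip1 s : - sin 1 <= clip s <= sin 1.
  by rewrite /clip le_max lexx/= ge_max ge_min lexx orbT andbT; lra.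
have clipL s t : `|clip s - clip t| <= `|s - t|.
  wlog ts : s t / t <= s.
    by move=> H; have [/H//|/ltW/H] := leP t s; rewrite distrC [leRHS]distrC.
  rewrite [leRHS]ger0_norm ?subr_ge0// /clip !maxEle !minEle ler_norml.
  by apply/andP; split; repeat case: ifPn => //; rewrite -?ltNge; lra.
have asin_clip s : sin (asin (clip s)) = clip s /\ `|asin (clip s)| <= 1.
  have /andP[c1 c2] := clip1 s.
  have [/andP[a1 a2] a3] : - (pi / 2) <= asin (clip s) <= pi / 2 /\ sin (asin (clip s)) = clip s.
    by apply: asin_def; apply/andP; split; lra.
  split=> //; rewrite ler_norml; apply/andP; split; rewrite leNgt; apply/negP => H.
  - have : sin (asin (clip s)) < sin (- 1).
      by rewrite ltr_sin// in_itv/=; apply/andP; split; lra.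
    rewrite a3 sinN; lra.
  - have : sin 1 < sin (asin (clip s)).
      by rewrite ltr_sin// in_itv/=; apply/andP; split; lra.
    rewrite a3; lra.
exists (fun s => asin (clip s)); split.
- by move=> s; case: (asin_clip s).
- move=> s t; have [e1 l1] := asin_clip s; have [e2 l2] := asin_clip t.
  have := sin_expanding l1 l2; rewrite e1 e2 => /le_trans; apply.
  by rewrite ler_pM2l.
- move=> x; rewrite ler_norml => /andP[u1 u2].
  have -> : clip (sin x) = sin x.
    have h1 : sin x <= sin 1.
      by rewrite leNgt ltr_sin ?in_itv/= -?leNgt//; apply/andP; split; lra.
    have h2 : - sin 1 <= sin x.
      by rewrite -sinN leNgt ltr_sin ?in_itv/= -?leNgt//; apply/andP; split; lra.
    by rewrite /clip (min_idPl h1) (max_idPr h2).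
  by rewrite sinK// in_itv/=; apply/andP; split; lra.
Qed.

(** The Bernstein polynomial is evaluated at [(1 + sin (x / A)) / 2], which lies in [[0, 1]] for
    every real [x]. The approximant is therefore trigonometric and inherits the bound [M] on the
    whole line, while [phi] undoes the substitution for [x] in [[- A, A]]. *)
Lemma trigpoly_approx (h : R -> R) (A e M : R) : continuous h -> 0 < A -> 0 < e ->
  (forall x, `|h x| <= M) ->
  exists2 p, trigpoly p & (forall x, `|p x| <= M) /\
    forall x, `|x| <= A -> `|p x - h x| <= e.
Proof.
move=> ch A0 e0 hM.
have M0 : 0 <= M := le_trans (normr_ge0 _) (hM 0).
have [u [u1 uL us]] := sin_lipschitz_inverse.
pose phi y := h (A * u (2 * y - 1)).
have e20 : 0 < e / 2 by rewrite divr_gt0.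
have [d d0 hd] := @uniformly_continuous_segment h A (e / 2) ch e20.
have phiM y : `|phi y| <= M by exact: hM.
have [d' d'0 phid] : exists2 d', 0 < d' &
    forall y z, `|y - z| < d' -> `|phi y - phi z| <= e / 2.
  (* [4 A] is a Lipschitz constant of [y |-> A * u (2 y - 1)]. *)
  exists (d / (4 * A)); first by rewrite divr_gt0// mulr_gt0.
  move=> y z; rewrite ltr_pdivlMr ?mulr_gt0// => yz; apply/ltW/hd.
    by rewrite normrM gtr0_norm// ler_piMr ?(ltW A0).
  rewrite -mulrBr normrM gtr0_norm//.
  apply: le_lt_trans (ler_wpM2l (ltW A0) (uL _ _)) _.
  have -> : 2 * y - 1 - (2 * z - 1) = 2 * (y - z) by ring.
  rewrite normrM gtr0_norm//; apply: le_lt_trans yz; lra.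
have d20 : 0 < d' ^+ 2 by rewrite exprn_gt0.
have [n n0 nP] : exists2 n, (0 < n)%N & 2 * M / (n%:R * d' ^+ 2) <= e / 2.
  exists (Num.truncn (2 * M / (d' ^+ 2 * (e / 2)))).+1 => //.
  set n := (Num.truncn _).+1; have n0 : 0 < n%:R :> R by rewrite ltr0n.
  rewrite ler_pdivrMr ?(mulr_gt0 n0 d20)// mulrCA -ler_pdivrMr ?(mulr_gt0 e20 d20)//.
  by rewrite [_ / 2 * _]mulrC; apply/ltW; exact: truncnS_gt.
have sx (x : R) : 0 <= (1 + sin x) / 2 <= 1.
  by have := sin_geN1 x; have := sin_le1 x; move=> ? ?; apply/andP; split; lra.
exists (fun x => bern n (fun k => phi (k%:R / n%:R)) ((1 + sin (A^-1 * x)) / 2)).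
  exact: trigpoly_bern.
split=> [x|x xA]; first exact: bern_bounded.
have <- : phi ((1 + sin (A^-1 * x)) / 2) = h x.
  rewrite /phi; have -> : 2 * ((1 + sin (A^-1 * x)) / 2) - 1 = sin (A^-1 * x) by field.
  rewrite us; first by rewrite mulrA mulfV ?gt_eqF// mul1r.
  by rewrite normrM gtr0_norm ?invr_gt0// ler_pdivrMl// mulr1.
apply: le_trans (bern_approx phiM d'0 (ltW e20) phid (sx _) n0) _.
by rewrite [leRHS](splitr e) lerD2l.
Qed.

Lemma trigpoly_continuous p : trigpoly p -> continuous p.
Proof.
elim => [t c|a {}p b q _ cp _ cq] x.
  apply: continuous_comp; last exact: continuous_cos.
  apply: cvgD; last exact: cvg_cst.
  by apply: cvgMl_tmp; exact: cvg_id.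
by apply: cvgD; [apply: cvgMl_tmp; exact: cp|apply: cvgMl_tmp; exact: cq].
Qed.

Lemma trigpoly_bounded p : trigpoly p -> exists M, forall x, `|p x| <= M.
Proof.
elim => [t c|a {}p b q _ [Mp cp] _ [Mq cq]].
  by exists 1 => x; exact: cos_max.
exists (`|a| * Mp + `|b| * Mq) => x.
by rewrite (le_trans (ler_normD _ _))// !normrM lerD// ler_wpM2l.
Qed.

End trigonometric_polynomials.

(** * Real-valued integrals of bounded functions *)

Section bounded_measurable_functions.
Context d (W : measurableType d) (R : realType).
Implicit Types f g : W -> R.

Definition bounded_measurable f :=
  measurable_fun [set: W] f /\ exists M, forall w, `|f w| <= M.

Lemma bounded_measurable_cst c : bounded_measurable (cst c).
Proof. by split; [exact: measurable_cst|exists `|c|]. Qed.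

Lemma bounded_measurableD f g :
  bounded_measurable f -> bounded_measurable g -> bounded_measurable (fun x => f x + g x).
Proof.
move=> [mf [M fM]] [mg [N gN]]; split; first exact: measurable_funD.
by exists (M + N) => x; rewrite (le_trans (ler_normD _ _))// lerD.
Qed.

Lemma bounded_measurableM f g :
  bounded_measurable f -> bounded_measurable g -> bounded_measurable (fun x => f x * g x).
Proof.
move=> [mf [M fM]] [mg [N gN]]; split; first exact: measurable_funM.
by exists (M * N) => x; rewrite normrM ler_pM.
Qed.

Lemma bounded_measurableZ c f :
  bounded_measurable f -> bounded_measurable (fun x => c * f x).
Proof. by apply: bounded_measurableM; exact: bounded_measurable_cst. Qed.

Lemma bounded_measurableB f g :
  bounded_measurable f -> bounded_measurable g -> bounded_measurable (fun x => f x - g x).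
Proof.
move=> [mf [M fM]] [mg [N gN]]; split; first exact: measurable_funB.
by exists (M + N) => x; rewrite (le_trans (ler_normB _ _))// lerD.
Qed.

Lemma bounded_measurable_norm f : bounded_measurable f -> bounded_measurable (fun x => `|f x|).
Proof.
move=> [mf [M fM]]; split; first exact: measurableT_comp.
by exists M => x; rewrite normr_id.
Qed.

Lemma bounded_measurable_sum (I : Type) (r : seq I) (F : I -> W -> R) :
  (forall i, bounded_measurable (F i)) -> bounded_measurable (fun x => \sum_(i <- r) F i x).
Proof.
move=> bF; elim: r => [|i r IH].
  by under eq_fun do rewrite big_nil; exact: bounded_measurable_cst.
by under eq_fun do rewrite big_cons; exact: bounded_measurableD.
Qed.

Lemma bounded_measurable_continuous (h : R -> R) f : continuous h ->
  (exists M, forall x, `|h x| <= M) -> measurable_fun setT f ->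
  bounded_measurable (fun x => h (f x)).
Proof.
move=> ch [M hM] mf; split; last by exists M.
by apply: measurableT_comp => //; exact: continuous_measurable_fun.
Qed.

Lemma bounded_measurable_cos f : measurable_fun setT f -> bounded_measurable (fun x => cos (f x)).
Proof.
apply: bounded_measurable_continuous; first exact: continuous_cos.
by exists 1; exact: cos_max.
Qed.

Lemma bounded_measurable_integrable (Q : probability W R) f :
  bounded_measurable f -> Q.-integrable setT (EFin \o f).
Proof.
move=> [mf [M fM]]; apply: measurable_bounded_integrable => //.
  by rewrite (le_lt_trans (probability_le1 _ _)) ?ltry.
exists M; split; first exact: num_real.
by move=> x /ltW Mx w _; exact: le_trans Mx.
Qed.

Lemma bounded_measurable_indic (A : set W) : measurable A -> bounded_measurable (\1_A : W -> R).
Proof.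
move=> mA; split; first exact: measurable_indic.
by exists 1 => w; rewrite indicE; case: (_ \in _); rewrite ?normr1 ?normr0.
Qed.

Variable Q : probability W R.

Lemma RintegralE f : bounded_measurable f -> ((\int[Q]_x f x)%:E = \int[Q]_x (f x)%:E)%E.
Proof.
move=> bf; rewrite /Rintegral fineK//.
by apply: integrable_fin_num => //; exact: bounded_measurable_integrable.
Qed.

Lemma Rintegral_linear c c' f g : bounded_measurable f -> bounded_measurable g ->
  \int[Q]_x (c * f x + c' * g x) = c * \int[Q]_x f x + c' * \int[Q]_x g x.
Proof.
move=> bf bg; rewrite RintegralD//; last 2 first.
- exact/bounded_measurable_integrable/bounded_measurableZ.
- exact/bounded_measurable_integrable/bounded_measurableZ.
by rewrite !RintegralZl//; exact: bounded_measurable_integrable.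
Qed.

Lemma Rintegral_prob_cst c : \int[Q]_x c = c.
Proof. rewrite /Rintegral integral_cst// (_ : (_ * _)%E = c%:E)//.
by rewrite -[RHS]mule1; congr (_ * _)%E; exact: probability_setT. Qed.

Lemma Rintegral_le f g : bounded_measurable f -> bounded_measurable g ->
  (forall x, f x <= g x) -> \int[Q]_x f x <= \int[Q]_x g x.
Proof. by move=> bf bg fg; apply: le_Rintegral => //; exact: bounded_measurable_integrable. Qed.

Lemma Rintegral_dist f g h : bounded_measurable f -> bounded_measurable g ->
  bounded_measurable h ->
  (forall x, `|f x - g x| <= h x) -> `|\int[Q]_x f x - \int[Q]_x g x| <= \int[Q]_x h x.
Proof.
move=> bf bg bh fgh; rewrite -RintegralB//; try exact: bounded_measurable_integrable.
have bfg := bounded_measurableB bf bg.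
rewrite (le_trans (le_normr_Rintegral _ _))//; first exact: bounded_measurable_integrable.
by apply: Rintegral_le => //; exact: bounded_measurable_norm.
Qed.

Lemma Rintegral_dist_cst f g (e : R) : bounded_measurable f -> bounded_measurable g ->
  (forall x, `|f x - g x| <= e) -> `|\int[Q]_x f x - \int[Q]_x g x| <= e.
Proof.
move=> bf bg fg; rewrite -[leRHS]Rintegral_prob_cst; apply: Rintegral_dist => //.
exact: bounded_measurable_cst.
Qed.

Lemma Rintegral_indic (A : set W) : measurable A -> (\int[Q]_x (\1_A x))%:E = Q A.
Proof.
by move=> mA; rewrite RintegralE ?integral_indic ?setIT//; exact: bounded_measurable_indic.
Qed.

End bounded_measurable_functions.

Section weak_convergence.
Context {R : realType}.

Lemma measurable_norm_gt d (W : measurableType d) (Y : W -> R) A :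
  measurable_fun setT Y -> measurable [set w | A < `|Y w|].
Proof.
move=> mY; have -> : [set w | A < `|Y w|] = (fun w => `|Y w|) @^-1` `]A, +oo[.
  by apply/seteqP; split => w; rewrite /= in_itv/= andbT.
have mn : measurable_fun setT (fun w => `|Y w|) by exact: measurableT_comp.
by rewrite -[_ @^-1` _]setTI; exact: mn.
Qed.

(** The error is at most [e] where [|Y| <= A] and at most [2 M] on the remaining event, which has
    probability at most [e]. *)
Lemma Rintegral_trigpoly_approx d (W : measurableType d) (Q : probability W R)
   (Y : W -> R) (h p : R -> R) (A e M : R) :
  measurable_fun setT Y -> continuous h -> trigpoly p -> 0 < A -> 0 < e ->
  (forall x, `|h x| <= M) -> (forall x, `|p x| <= M) ->
  (forall x, `|x| <= A -> `|p x - h x| <= e) ->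
  (Q [set w | (A < `|Y w|)%R] <= e%:E)%E ->
  `|\int[Q]_w p (Y w) - \int[Q]_w h (Y w)| <= e + 2 * M * e.
Proof.
move=> mY ch tp A0 e0 hM pM ph QA.
have M0 : 0 <= M := le_trans (normr_ge0 _) (hM 0).
set B := [set w | _] in QA.
have mB : measurable B by exact: measurable_norm_gt.
have b1 := @bounded_measurable_indic _ _ R _ mB.
have bp : bounded_measurable (fun w => p (Y w)).
  by apply: bounded_measurable_continuous => //; [exact: trigpoly_continuous|exists M].
have bh : bounded_measurable (fun w => h (Y w)).
  by apply: bounded_measurable_continuous => //; exists M.
apply: (@le_trans _ _ (\int[Q]_w (e * cst 1 w + 2 * M * \1_B w))).
  apply: Rintegral_dist => //.
    apply: bounded_measurableD; first exact/bounded_measurableZ/bounded_measurable_cst.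
    exact/bounded_measurableZ.
  move=> w; rewrite /cst/= mulr1 indicE; have [YA|YA] := leP `|Y w| A.
    by rewrite memNset ?mulr0 ?addr0 ?ph// /B/= ltNge YA.
  rewrite mem_set//= mulr1 (le_trans (ler_normB _ _))// -[leLHS]add0r lerD ?(ltW e0)//.
  by rewrite mulr_natl mulr2n lerD.
rewrite Rintegral_linear//; last exact: bounded_measurable_cst.
rewrite Rintegral_prob_cst mulr1 lerD2l ler_wpM2l ?mulr_ge0//.
by rewrite -lee_fin Rintegral_indic.
Qed.

Lemma probability_real_tight (mu : probability (measurableTypeR R) R) (e : R) : 0 < e ->
  exists2 A, 0 < A & (mu [set x | (A < `|x|)%R] <= e%:E)%E.
Proof.
move=> e0; pose F n : set (measurableTypeR R) := [set x | n.+1%:R < `|x|].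
have mu1 (B : set (measurableTypeR R)) : measurable B -> (mu B <= 1)%E.
  by move=> mB; exact: probability_le1.
have mF n : measurable (F n) by exact: (measurable_norm_gt (Y := id)).
have F0 : \bigcap_n F n = set0.
  apply/seteqP; split => // x /(_ (Num.truncn `|x|) I); rewrite /F/=.
  by rewrite ltNge => /negP; apply; apply/ltW; exact: truncnS_gt.
have : mu \o F @ \oo --> mu (\bigcap_n F n).
  apply: nonincreasing_cvg_mu => //.
  - by apply: (@le_lt_trans _ _ 1%E); [exact: mu1|rewrite ltry].
  - by rewrite F0.
  - move=> n m nm; apply/subsetPset => x; rewrite /F/=; apply: le_lt_trans.
    by rewrite ler_nat.
rewrite F0 measure0 => /fine_cvgP[_ /cvgrPdist_le/(_ e e0)[N _ /(_ N (leqnn N))]] /=.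
rewrite sub0r normrN => H; exists N.+1%:R; first exact: ltr0Sn.
have fF : mu (F N) \is a fin_num by rewrite fin_num_measure.
rewrite -/(F N) -(fineK fF) lee_fin; apply: le_trans H; exact: ler_norm.
Qed.

(** A continuity theorem in which tightness is a hypothesis: a test function is replaced by a
    trigonometric polynomial on one window [[- A, A]] that serves all the [Y n] and the limit law,
    and tightness bounds what happens outside. *)
Lemma cvg_in_distribution_cos d (W : measurableType d) (Q : probability W R)
    (Y : nat -> W -> R) (mu : probability (measurableTypeR R) R) :
  (forall n, measurable_fun setT (Y n)) ->
  (forall e, 0 < e -> exists2 A, 0 < A & forall n, (Q [set w | (A < `|Y n w|)%R] <= e%:E)%E) ->
  (forall t c, \int[Q]_w cos (t * Y n w + c) @[n --> \oo] --> \int[mu]_x cos (t * x + c)) ->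
  cvg_in_distribution Q Y mu.
Proof.
move=> mY tY ccos h ch [M hM].
have M0 : 0 <= M := le_trans (normr_ge0 _) (hM 0).
have mid : measurable_fun setT (fun x : measurableTypeR R => x) by exact: measurable_id.
have bp p n : trigpoly p -> bounded_measurable (fun w => p (Y n w)).
  move=> tp; apply: bounded_measurable_continuous => //; first exact: trigpoly_continuous.
  exact: trigpoly_bounded.
have bpm p : trigpoly p -> bounded_measurable (fun x : measurableTypeR R => p x).
  move=> tp; apply: (bounded_measurable_continuous _ _ mid); first exact: trigpoly_continuous.
  exact: trigpoly_bounded.
have bh n : bounded_measurable (fun w => h (Y n w)).
  by apply: bounded_measurable_continuous => //; exists M.
have bhm : bounded_measurable (fun x : measurableTypeR R => h x).
  by apply: (bounded_measurable_continuous _ _ mid) => //; exists M.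
rewrite -(RintegralE mu bhm).
rewrite unlock; under eq_fun do rewrite -(RintegralE Q (bh _)).
apply: cvg_EFin; first exact: nearW.
rewrite [fine \o _](_ : _ = fun n => \int[Q]_w h (Y n w)); last exact/funext.
have cp p : trigpoly p -> \int[Q]_w p (Y n w) @[n --> \oo] --> \int[mu]_x p x.
  elim => [t c|a {}p b q tp cp tq cq]; first exact: ccos.
  under eq_fun do rewrite (Rintegral_linear _ _ _ (bp _ _ tp) (bp _ _ tq)).
  rewrite (Rintegral_linear _ _ _ (bpm _ tp) (bpm _ tq)).
  by apply: cvgD; apply: cvgMl_tmp.
apply/cvgrPdist_le => e e0.
pose e' := e / (3 * (1 + 2 * M)).
have e'0 : 0 < e' by rewrite divr_gt0// mulr_gt0//; lra.
have e'E : e' + 2 * M * e' = e / 3 by rewrite /e'; field; lra.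
have [A1 A10 QA] := tY _ e'0; have [A2 A20 muA] := probability_real_tight mu e'0.
pose A := Num.max A1 A2.
have A0 : 0 < A by rewrite lt_max A10.
have [p tp [pM pA]] := trigpoly_approx ch A0 e'0 hM.
have /cvgrPdist_le/(_ (e / 3)) := cp _ tp.
case; first by rewrite divr_gt0.
move=> N _ HN; exists N => // n /HN H /=.
have h1 : `|\int[Q]_w p (Y n w) - \int[Q]_w h (Y n w)| <= e / 3.
  rewrite -e'E; apply: (Rintegral_trigpoly_approx (A := A)) => //.
  apply: le_trans (QA n); apply: le_measure; rewrite ?inE; try exact: measurable_norm_gt.
  by move=> w /=; apply: le_lt_trans; rewrite le_max lexx.
have h2 : `|\int[mu]_w p w - \int[mu]_w h w| <= e / 3.
  rewrite -e'E; apply: (Rintegral_trigpoly_approx mid ch tp A0) => //.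
  apply: le_trans muA; apply: le_measure; rewrite ?inE; try exact: (measurable_norm_gt (Y := id)).
  by move=> w /=; apply: le_lt_trans; rewrite le_max lexx orbT.
move: H h1 h2; rewrite !ler_norml => /andP[? ?] /andP[? ?] /andP[? ?].
by apply/andP; split; lra.
Qed.

End weak_convergence.

(** The range is cut into slices of height [e]. This carries identities between integrals from
    indicators to bounded functions: for the normal density, for the independence of blocks, and for
    their common law. *)
Lemma simple_approximation (R : realType) (W : Type) (f : W -> R) (M e : R) :
  0 < e -> (forall w, `|f w| <= M) ->
  exists s : seq (R * interval R),
    forall w, `|f w - \sum_(cA <- s) cA.1 * \1_(f @^-1` [set` cA.2]) w| <= e.
Proof.
move=> e0 fM; pose k w := Num.truncn ((f w + M) / e).
pose K := (Num.truncn (2 * M / e)).+1.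
exists [seq (j%:R * e - M, `[j%:R * e - M, j.+1%:R * e - M[) | j <- iota 0 K] => w.
have := fM w; rewrite ler_norml => /andP[f1 f2].
have fe0 : 0 <= (f w + M) / e by rewrite divr_ge0 ?(ltW e0)//; lra.
have kw : forall j : nat, (f @^-1` [set` `[j%:R * e - M, j.+1%:R * e - M[]) w <-> (k w == j).
  move=> j; rewrite /k truncn_eq//= in_itv/= ler_pdivlMr// ltr_pdivrMr//.
  by rewrite lerBlDr ltrBrDr.
have kK : (k w < K)%N.
  rewrite /K ltnS; apply: Num.Theory.le_truncn.
  by rewrite ler_pM2r ?invr_gt0//; lra.
have kwK : k w \in iota 0 K by rewrite mem_iota add0n kK.
rewrite big_map (bigD1_seq (k w) kwK (iota_uniq _ _))/=.
rewrite indicE mem_set ?mulr1; last exact/kw.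
rewrite big1 ?addr0; last first.
  move=> j jk; rewrite indicE memNset ?mulr0// => /kw/eqP kj.
  by rewrite kj eqxx in jk.
have /andP[] := truncn_itv fe0; rewrite -/(k w) ler_pdivlMr// ltr_pdivrMr//.
rewrite -natr1 mulrDl mul1r => h1 h2.
by rewrite ger0_norm; lra.
Qed.

(** * The characteristic function of the normal law *)

Section normal_density.
Context {R : realType}.
Local Notation lam := (@lebesgue_measure R).
Variable s : R.
Hypothesis s0 : s != 0.
Local Notation p := (normal_pdf 0 s).

Lemma integrable_mul_normal_pdf (f : R -> R) (c : R) :
  measurable_fun setT f -> (forall x, `|f x| <= c) ->
  lam.-integrable setT (EFin \o (fun x => f x * p x)).
Proof.
move=> mf fM; have c0 : 0 <= c := le_trans (normr_ge0 _) (fM 0).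
have Ip : lam.-integrable setT (fun x => c%:E * (p x)%:E)%E.
  by apply: integrableZl => //; exact: integrable_normal_pdf.
apply: le_integrable Ip => //.
- apply/measurable_EFinP; apply: measurable_funM => //; exact: measurable_normal_pdf.
- move=> x _; rewrite /= lee_fin !normrM.
  by rewrite ler_wpM2r// (ger0_norm c0).
Qed.

(** For an indicator this is the definition of [normal_prob]; linearity and uniform approximation by
    simple functions do the rest. *)
Lemma Rintegral_normal_prob (f : measurableTypeR R -> R) : bounded_measurable f ->
  \int[normal_prob 0 s]_x f x = \int[lam]_x (f x * p x).
Proof.
move=> bf; have [mf [M fM]] := bf; apply/eqP; rewrite -subr_eq0 -normr_le0.
apply/ler_addgt0Pr => e e0; rewrite add0r.
have e20 : 0 < e / 2 by rewrite divr_gt0.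
have [S fS] := simple_approximation e20 fM.
pose A (cA : R * interval R) := f @^-1` [set` cA.2].
have mA cA : measurable (A cA) by rewrite -[A cA]setTI; exact: mf.
pose g (x : measurableTypeR R) := \sum_(cA <- S) cA.1 * \1_(A cA) x.
have bg : bounded_measurable g.
  by apply: bounded_measurable_sum => cA; apply/bounded_measurableZ/bounded_measurable_indic.
have h1 := @Rintegral_dist_cst _ _ _ (normal_prob 0 s) _ _ _ bf bg fS.
have If := integrable_mul_normal_pdf mf fM.
have Ig : lam.-integrable setT (EFin \o (fun x => g x * p x)).
  by case: bg => mg [N gN]; exact: (integrable_mul_normal_pdf mg gN).
have h2 : `|\int[lam]_x (f x * p x) - \int[lam]_x (g x * p x)| <= e / 2.
  rewrite -RintegralB//.
  have -> : e / 2 = \int[lam]_x (e / 2 * p x).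
    rewrite RintegralZl//; last exact: integrable_normal_pdf.
    by rewrite /Rintegral integral_normal_pdf mulr1.
  have IB : lam.-integrable setT (EFin \o (fun x => f x * p x - g x * p x)).
    exact: (integrableB measurableT If Ig).
  rewrite (le_trans (le_normr_Rintegral _ IB))//.
  apply: le_Rintegral => //.
  - exact: integrable_norm.
  - exact: (integrableZl measurableT (e / 2) (integrable_normal_pdf 0 s)).
  move=> x _; rewrite -mulrBl normrM (ger0_norm (normal_pdf_ge0 _ _ _)) ler_wpM2r//.
  exact: normal_pdf_ge0.
have h3 : \int[normal_prob 0 s]_x g x = \int[lam]_x (g x * p x).
  rewrite /g; elim: S {fS g bg h1 Ig h2} => [|cA S IH].
    under eq_Rintegral do rewrite big_nil.
    under [RHS]eq_Rintegral do rewrite big_nil mul0r.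
    by rewrite /Rintegral !integral0.
  under eq_Rintegral do rewrite big_cons -[X in _ + X]mul1r.
  under [RHS]eq_Rintegral do rewrite big_cons mulrDl.
  rewrite Rintegral_linear; last 2 first.
    exact: bounded_measurable_indic.
    by apply: bounded_measurable_sum => cB; apply/bounded_measurableZ/bounded_measurable_indic.
  rewrite RintegralD//; last 2 first.
    apply: (@integrable_mul_normal_pdf _ `|cA.1|).
      by apply: measurable_funM => //; apply: measurable_indic; exact: mA.
    by move=> x; rewrite normrM ler_piMr// indicE; case: (_ \in _); rewrite ?normr1 ?normr0.
    have [mg [N gN]] : bounded_measurable (fun x : measurableTypeR R => \sum_(cB <- S) cB.1 * \1_(A cB) x).
      by apply: bounded_measurable_sum => cB; apply/bounded_measurableZ/bounded_measurable_indic.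
    exact: (integrable_mul_normal_pdf mg gN).
  rewrite mul1r IH; congr (_ + _).
  under [RHS]eq_Rintegral do rewrite -mulrA.
  rewrite RintegralZl//; last first.
    apply: (@integrable_mul_normal_pdf _ 1); first by apply: measurable_indic; exact: mA.
    by move=> x; rewrite indicE; case: (_ \in _); rewrite ?normr1 ?normr0.
  congr (_ * _); apply: EFin_inj; rewrite Rintegral_indic// /normal_prob.
  rewrite -[LHS]/(normal_prob 0 s (A cA)) /normal_prob integral_mkcond /Rintegral fineK; last first.
    apply: integrable_fin_num => //.
    apply: (@integrable_mul_normal_pdf _ 1); first by apply: measurable_indic; exact: mA.
    by move=> x; rewrite indicE; case: (_ \in _); rewrite ?normr1 ?normr0.
  apply: eq_integral => x _; rewrite patchE indicE.
  by case: ifPn => xA; rewrite ?mul1r ?mul0r.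
rewrite (splitr e); move: h1 h2; rewrite h3; set a := \int[_]_x _; set b := \int[_]_x _.
set c := \int[_]_x _ => h1 h2.
by rewrite (le_trans (ler_distD b _ _))// lerD// distrC.
Qed.

Lemma integrable_id_normal_pdf : lam.-integrable setT (EFin \o (fun x => `|x| * p x)).
Proof.
(* The dominating function is a multiple of the density of standard deviation [2 s]. Its exponent
   exceeds that of [p] by [k x^2], where [k = 1/(2 s^2) - 1/(8 s^2)], and
   [|x| <= 1 + x^2 <= (1 + 1/k) exp (k x^2)]. *)
pose k := 3 / (8 * s ^+ 2).
have s2 : 0 < s ^+ 2 by rewrite exprn_even_gt0.
have k0 : 0 < k by rewrite divr_gt0// mulr_gt0.
have ss0 : 2 * s != 0 by rewrite mulf_neq0.
have pk := normal_peak_gt0 s0; have pk2 := normal_peak_gt0 ss0.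
have [c c0 cE] : exists2 c, 0 <= c & c = (1 + k^-1) * (normal_peak s / normal_peak (2 * s)).
  eexists; last reflexivity.
  by rewrite mulr_ge0 ?divr_ge0 ?ltW// addr_gt0 ?invr_gt0.
have Ip : lam.-integrable setT (fun x => c%:E * (normal_pdf 0 (2 * s) x)%:E)%E.
  by apply: integrableZl => //; exact: integrable_normal_pdf.
apply: le_integrable Ip => //.
- apply/measurable_EFinP; apply: measurable_funM; last exact: measurable_normal_pdf.
  by apply: continuous_measurable_fun; exact: norm_continuous.
- move=> x _; rewrite /= lee_fin !normrM normr_id !normal_pdfE//.
  rewrite (ger0_norm c0) !normrM (gtr0_norm pk) (gtr0_norm pk2) /normal_fun.
  rewrite !(ger0_norm (expR_ge0 _)) cE subr0.
  set u := normal_peak s in pk *; set v := normal_peak _ in pk2 *.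
  rewrite -(mulrA (1 + _)) [u / v * _]mulrA divfK ?gt_eqF// mulrCA [leRHS]mulrCA ler_pM2l//.
  have -> : - x ^+ 2 / ((2 * s) ^+ 2 *+ 2) = k * x ^+ 2 + (- x ^+ 2 / (s ^+ 2 *+ 2)).
    by rewrite /k; field.
  rewrite expRD mulrA ler_wpM2r ?expR_ge0//.
  apply: (@le_trans _ _ ((1 + k^-1) * (1 + k * x ^+ 2))); last first.
    by rewrite ler_wpM2l ?expR_ge1Dx// addr_ge0// invr_ge0 ltW.
  have -> : (1 + k^-1) * (1 + k * x ^+ 2) = 1 + k^-1 + k * x ^+ 2 + x ^+ 2.
    by field; rewrite gt_eqF.
  have : 0 <= k^-1 by rewrite invr_ge0 ltW.
  have : 0 <= k * x ^+ 2 by rewrite mulr_ge0 ?sqr_ge0 ?ltW.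
  have : `|x| <= 1 + `|x| ^+ 2 by have := normr_ge0 x; nra.
  by rewrite real_normK ?num_real//; lra.
Qed.

Lemma is_derive_normal_pdf (x : R) : is_derive x (1 : R) p (- x / s ^+ 2 * p x).
Proof.
rewrite normal_pdfE// /normal_fun.
apply: is_derive_eq.
rewrite /GRing.scale/= subr0; set E := expR _; set m := normal_peak s; field.
exact: s0.
Qed.

Local Notation psi t c := (fun x => (t * cos (t * x + c) - x / s ^+ 2 * sin (t * x + c)) * p x).

Lemma integrable_cos_normal_pdf t c :
  lam.-integrable setT (EFin \o (fun x => cos (t * x + c) * p x)).
Proof.
apply: (@integrable_mul_normal_pdf _ 1); last by move=> x; exact: cos_max.
apply: continuous_measurable_fun; apply: trigpoly_continuous; exact: trigpoly_cos.
Qed.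

Lemma continuous_sin_affine (t c : R) : continuous (fun x : R => sin (t * x + c)).
Proof.
move=> x; apply: continuous_comp; last exact: continuous_sin.
by apply: cvgD; [apply: cvgMl_tmp; exact: cvg_id|exact: cvg_cst].
Qed.

Lemma integrable_id_sin_normal_pdf t c :
  lam.-integrable setT (EFin \o (fun x => x * sin (t * x + c) * p x)).
Proof.
apply: le_integrable integrable_id_normal_pdf => //.
- apply/measurable_EFinP; apply: measurable_funM; last exact: measurable_normal_pdf.
  apply: measurable_funM => //.
  by apply: continuous_measurable_fun; exact: continuous_sin_affine.
- by move=> x _; rewrite /= lee_fin !normrM normr_id ler_wpM2r// ler_piMr// sin_max.
Qed.

(** The difference of the two sides is the integral over the line of the derivative [psi] of
    [H x = sin (t x + c) p x], and [H] vanishes at infinity. *)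
Lemma Rintegral_by_parts_normal t c :
  t * \int[lam]_x (cos (t * x + c) * p x) =
  (s ^+ 2)^-1 * \int[lam]_x (x * sin (t * x + c) * p x).
Proof.
have Ic := integrable_cos_normal_pdf t c; have Is := integrable_id_sin_normal_pdf t c.
apply/eqP; rewrite -subr_eq0 -!RintegralZl//.
have Ic' : lam.-integrable setT (EFin \o (fun x => t * (cos (t * x + c) * p x))).
  exact: (integrableZl measurableT t Ic).
have Is' : lam.-integrable setT (EFin \o (fun x => (s ^+ 2)^-1 * (x * sin (t * x + c) * p x))).
  exact: (integrableZl measurableT (s ^+ 2)^-1 Is).
rewrite -RintegralB//.
pose psi x := t * (cos (t * x + c) * p x) - (s ^+ 2)^-1 * (x * sin (t * x + c) * p x).
have Ipsi : lam.-integrable setT (EFin \o psi) by exact: (integrableB measurableT Ic' Is').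
pose H x := sin (t * x + c) * p x.
have dH (x : R) : is_derive x (1 : R) H (psi x).
  have dp := is_derive_normal_pdf x.
  apply: is_derive_eq; rewrite /GRing.scale/= /psi; set P := p x; field; exact: s0.
have cH : continuous H.
  by move=> x; apply: cvgM; [exact: continuous_sin_affine|exact: continuous_normal_pdf].
have cpsi : continuous psi.
  have cp := @continuous_normal_pdf R 0 s s0.
  have cc := trigpoly_continuous (trigpoly_cos t c).
  have cs := @continuous_sin_affine t c.
  move=> x; apply: cvgB; apply: cvgMl_tmp; apply: cvgM => //; try exact: cp; try exact: cc.
  by apply: cvgM; [exact: cvg_id|exact: cs].
have FTC (n : nat) : (\int[lam]_(x in `[(- n.+1%:R)%R, n.+1%:R]) (psi x)%:E =
    (H n.+1%:R - H (- n.+1%:R))%R%:E)%E.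
  rewrite (@continuous_FTC2 _ psi H).
  - by [].
  - by rewrite -subr_gt0 opprK -mulr2n mulrn_wgt0.
  - exact: continuous_subspaceT.
  - split; first by move=> x _; case: (dH x).
    + by apply: cvg_at_right_filter; exact: cH.
    + by apply: cvg_at_left_filter; exact: cH.
  - by move=> x _; rewrite derive1E; apply: derive_val.
have := @dominated_cvg _ _ _ lam setT measurableT
  (fun n => (EFin \o psi) \_ `[- n.+1%:R, n.+1%:R]) (EFin \o psi)
  (fun x => `|(psi x)%:E|)%E.
have -> : (fun n => \int[lam]_x ((EFin \o psi) \_ `[(- n.+1%:R)%R, n.+1%:R]) x)%E =
  (fun n => (H n.+1%:R - H (- n.+1%:R))%:E).
  by apply/funext => n; rewrite -integral_mkcond FTC.
move=> DC.
have {DC} : (fun n => (H n.+1%:R - H (- n.+1%:R))%:E) @ \oo --> (\int[lam]_x (EFin \o psi) x)%E.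
  apply: DC.
  - move=> n; apply/(measurable_restrictT _ _).1 => //.
    by apply: measurable_funTS; apply/measurable_EFinP; exact: continuous_measurable_fun.
  - move=> x _; apply: cvg_near_cst; exists (Num.truncn `|x|) => // n /= nx.
    rewrite patchE mem_set//= in_itv/= -ler_norml ltW//.
    by apply: lt_le_trans (truncnS_gt _) _; rewrite ler_nat.
  - by [].
  - by apply: integrable_abse.
  - move=> n x _; rewrite patchE; case: ifPn => // _.
    by rewrite abse0 abse_ge0.
rewrite -(fineK (integrable_fin_num measurableT Ipsi)) => /fine_cvgP[_ L].
have H0 : H n.+1%:R - H (- n.+1%:R) @[n --> \oo] --> 0.
  apply/cvgr0Pnorm_le => e e0.
  have pk := normal_peak_gt0 s0.
  have s2 : 0 < s ^+ 2 by rewrite exprn_even_gt0.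
  (* From [exp (- y) <= 1 / y], each of the two boundary terms is at most [(m / 2) / (n + 1)]. *)
  pose m := normal_peak s * (s ^+ 2 *+ 2) * 2.
  have m0 : 0 < m by rewrite !mulr_gt0// mulrn_wgt0.
  exists (Num.truncn (m / e)) => // n /= nm.
  have n0 : 0 < n.+1%:R :> R by rewrite ltr0n.
  have ne : m / n.+1%:R <= e.
    rewrite ler_pdivrMr// mulrC -ler_pdivrMr// ltW//.
    by apply: lt_le_trans (truncnS_gt _) _; rewrite ler_nat.
  apply: le_trans ne.
  have Hp (x : R) : `|x| = n.+1%:R -> `|H x| <= m / 2 / n.+1%:R.
    move=> xn; rewrite /H normrM (ger0_norm (normal_pdf_ge0 _ _ _)).
    apply: (@le_trans _ _ (p x)).
      by rewrite ler_piMl ?normal_pdf_ge0// sin_max.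
    rewrite normal_pdfE// /m mulfK// -mulrA ler_pM2l// /normal_fun subr0.
    rewrite mulNr expRN -real_normK ?num_real// xn.
    rewrite -[leRHS]invrK lef_pV2 ?posrE ?expR_gt0 ?invr_gt0 ?divr_gt0 ?mulrn_wgt0//.
    rewrite invf_div; apply: le_trans (expR_ge1Dx _).
    rewrite -[leLHS]add0r lerD// ler_pM2r ?invr_gt0 ?mulrn_wgt0// expr2 ler_peMl ?(ltW n0)//.
    by rewrite ler1n.
  rewrite (le_trans (ler_normB _ _))//.
  have := Hp n.+1%:R (ger0_norm (ltW n0)).
  have := Hp (- n.+1%:R); rewrite normrN => /(_ (ger0_norm (ltW n0))).
  move=> h1 h2; apply: le_trans (lerD h2 h1) _.
  by rewrite le_eqVlt; apply/orP; left; apply/eqP; field; rewrite gt_eqF.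
have {}L : H n.+1%:R - H (- n.+1%:R) @[n --> \oo] --> \int[lam]_x psi x by exact: L.
by rewrite (cvg_unique _ L H0)//; exact: Rhausdorff.
Qed.

(** Differentiation under the integral sign followed by integration by parts: the characteristic
    function solves [phi' = - s^2 t phi]. *)
Lemma is_derive_cos_normal c (t : R) :
  is_derive t (1 : R) (fun t => \int[lam]_x (cos (t * x + c) * p x))
    (- (s ^+ 2 * t) * \int[lam]_x (cos (t * x + c) * p x)).
Proof.
pose f (t : R) x := cos (t * x + c) * p x.
have df (u y : R) : is_derive u (1 : R) (f ^~ y) (- (y * sin (u * y + c) * p y)).
  by rewrite /f; apply: is_derive_eq; rewrite /GRing.scale/=; ring.
have pE u y : partial1of2 f u y = - (y * sin (u * y + c) * p y).
  by rewrite partial1of2E; have := df u y => ?; rewrite derive_val.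
have It : `]t - 1, t + 1[%classic t by rewrite /= in_itv/=; lra.
have intf x : `]t - 1, t + 1[%classic x -> lam.-integrable setT (EFin \o f x).
  by move=> _; exact: integrable_cos_normal_pdf.
have derf x y : `]t - 1, t + 1[%classic x -> setT y -> derivable (f ^~ y) x 1.
  by move=> _ _; case: (df x y).
have G0 y : 0 <= `|y| * p y by rewrite mulr_ge0// normal_pdf_ge0.
have Gub x y : `]t - 1, t + 1[%classic x -> setT y -> `|partial1of2 f x y| <= `|y| * p y.
  move=> _ _; rewrite pE normrN !normrM (ger0_norm (normal_pdf_ge0 _ _ _)).
  by rewrite ler_wpM2r ?normal_pdf_ge0// ler_piMr// sin_max.
have D1 := derivable_under_integral measurableT It intf derf G0 integrable_id_normal_pdf Gub.
have D2 := differentiation_under_integral measurableT It intf derf G0 integrable_id_normal_pdf Gub.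
apply: DeriveDef; first exact: D1.
rewrite -derive1E D2.
have -> : \int[lam]_y partial1of2 f t y = - \int[lam]_x (x * sin (t * x + c) * p x).
  under eq_Rintegral do rewrite pE -mulN1r.
  by rewrite RintegralZl// ?mulN1r//; exact: integrable_id_sin_normal_pdf.
have := Rintegral_by_parts_normal t c; set A := \int[_]_x _; set B := \int[_]_x _ => AB.
have s2 : s ^+ 2 != 0 by rewrite expf_neq0.
by rewrite mulNr -mulrA AB mulVKf.
Qed.

(** The integrating factor makes [F] constant, equal to its value [cos c] at [t = 0]. *)
Lemma normal_characteristic t c :
  \int[normal_prob 0 s]_x cos (t * x + c) = expR (- (s ^+ 2 * t ^+ 2 / 2)) * cos c.
Proof.
rewrite Rintegral_normal_prob; last first.
  split; last by exists 1 => x; exact: cos_max.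
  apply: continuous_measurable_fun; apply: trigpoly_continuous; exact: trigpoly_cos.
pose F (t : R) := expR (s ^+ 2 * t ^+ 2 / 2) * \int[lam]_x (cos (t * x + c) * p x).
have dF (u : R) : is_derive u (1 : R) F 0.
  have dI := is_derive_cos_normal c u.
  apply: is_derive_eq; rewrite /GRing.scale/=.
  by set A := \int[_]_x _; set E := expR _; field.
have := is_derive_0_is_cst t 0 dF; rewrite /F expr0n/= mulr0 mul0r expR0 mul1r.
have -> : \int[lam]_x (cos (0 * x + c) * p x) = cos c.
  under eq_Rintegral do rewrite mul0r add0r.
  rewrite RintegralZl//; last exact: integrable_normal_pdf.
  by rewrite /Rintegral integral_normal_pdf mulr1.
by move=> <-; rewrite mulrA -expRD addNr expR0 mul1r.
Qed.

End normal_density.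

Lemma centered_normal_characteristic (R : realType) (v t c : R) : 0 <= v ->
  \int[centered_normal v]_x cos (t * x + c) = expR (- (v * t ^+ 2 / 2)) * cos c.
Proof.
move=> v0; rewrite /centered_normal; case: eqP => [->|/eqP vn0].
  rewrite mul0r mul0r oppr0 expR0 mul1r.
  rewrite /Rintegral integral_dirac//=; last first.
    apply/measurable_EFinP; apply: continuous_measurable_fun.
    apply: trigpoly_continuous; exact: trigpoly_cos.
  by rewrite indicE mem_set// mul1r mulr0 add0r.
rewrite normal_characteristic ?sqr_sqrtr//.
by rewrite sqrtr_eq0 -ltNge lt_neqAle eq_sym vn0.
Qed.

(** * The transfer operator of a g-function *)

Section pushforward.
Context d d' (W : measurableType d) (W' : measurableType d') (R : realType).
Variables (Q : probability W R) (P : probability W' R) (T : W -> W').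
Hypothesis mT : measurable_fun setT T.
Hypothesis TQ : forall A, measurable A -> Q (T @^-1` A) = P A.

Lemma bounded_measurable_comp (f : W' -> R) :
  bounded_measurable f -> bounded_measurable (fun w => f (T w)).
Proof. by move=> [mf [M fM]]; split; [exact: measurableT_comp|exists M]. Qed.

Lemma Rintegral_pushforward (f : W' -> R) : bounded_measurable f ->
  \int[Q]_w f (T w) = \int[P]_w f w.
Proof.
move=> bf; have [mf [M fM]] := bf.
apply: EFin_inj; rewrite (RintegralE Q (bounded_measurable_comp bf)) (RintegralE P bf).
have PE : forall A, measurable A -> A `<=` setT -> pushforward Q T A = P A.
  by move=> A mA _; exact: TQ.
rewrite -(eq_measure_integral _ PE) integral_pushforward//.
- exact/measurable_EFinP.
- by apply: bounded_measurable_integrable; exact: bounded_measurable_comp.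
Qed.

End pushforward.

Section configurations.
Context {E : pointedFinType}.

Lemma measurable_coordinate (I : Type) (i : I) (B : set E) :
  measurable [set w : config I E | B (w i)].
Proof. by apply: sub_sigma_algebra; exists i => //; exists B. Qed.

Lemma measurable_to_config d (W : measurableType d) (I : Type) (T : W -> config I E) :
  (forall i (B : set E), measurable [set w | B (T w i)]) -> measurable_fun setT T.
Proof.
move=> mT; apply: (@measurability _ _ _ _ _ T (@coord_events I E [set: I])) => //.
move=> _ [A [i _ [B ->]] <-]; rewrite setTI; exact: mT.
Qed.

(** Entry 0 of a past is the most recent site -1, so this is the past seen one time step later if
    the new symbol is [x]. *)
Definition pcons (x : E) (w : past E) : past E := fun n => if n is n'.+1 then w n' else x.

Definition ptail (w : past E) : past E := fun n => w n.+1.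

Lemma measurable_pcons x : measurable_fun setT (pcons x).
Proof.
apply: measurable_to_config => -[|i] B /=; last exact: measurable_coordinate.
have [xB|xB] := pselect (B x).
  by rewrite [X in measurable X](_ : _ = setT)//; apply/seteqP; split.
by rewrite [X in measurable X](_ : _ = set0)//; apply/seteqP; split.
Qed.

Lemma measurable_ptail : measurable_fun setT ptail.
Proof. apply: measurable_to_config => i B; exact: (measurable_coordinate i.+1). Qed.

Lemma measurable_iter_ptail n : measurable_fun setT (iter n ptail).
Proof.
elim: n => [|n IH]; first exact: measurable_id.
by rewrite (_ : iter _ _ = ptail \o iter n ptail)//; apply: measurableT_comp => //; exact: measurable_ptail.
Qed.

Lemma measurable_past_of : measurable_fun setT (@past_of E : config int E -> past E).
Proof. by apply: measurable_to_config => i B; exact: measurable_coordinate. Qed.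

Lemma measurable_config_shift :
  measurable_fun setT (@config_shift E : config int E -> config int E).
Proof. by apply: measurable_to_config => i B; exact: measurable_coordinate. Qed.

Lemma past_measurable_past_of (R : realType) (h : past E -> R) :
  measurable_fun setT h -> past_measurable (fun w => h (past_of w)).
Proof.
move=> mh; apply: (@measurableT_comp _ _ _ _ _ _ h) => //.
apply: measurable_to_config => i B; apply: sub_sigma_algebra.
exists (- i.+1%:Z) => /=; first by lia.
by exists B.
Qed.

Lemma measurable_coordinate_fun (R : realType) (I : Type) (i : I) (f : E -> R) :
  measurable_fun setT (fun w : config I E => f (w i)).
Proof. by move=> _ B mB; rewrite setTI; exact: (measurable_coordinate i (f @^-1` B)). Qed.

Lemma bounded_measurable_coordinate (R : realType) (I : Type) (i : I) (f : E -> R) :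
  bounded_measurable (fun w : config I E => f (w i)).
Proof.
split; first exact: measurable_coordinate_fun.
exists (\sum_(x : E) `|f x|) => w; rewrite (bigD1 (w i))//= lerDl.
by apply: sumr_ge0.
Qed.

Lemma past_of_shift (w : config int E) :
  past_of (config_shift w) = pcons (w 0) (past_of w).
Proof.
apply/funext => -[|n]; rewrite /past_of /config_shift/=; congr w; lia.
Qed.

End configurations.

Section transfer.
Context {R : realType} {E : pointedFinType}.
Variables (g : E -> past E -> R) (P : probability (config int E) R).
Hypothesis gF : g_function g.

Let mg x : measurable_fun setT (g x). Proof. by case: gF. Qed.
Let g01 x w : 0 <= g x w <= 1. Proof. by case: gF. Qed.
Let g_ge0 x w : 0 <= g x w. Proof. by case/andP: (g01 x w). Qed.
Let g_sum w : \sum_x g x w = 1. Proof. by case: gF. Qed.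

Lemma bounded_measurable_g x : bounded_measurable (g x).
Proof. by split => //; exists 1 => w; rewrite ger0_norm//; case/andP: (g01 x w). Qed.

Definition transfer (f : past E -> R) (w : past E) : R := \sum_(x : E) g x w * f (pcons x w).

Lemma transfer_linear c c' f f' w :
  transfer (fun w => c * f w + c' * f' w) w = c * transfer f w + c' * transfer f' w.
Proof.
rewrite /transfer !mulr_sumr -big_split/=; apply: eq_bigr => x _; ring.
Qed.

Lemma transfer_cst c w : transfer (fun=> c) w = c.
Proof. by rewrite /transfer -mulr_suml g_sum mul1r. Qed.

Lemma transfer_tail f f' w :
  transfer (fun w => f w * f' (ptail w)) w = transfer f w * f' w.
Proof. by rewrite /transfer mulr_suml; apply: eq_bigr => x _; rewrite mulrA. Qed.

Lemma transfer_dist f f' e w : (forall w, `|f w - f' w| <= e) ->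
  `|transfer f w - transfer f' w| <= e.
Proof.
move=> ff'; rewrite -sumrB (le_trans (ler_norm_sum _ _ _))//.
rewrite -[leRHS](transfer_cst e w); apply: ler_sum => x _.
by rewrite -mulrBr normrM ger0_norm// ler_wpM2l.
Qed.

Lemma bounded_measurable_transfer f :
  bounded_measurable f -> bounded_measurable (transfer f).
Proof.
move=> bf; apply: bounded_measurable_sum => x; apply: bounded_measurableM.
  exact: bounded_measurable_g.
exact: (bounded_measurable_comp (@measurable_pcons E x) bf).
Qed.

Lemma bounded_measurable_iter_transfer n f :
  bounded_measurable f -> bounded_measurable (iter n transfer f).
Proof. by move=> bf; elim: n => //= n; exact: bounded_measurable_transfer. Qed.

Hypothesis gP : consistent g P.

Lemma Rintegral_shift (h : config int E -> R) : bounded_measurable h ->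
  \int[P]_w h (config_shift w) = \int[P]_w h w.
Proof.
apply: (@Rintegral_pushforward _ _ _ _ _ P P (@config_shift E)); first exact: measurable_config_shift.
by case: gP.
Qed.

(** Shift-invariance replaces the past by the past one step later, which is
    [pcons (w 0) (past_of w)]. Splitting according to [w 0 = x], consistency with
    [h = f (pcons x _)] turns each indicator into the weight [g x]. *)
Lemma Rintegral_transfer f : bounded_measurable f ->
  \int[P]_w transfer f (past_of w) = \int[P]_w f (past_of w).
Proof.
move=> bf; have bp := bounded_measurable_comp (@measurable_past_of E) bf.
rewrite -(Rintegral_shift bp); apply: EFin_inj.
have bpc x : bounded_measurable (fun w : config int E => f (pcons x (past_of w))).
  exact: (bounded_measurable_comp (@measurable_past_of E) (bounded_measurable_comp (@measurable_pcons E x) bf)).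
have bgc x : bounded_measurable (fun w : config int E => f (pcons x (past_of w)) * g x (past_of w)).
  apply: bounded_measurableM => //.
  exact: (bounded_measurable_comp (@measurable_past_of E) (bounded_measurable_g x)).
have m0 x : measurable [set w : config int E | w 0 = x].
  exact: (measurable_coordinate 0 [set y | y = x]).
have b1 x : bounded_measurable (fun w : config int E =>
    f (pcons x (past_of w)) * \1_[set w : config int E | w 0 = x] w).
  by apply: bounded_measurableM => //; exact: bounded_measurable_indic.
have bm (h : E -> config int E -> R) : (forall x, bounded_measurable (h x)) ->
    \int[P]_w (\sum_x h x w) = \sum_x \int[P]_w h x w.
  move=> bh; have H (r : seq E) : \int[P]_w (\sum_(x <- r) h x w) = \sum_(x <- r) \int[P]_w h x w.
    elim: r => [|x r IH].
      by under eq_Rintegral do rewrite big_nil; rewrite big_nil Rintegral_prob_cst.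
    under eq_Rintegral do rewrite big_cons.
    rewrite big_cons -IH RintegralD//; apply: bounded_measurable_integrable => //.
    exact: bounded_measurable_sum.
  exact: H.
have -> : \int[P]_w transfer f (past_of w) =
    \int[P]_w (\sum_x f (pcons x (past_of w)) * g x (past_of w)).
  by apply: eq_Rintegral => w _; apply: eq_bigr => x _; rewrite mulrC.
rewrite [in RHS](_ : (fun w => f _) = (fun w : config int E =>
    \sum_x f (pcons x (past_of w)) * \1_[set w : config int E | w 0 = x] w)); last first.
  apply/funext => w; rewrite past_of_shift (bigD1 (w 0))//= indicE mem_set// mulr1.
  rewrite big1 ?addr0// => x /eqP xw; rewrite indicE memNset ?mulr0//=.
  by move=> wx; apply: xw.
rewrite !bm//; congr EFin; apply: eq_bigr => x _; apply: EFin_inj.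
rewrite (RintegralE P (bgc x)) (RintegralE P (b1 x)).
have [_ /(_ x (fun w => f (pcons x (past_of w))))] := gP.
move=> ->.
- rewrite integral_mkcond; apply: eq_integral => w _; rewrite patchE indicE.
  by case: ifPn => _; rewrite ?mulr1 ?mulr0.
- apply: (@past_measurable_past_of _ _ (fun w => f (pcons x w))).
  by have [] := bounded_measurable_comp (@measurable_pcons E x) bf.
- by have [_] := bpc x.
Qed.

Lemma Rintegral_iter_transfer n f : bounded_measurable f ->
  \int[P]_w iter n transfer f (past_of w) = \int[P]_w f (past_of w).
Proof.
move=> bf; elim: n => //= n IH; rewrite Rintegral_transfer//.
exact: bounded_measurable_iter_transfer.
Qed.

Lemma iter_transfer_tail n f f' w :
  iter n transfer (fun w => f w * f' (iter n ptail w)) w = iter n transfer f w * f' w.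
Proof.
elim: n f w => // n IH f w; rewrite !iterSr.
have -> : transfer (fun w => f w * f' (iter n.+1 ptail w)) =
    (fun w => transfer f w * f' (iter n ptail w)).
  apply/funext => v; rewrite -(transfer_tail f (fun w => f' (iter n ptail w))).
  by apply: eq_bigr => x _; rewrite iterSr.
exact: IH.
Qed.

(** [iter n ptail] forgets the [n] most recent symbols, so this is conditioning on the past [n]
    steps earlier. It turns correlations and mixing into estimates on the iterates of the transfer
    operator. *)
Lemma Rintegral_tail (n : nat) (f f' : past E -> R) : bounded_measurable f -> bounded_measurable f' ->
  \int[P]_w (f (past_of w) * f' (iter n ptail (past_of w))) =
  \int[P]_w (iter n transfer f (past_of w) * f' (past_of w)).
Proof.
move=> bf bf'.
rewrite -(@Rintegral_iter_transfer n (fun w => f w * f' (iter n ptail w))).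
  by apply: eq_Rintegral => w _; rewrite iter_transfer_tail.
by apply: bounded_measurableM => //; exact: (bounded_measurable_comp (measurable_iter_ptail n) bf').
Qed.

End transfer.

(** * Coupling and moduli of continuity *)

Section modulus.
Context {R : realType} {E : pointedFinType}.
Variable g : E -> past E -> R.
Hypothesis gF : g_function g.
Implicit Types (w s : past E).

Let g01 x w : 0 <= g x w <= 1. Proof. by case: gF. Qed.
Let g_ge0 x w : 0 <= g x w. Proof. by case/andP: (g01 x w). Qed.
Let g_sum w : \sum_x g x w = 1. Proof. by case: gF. Qed.

Definition agree (k : nat) w s := forall j, (j < k)%N -> w j = s j.

Definition prefix_tuple (k : nat) w : k.-tuple E := [tuple w i | i < k].

Lemma juxt_prefix k w s : agree k w s ->
  exists v, s = juxt (prefix_tuple k w) v.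
Proof.
move=> ws; exists (fun n => s (n + k)%N); apply/funext => n; rewrite /juxt.
have [nk|kn] := ltnP n k.
  rewrite -ws// (nth_map (Ordinal nk)) ?size_enum_ord//.
  by rewrite nth_enum_ord.
by rewrite nth_default ?size_tuple// subnK.
Qed.

Lemma agree_juxt k w v : agree k w (juxt (prefix_tuple k w) v).
Proof.
move=> j jk; rewrite /juxt (nth_map (Ordinal jk)) ?size_enum_ord//.
by rewrite nth_enum_ord.
Qed.

(** The infimum inside [a_coef], indexed by a past instead of by the word of its first [k] symbols.
    It is the mass of [x] common to all pasts with that prefix, on which two of them can be
    coupled. *)
Definition g_lower k x w : R := inf [set g x (juxt (prefix_tuple k w) v) | v in [set: past E]].

Let g_lower_has_inf k x w : has_inf [set g x (juxt (prefix_tuple k w) v) | v in [set: past E]].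
Proof.
split; first by exists (g x (juxt (prefix_tuple k w) point)); exists point.
by exists 0 => _ [v _ <-].
Qed.

Lemma g_lower_le k x w s : agree k w s -> g_lower k x w <= g x s.
Proof.
move=> /juxt_prefix[v sv]; apply: ge_inf; last by exists v => //; rewrite -sv.
by case: (g_lower_has_inf k x w).
Qed.

Lemma le_g_lower k x w c : (forall s, agree k w s -> c <= g x s) -> c <= g_lower k x w.
Proof.
move=> cg; apply: lb_le_inf; first by case: (g_lower_has_inf k x w).
by move=> _ [v _ <-]; apply: cg; exact: agree_juxt.
Qed.

Lemma g_lower_ge0 k x w : 0 <= g_lower k x w.
Proof. by apply: le_g_lower => s _. Qed.

Lemma a_coef_le k w : a_coef g k <= \sum_x g_lower k x w.
Proof.
apply: ge_inf; last by exists (prefix_tuple k w).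
exists 0 => _ [s _ <-]; apply: sumr_ge0 => x _; apply: lb_le_inf.
  by exists (g x (juxt s point)); exists point.
by move=> _ [v _ <-].
Qed.

Lemma le_a_coef k c : (forall w, c <= \sum_x g_lower k x w) -> c <= a_coef g k.
Proof.
move=> cg; apply: lb_le_inf.
  by exists (\sum_x inf [set g x (juxt (prefix_tuple k point) v) | v in [set: past E]]); exists (prefix_tuple k point).
move=> _ [s _ <-]; apply: le_trans (cg (juxt s point)) _.
have sE : prefix_tuple k (juxt s point) = s.
  apply: eq_from_tnth => i; rewrite tnth_mktuple /juxt (tnth_nth point).
  by apply: set_nth_default; rewrite size_tuple.
by rewrite /g_lower sE.
Qed.

Lemma agreeW j k w s : (j <= k)%N -> agree k w s -> agree j w s.
Proof. by move=> jk ws i ij; apply: ws; exact: leq_trans jk. Qed.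

Lemma agree_pcons k x w s : agree k w s -> agree k.+1 (pcons x w) (pcons x s).
Proof. by move=> ws [|j]//=; exact: ws. Qed.

Lemma a_coef_nondecreasing k : a_coef g k <= a_coef g k.+1.
Proof.
apply: le_a_coef => w; apply: le_trans (a_coef_le k w) _.
apply: ler_sum => x _; apply: le_g_lower => s ws; apply: g_lower_le.
exact: agreeW ws.
Qed.

Lemma a_coef_le1 k : a_coef g k <= 1.
Proof.
apply: le_trans (a_coef_le k point) _; rewrite -(g_sum point).
by apply: ler_sum => x _; exact: g_lower_le.
Qed.

Lemma a_coef_gt0 : g_bounded_away g -> 0 < a_coef g 0.
Proof.
move=> [c c0 cg]; apply: lt_le_trans c0 _; apply: le_a_coef => w.
rewrite (bigD1 point)//= -[leLHS]addr0 lerD//.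
  by apply: le_g_lower => s _; exact: cg.
by apply: sumr_ge0 => x _; exact: g_lower_ge0.
Qed.

Definition has_modulus (f : past E -> R) (B : nat -> R) :=
  forall k w s, agree k w s -> `|f w - f s| <= B k.

(* Coupling: the common part of [g (. | w)] and [g (. | s)] has mass at least [a_k], and on it
   the pasts now agree to depth [k + 1]; elsewhere nothing is known. *)
Lemma transfer_modulus f B : has_modulus f B -> (forall k, B k <= B 0%N) ->
  has_modulus (transfer g f) (house_op (a_coef g) B).
Proof.
move=> fB B0.
have one_sided k w s : agree k w s ->
    transfer g f w - transfer g f s <= house_op (a_coef g) B k.
  move=> ws; pose m x := g_lower k x w.
  have mw x : m x <= g x w by exact: g_lower_le.
  have ms x : m x <= g x s by exact: g_lower_le.
  have am : a_coef g k <= \sum_x m x by exact: a_coef_le.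
  set Sm := \sum_x m x in am.
  (* Both residual measures have mass [1 - Sm]. They are compared through the one value
     [f (pcons y s)]: no value at [s] is smaller, and no value at [w] exceeds it by more than
     [B 0]. *)
  pose y := [arg min_(y < point : E) f (pcons y s)]%O.
  have yP x : f (pcons y s) <= f (pcons x s).
    by rewrite /y; case: arg_minP => // i _; apply.
  have -> : transfer g f w - transfer g f s =
      \sum_x m x * (f (pcons x w) - f (pcons x s)) +
      (\sum_x (g x w - m x) * f (pcons x w) - \sum_x (g x s - m x) * f (pcons x s)).
    rewrite /transfer -!sumrB -big_split/=; apply: eq_bigr => x _; ring.
  have h1 : \sum_x m x * (f (pcons x w) - f (pcons x s)) <= Sm * B k.+1.
    rewrite /Sm mulr_suml; apply: ler_sum => x _.
    rewrite ler_wpM2l ?g_lower_ge0// (le_trans (ler_norm _))//.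
    by apply: fB; exact: agree_pcons.
  have h2 : \sum_x (g x w - m x) * f (pcons x w) <= (1 - Sm) * (f (pcons y s) + B 0%N).
    rewrite -(g_sum w) /Sm -sumrB mulr_suml; apply: ler_sum => x _.
    rewrite ler_wpM2l ?subr_ge0// -lerBlDl (le_trans (ler_norm _))//.
    exact: fB.
  have h3 : (1 - Sm) * f (pcons y s) <= \sum_x (g x s - m x) * f (pcons x s).
    rewrite -(g_sum s) /Sm -sumrB mulr_suml; apply: ler_sum => x _.
    by rewrite ler_wpM2l ?subr_ge0.
  (* The bound obtained so far is [Sm * B k.+1 + (1 - Sm) * B 0], which is nonincreasing in [Sm]
     since [B k.+1 <= B 0]; so [Sm] may be lowered to [a_k]. *)
  have h4 := B0 k.+1; rewrite /house_op.
  move: h1 h2 h3; set x1 := \sum_x _ * _; set x2 := \sum_x _ * _; set x3 := \sum_x _ * _.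
  set z := f _ => h1 h2 h3; nra.
move=> k w s ws; rewrite ler_norml lerNl opprB; apply/andP; split; apply: one_sided => //.
by move=> j jk; rewrite ws.
Qed.

Lemma iter_transfer_modulus n f B : has_modulus f B ->
  (forall k, 0 <= B k) -> (forall k, B k.+1 <= B k) ->
  has_modulus (iter n (transfer g) f) (iter n (house_op (a_coef g)) B).
Proof.
move=> fB B0 Bd.
(* [house_op] keeps a modulus nonincreasing because [a_k] is nondecreasing; hence the value at 0
   remains the largest, as [transfer_modulus] requires. *)
have HB m : (forall k, iter m (house_op (a_coef g)) B k.+1 <= iter m (house_op (a_coef g)) B k).
  elim: m => [|m IH] k //=; rewrite /house_op.
  set C := iter _ _ _ in IH *.
  have CC j : C j <= C 0%N by elim: j => // j; exact: le_trans.
  have := a_coef_nondecreasing k; have := a_coef_le1 k.+1; have := IH k.+1.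
  have a0 : 0 <= a_coef g k.+1.
    by apply: le_a_coef => w; apply: sumr_ge0 => x _; exact: g_lower_ge0.
  have := CC k.+1; nra.
elim: n => //= n IH; apply: transfer_modulus => // k.
by elim: k => // k /(le_trans (HB _ _)).
Qed.

End modulus.

Lemma eq_of_dist_le (R : realType) (x y : R) : (forall e, 0 < e -> `|x - y| <= e) -> x = y.
Proof.
move=> xy; apply/eqP; rewrite -subr_eq0 -normr_le0.
by apply/ler_addgt0Pr => e e0; rewrite add0r xy.
Qed.

Lemma uniform_series (R : realType) (W : Type) (u : nat -> W -> R) (b : nat -> R) :
  (forall n w, `|u n w| <= b n) -> bounded_sums b ->
  exists U : W -> R, forall e, 0 < e -> exists N, forall n, (N <= n)%N ->
    forall w, `|U w - \sum_(m < n) u m w| <= e.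
Proof.
move=> ub [S hS].
have b0 n : (W -> 0 <= b n) by move=> w; exact: le_trans (ub n w).
(* Over an empty domain the hypothesis says nothing about the sign of [b]. *)
have [[w0]|nW] := pselect (inhabited W); last first.
  exists (fun=> 0) => e e0; exists 0%N => n _ w; exfalso; apply: nW; exact: inhabits w.
have {}b0 n : 0 <= b n := b0 n w0.
pose T := [series b n]_n.
have cT : cvgn T.
  apply: nondecreasing_is_cvgn; first exact: nondecreasing_series.
  by exists S => _ [n _ <-]; rewrite /T/series/= big_mkord.
have Tn n : T n <= limn T.
  by apply: nondecreasing_cvgn_le => //; exact: nondecreasing_series.
have tail w n p : (n <= p)%N -> `|\sum_(m < p) u m w - \sum_(m < n) u m w| <= limn T - T n.
  move=> np; rewrite -!(big_mkord predT (u ^~ w)) (@big_cat_nat _ _ _ n 0 p)//=.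
  rewrite addrAC subrr add0r (le_trans (ler_norm_sum _ _ _))//.
  apply: (@le_trans _ _ (T p - T n)); last by rewrite lerB.
  rewrite /T/series/= (@big_cat_nat _ _ _ n 0 p)//= addrAC subrr add0r.
  exact: ler_sum.
have cu w : cvgn (series (u ^~ w)).
  apply: normed_cvg; apply: (@series_le_cvg _ _ b); [|by []| |exact: cT].
    by move=> n; exact: normr_ge0.
  by move=> n; exact: ub.
exists (fun w => limn (series (u ^~ w))) => e e0.
have /cvgrPdist_le/(_ e e0)[N _ HN] : T @ \oo --> limn T by exact: cT.
exists N => n Nn w; have /= := HN n Nn; rewrite ger0_norm ?subr_ge0// => Te.
have su p : series (u ^~ w) p = \sum_(m < p) u m w by rewrite /series/= big_mkord.
rewrite ler_distl; apply/andP; split.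
  apply: limr_ge => //; exists n => // p /= np; rewrite su.
  by have := tail w n p np; rewrite ler_distl => /andP[]; lra.
apply: limr_le => //; exists n => // p /= np; rewrite su.
by have := tail w n p np; rewrite ler_distl => /andP[]; lra.
Qed.

(** * Continuous functions of the past and mixing *)

Section regular_functions.
Context {R : realType} {E : pointedFinType}.
Variables (g : E -> past E -> R) (P : probability (config int E) R).
Hypothesis gF : g_function g.
Hypothesis gC : g_continuous g.
Hypothesis gP : consistent g P.
Implicit Types (phi psi : past E -> R) (w s : past E).

(** Uniform continuity for the product topology on pasts. *)
Definition uniformly_local phi := forall e, 0 < e ->
  exists n : nat, forall w s, agree n w s -> `|phi w - phi s| <= e.

Definition regular_fun phi := bounded_measurable phi /\ uniformly_local phi.

Lemma regular_fun_linear c c' phi psi : regular_fun phi -> regular_fun psi ->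
  regular_fun (fun w => c * phi w + c' * psi w).
Proof.
move=> [bphi uphi] [bpsi upsi]; split.
  by apply: bounded_measurableD; exact: bounded_measurableZ.
move=> e e0; pose e' := e / (`|c| + `|c'| + 1).
have c0 : 0 < `|c| + `|c'| + 1 by rewrite ltr_wpDl// addr_ge0.
have e'0 : 0 < e' by rewrite divr_gt0.
have [n Hn] := uphi _ e'0; have [m Hm] := upsi _ e'0.
exists (maxn n m) => w s ws.
have h1 := Hn w s (agreeW (leq_maxl n m) ws).
have h2 := Hm w s (agreeW (leq_maxr n m) ws).
have -> : c * phi w + c' * psi w - (c * phi s + c' * psi s) =
  c * (phi w - phi s) + c' * (psi w - psi s) by ring.
rewrite (le_trans (ler_normD _ _))// !normrM.
have ee : e = (`|c| + `|c'| + 1) * e' by rewrite mulrC divfK// gt_eqF.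
rewrite ee !mulrDl -[leLHS]addr0 !lerD ?ler_wpM2l ?mul1r ?(ltW e'0)//.
Qed.

Lemma regular_funM phi psi : regular_fun phi -> regular_fun psi ->
  regular_fun (fun w => phi w * psi w).
Proof.
move=> [bphi uphi] [bpsi upsi]; split; first exact: bounded_measurableM.
have [_ [M1 hM1]] := bphi; have [_ [M2 hM2]] := bpsi.
have M10 : 0 <= M1 := le_trans (normr_ge0 _) (hM1 point).
have M20 : 0 <= M2 := le_trans (normr_ge0 _) (hM2 point).
move=> e e0; pose e' := e / (M1 + M2 + 1).
have c0 : 0 < M1 + M2 + 1 by rewrite ltr_wpDl// addr_ge0.
have e'0 : 0 < e' by rewrite divr_gt0.
have [n Hn] := uphi _ e'0; have [m Hm] := upsi _ e'0.
exists (maxn n m) => w s ws.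
have h1 := Hn w s (agreeW (leq_maxl n m) ws).
have h2 := Hm w s (agreeW (leq_maxr n m) ws).
have -> : phi w * psi w - phi s * psi s =
  phi w * (psi w - psi s) + (phi w - phi s) * psi s by ring.
rewrite (le_trans (ler_normD _ _))// !normrM.
have ee : e = (M1 + M2 + 1) * e' by rewrite mulrC divfK// gt_eqF.
rewrite ee !mulrDl -[leLHS]addr0 !lerD ?mul1r ?(ltW e'0)//.
  exact: ler_pM.
by rewrite mulrC; apply: ler_pM.
Qed.

Lemma regular_fun_cst c : regular_fun (fun=> c).
Proof.
split; first exact: bounded_measurable_cst.
by move=> e e0; exists 0%N => w s _; rewrite subrr normr0 ltW.
Qed.

Lemma regular_fun_g x : regular_fun (g x).
Proof.
split; first exact: bounded_measurable_g.
move=> e e0; have [n Hn] := gC e0; exists n => w s ws; apply/ltW/Hn => k kn.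
exact: ws.
Qed.

Lemma regular_fun_coordinate n (f : E -> R) : regular_fun (fun w => f (w n)).
Proof.
split; first exact: bounded_measurable_coordinate.
by move=> e e0; exists n.+1 => w s ->//; rewrite subrr normr0 ltW.
Qed.

Lemma regular_fun_ptail phi : regular_fun phi -> regular_fun (fun w => phi (ptail w)).
Proof.
move=> [bphi uphi]; split; first exact: (bounded_measurable_comp (@measurable_ptail E) bphi).
move=> e e0; have [n Hn] := uphi e e0; exists n.+1 => w s ws; apply: Hn => j jn.
exact: ws.
Qed.

Lemma regular_fun_pcons x phi : regular_fun phi -> regular_fun (fun w => phi (pcons x w)).
Proof.
move=> [bphi uphi]; split; first exact: (bounded_measurable_comp (@measurable_pcons E x) bphi).
move=> e e0; have [n Hn] := uphi e e0; exists n => w s ws; apply: Hn.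
apply: (agreeW (leqnSn n)); exact: agree_pcons.
Qed.

Lemma regular_funD phi psi : regular_fun phi -> regular_fun psi ->
  regular_fun (fun w => phi w + psi w).
Proof.
move=> rp rq; rewrite (_ : (fun w => _) = (fun w => 1 * phi w + 1 * psi w)).
  exact: regular_fun_linear.
by apply/funext => w; ring.
Qed.

Lemma regular_funB phi psi : regular_fun phi -> regular_fun psi ->
  regular_fun (fun w => phi w - psi w).
Proof.
move=> rp rq; rewrite (_ : (fun w => _) = (fun w => 1 * phi w + (-1) * psi w)).
  exact: regular_fun_linear.
by apply/funext => w; ring.
Qed.

Lemma regular_fun_sum (I : Type) (r : seq I) (F : I -> past E -> R) :
  (forall i, regular_fun (F i)) -> regular_fun (fun w => \sum_(i <- r) F i w).
Proof.
move=> rF; elim: r => [|i r IH].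
  by under eq_fun do rewrite big_nil; exact: regular_fun_cst.
by under eq_fun do rewrite big_cons; exact: regular_funD.
Qed.

Lemma regular_fun_transfer phi : regular_fun phi -> regular_fun (transfer g phi).
Proof.
move=> rp; apply: regular_fun_sum => x; apply: regular_funM; first exact: regular_fun_g.
exact: regular_fun_pcons.
Qed.

Lemma regular_fun_iter_transfer n phi : regular_fun phi -> regular_fun (iter n (transfer g) phi).
Proof. by move=> rp; elim: n => //= n; exact: regular_fun_transfer. Qed.

Lemma regular_fun_uniform_limit phi : (forall e, 0 < e ->
  exists2 psi, regular_fun psi & forall w, `|phi w - psi w| <= e) -> regular_fun phi.
Proof.
move=> H; have [psi0 [[m0 [M0 hM0]] _] h0] := H 1 ltr01.
split; first split.
- pose u n := sval (cid2 (H n.+1%:R^-1 (ltac:(by rewrite invr_gt0 ltr0n)))).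
  have uP n : regular_fun (u n) /\ forall w, `|phi w - u n w| <= n.+1%:R^-1.
    by rewrite /u; case: cid2.
  apply: (@measurable_fun_cvg _ _ _ _ u); first by move=> n; case: (uP n) => [[[]]].
  move=> w _; apply/cvgrPdist_le => e e0; exists (Num.truncn e^-1) => // n /= Nn.
  have [_ /(_ w) h] := uP n; apply: le_trans h _.
  rewrite -[leRHS]invrK lef_pV2 ?posrE ?invr_gt0 ?ltr0n//; apply/ltW.
  by apply: lt_le_trans (truncnS_gt _) _; rewrite ler_nat.
- exists (M0 + 1) => w; rewrite -[phi w](subrK (psi0 w)) addrC.
  by rewrite (le_trans (ler_normD _ _))// lerD.
- move=> e e0; have e30 : 0 < e / 3 by rewrite divr_gt0.
  have [psi [_ upsi] hpsi] := H _ e30; have [n Hn] := upsi _ e30.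
  exists n => w s /Hn ws; have := hpsi w; have := hpsi s.
  by move: ws; rewrite !ler_norml => /andP[? ?] /andP[? ?] /andP[? ?]; apply/andP; split; lra.
Qed.

Lemma regular_fun_modulus phi : regular_fun phi -> exists B : nat -> R,
  [/\ has_modulus phi B, forall k, 0 <= B k, forall k, B k.+1 <= B k &
      forall e, 0 < e -> exists k, B k < e].
Proof.
move=> [[_ [M hM]] uphi].
pose S k := [set r | exists w s, agree k w s /\ r = `|phi w - phi s|].
have S0 k : S k 0 by exists point, point; split=> //; rewrite subrr normr0.
have hS k : has_sup (S k).
  split; first by exists 0.
  exists (M + M) => _ [w [s [_ ->]]].
  by rewrite (le_trans (ler_normB _ _))// lerD.
exists (fun k => sup (S k)); split.
- by move=> k w s ws; apply: ub_le_sup; [case: (hS k)|exists w, s].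
- by move=> k; apply: ub_le_sup; [case: (hS k)|].
- move=> k; apply: ge_sup; first by exists 0.
  move=> _ [w [s [ws ->]]]; apply: ub_le_sup; first by case: (hS k).
  by exists w, s; split=> //; exact: agreeW ws.
- move=> e e0; have [n Hn] := uphi (e / 2) (ltac:(by rewrite divr_gt0)).
  exists n; apply: (@le_lt_trans _ _ (e / 2)); last by rewrite ltr_pdivrMr// ltr_pMr// ltr1n.
  apply: ge_sup; first by exists 0.
  by move=> _ [w [s [ws ->]]]; exact: Hn.
Qed.

(** Averaging [phi w - phi s] over a random past [s] leaves [phi w], the mean being 0. *)
Lemma norm_le_oscillation phi e : bounded_measurable phi ->
  \int[P]_w phi (past_of w) = 0 -> (forall w s, `|phi w - phi s| <= e) ->
  forall w, `|phi w| <= e.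
Proof.
move=> bphi phi0 osc w.
have := @Rintegral_dist_cst _ _ _ P (fun=> phi w) (fun v => phi (past_of v)) e.
rewrite phi0 subr0 Rintegral_prob_cst; apply.
- exact: bounded_measurable_cst.
- exact: (bounded_measurable_comp (@measurable_past_of E) bphi).
- by move=> v; exact: osc.
Qed.

Hypothesis a0 : 0 < a_coef g 0.
Hypothesis a_summable : bounded_sums (fun k => 1 - a_coef g k).

(** The modulus at depth 0 is the full oscillation. For the [l]-th iterate it is dominated by the
    mean at time [l] of a vanishing modulus along the house-of-cards chain started at 0, and that
    chain is transient. *)
Lemma transfer_mixing phi e : regular_fun phi ->
  \int[P]_w phi (past_of w) = 0 -> 0 < e ->
  exists N, forall l, (N <= l)%N -> forall w, `|iter l (transfer g) phi w| <= e.
Proof.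
move=> rphi phi0 e0; have [B [phiB B0 Bd Bs]] := regular_fun_modulus rphi.
have [N HN] := house_op_iter_small (a_coef_nondecreasing gF) a0 (a_coef_le1 gF) a_summable B0 Bd Bs e0.
exists N => l /HN Nl; apply: norm_le_oscillation.
- exact: bounded_measurable_iter_transfer rphi.1.
- by rewrite (Rintegral_iter_transfer gF gP)//; exact: rphi.1.
- move=> w s; apply/ltW; apply: le_lt_trans Nl.
  by apply: (@iter_transfer_modulus _ _ _ gF l phi B).
Qed.

(** A function of the last symbol has a modulus supported at depth 0, so the oscillation of its
    [n]-th iterate is at most [2 M] times the probability of a visit to 0 at time [n]; these
    probabilities are summable. *)
Lemma bounded_sums_iter_transfer (f : E -> R) :
  \int[P]_w f (past_of w 0%N) = 0 ->
  exists2 b : nat -> R, bounded_sums b &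
    forall n w, `|iter n (transfer g) (fun w => f (w 0%N)) w| <= b n.
Proof.
move=> f0; have [bf [M hM]] := bounded_measurable_coordinate 0%N f.
pose I := fun k : nat => (k < 1)%N%:R : R.
pose B := fun k => (M + M) * I k.
have M0 : 0 <= M + M by rewrite addr_ge0// (le_trans (normr_ge0 _) (hM point)).
have [c hc] := house_op_iter_sum (a_coef_nondecreasing gF) a0 (a_coef_le1 gF) a_summable 1.
exists (fun n => (M + M) * iter n (house_op (a_coef g)) I 0%N).
  by exists ((M + M) * c) => n; rewrite -mulr_sumr ler_wpM2l.
move=> n; apply: norm_le_oscillation.
- by apply: bounded_measurable_iter_transfer => //; exact: bounded_measurable_coordinate.
- rewrite (Rintegral_iter_transfer gF gP)//; exact: bounded_measurable_coordinate.
have fB : has_modulus (fun w => f (w 0%N)) B.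
  move=> [|k] w s ws; rewrite /B /I/=.
    by rewrite mulr1 (le_trans (ler_normB _ _))// lerD.
  by rewrite ws// subrr normr0 mulr0.
have BE k : iter n (house_op (a_coef g)) B k = (M + M) * iter n (house_op (a_coef g)) I k.
  elim: n k => //= n IH k; rewrite /house_op !IH; ring.
move=> w s; rewrite -BE; apply: (@iter_transfer_modulus _ _ _ gF n _ B) => //.
- by move=> k; rewrite mulr_ge0// ler0n.
- by move=> k; rewrite ler_wpM2l// ler_nat; case: k.
Qed.

End regular_functions.

(** * Martingale approximation *)

Lemma expRN_quad (R : realType) (x : R) : 0 <= x -> `|1 - x - expR (- x)| <= x ^+ 2.
Proof.
move=> x0; have h1 := expR_ge1Dx (- x).
have h2 : expR (- x) <= 1 - x + x ^+ 2.
  rewrite expRN; have ex := expR_ge1Dx x; have x1 : 0 < 1 + x by lra.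
  apply: (@le_trans _ _ (1 + x)^-1).
    by rewrite lef_pV2 ?posrE ?expR_gt0.
  rewrite -[leLHS]mul1r ler_pdivrMr//.
  have : 0 <= x ^+ 3 by rewrite exprn_ge0.
  have -> : (1 - x + x ^+ 2) * (1 + x) = 1 + x ^+ 3 by ring.
  lra.
by rewrite ler_norml; apply/andP; split; lra.
Qed.

Lemma Rintegral_norm_le d (W : measurableType d) (R : realType) (Q : probability W R)
    (h : W -> R) (e : R) :
  bounded_measurable h -> (forall w, `|h w| <= e) -> `|\int[Q]_w h w| <= e.
Proof.
move=> bh he; have := @Rintegral_dist_cst _ _ _ Q h (cst 0) e bh (bounded_measurable_cst _ 0).
rewrite Rintegral_prob_cst subr0; apply => w; by rewrite subr0.
Qed.

(** The constant [C] may depend on [e] but not on [s], [th] or [n]. This uniformity serves twice: at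
    [s = t / sqrt n] in the central limit theorem, and at one small frequency for all [n] at once in
    the Abel sums. *)
Definition gaussian_characteristic (R : realType) (sigma2 : R) (c : R -> R -> nat -> R) :=
  forall e, 0 < e -> exists C : R, 0 <= C /\ forall s th n, `|s| <= 1 ->
    `|c s th n - expR (- (n%:R * s ^+ 2 * sigma2 / 2)) * cos th| <=
      n%:R * (C * `|s| ^+ 3 + s ^+ 2 * e) + C * `|s|.

Section poisson_equation.
Context {R : realType} {E : pointedFinType}.
Variables (g : E -> past E -> R) (P : probability (config int E) R).
Hypothesis gF : g_function g.
Hypothesis gC : g_continuous g.
Hypothesis gP : consistent g P.
Hypothesis a0 : 0 < a_coef g 0.
Hypothesis a_summable : bounded_sums (fun k => 1 - a_coef g k).
Variable f : E -> R.
Hypothesis f_mean0 : \int[P]_w f (w 0) = 0.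
Implicit Types (w p : past E).

Let L := transfer g.
Let f0 : past E -> R := fun w => f (w 0%N).

Let rf0 : regular_fun f0. Proof. exact: regular_fun_coordinate. Qed.

Lemma Rintegral_past_coordinate0 : \int[P]_w f0 (past_of w) = 0.
Proof.
rewrite -(Rintegral_shift gP (bounded_measurable_comp (@measurable_past_of E) rf0.1)).
by under eq_Rintegral do rewrite past_of_shift.
Qed.

(** The series starts at [L f0], without the term [f0], so that [G] is the transfer of [f0 + G];
    this is the form that yields martingale differences. *)
Lemma poisson_solution : exists G : past E -> R,
  [/\ regular_fun G, forall w, G w = L f0 w + L G w &
    forall e, 0 < e -> exists N, forall n, (N <= n)%N ->
      forall w, `|G w - \sum_(m < n) iter m.+1 L f0 w| <= e].
Proof.
have [b [S hS] fb] := bounded_sums_iter_transfer gF gP a0 a_summable Rintegral_past_coordinate0.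
have [G hG] : exists U : past E -> R, forall e, 0 < e -> exists N, forall n, (N <= n)%N ->
    forall w, `|U w - \sum_(m < n) iter m.+1 L f0 w| <= e.
  apply: (@uniform_series R _ (fun m w => iter m.+1 L f0 w) (fun n => b n.+1)); first by move=> n w; exact: fb.
  exists (S - b 0%N) => n; rewrite lerBrDl; apply: le_trans (hS n.+1).
  by rewrite big_ord_recl.
have rG : regular_fun G.
  apply: regular_fun_uniform_limit => // e e0; have [N /(_ N (leqnn N)) HN] := hG _ e0.
  exists (fun w => \sum_(m < N) iter m.+1 L f0 w) => //.
  by apply: regular_fun_sum => m; exact: (regular_fun_iter_transfer gF gC).
exists G; split=> // w; apply: eq_of_dist_le => e e0.
have e20 : 0 < e / 2 by rewrite divr_gt0.
have [N HN] := hG _ e20.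
have h1 := HN N.+1 (leqnSn N) w; have h2 := HN N (leqnn N).
have h3 := transfer_dist gF w h2.
have : \sum_(m < N.+1) iter m.+1 L f0 w = L f0 w + L (fun w => \sum_(m < N) iter m.+1 L f0 w) w.
  rewrite big_ord_recl/=; congr (_ + _).
  rewrite /L /transfer; under [RHS]eq_bigr do rewrite mulr_sumr.
  by rewrite exchange_big.
move=> E1; move: h1 h3; rewrite E1 -/L !ler_norml => /andP[? ?] /andP[? ?].
by apply/andP; split; lra.
Qed.

Section martingale.
Variable G : past E -> R.
Hypothesis rG : regular_fun G.
Hypothesis GE : forall w, G w = L f0 w + L G w.

(** Gordin's decomposition: [G (ptail w)] is the conditional expectation of [f0 + G] given the past
    one step earlier, since [G = L (f0 + G)]. *)
Definition martingale_difference w := f0 w + G w - G (ptail w).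
Local Notation D := martingale_difference.

Lemma regular_martingale_difference : regular_fun D.
Proof. by apply: regular_funB; [exact: regular_funD|exact: regular_fun_ptail]. Qed.

Lemma transfer_martingale_difference w : L D w = 0.
Proof.
have Ht : transfer g (fun w => 1 * G (ptail w)) w = G w.
  by rewrite (transfer_tail g (fun=> 1) G) transfer_cst// mul1r.
rewrite /L (_ : D = (fun w => 1 * (1 * f0 w + 1 * G w) + -1 * (1 * G (ptail w)))).
  by rewrite transfer_linear (transfer_linear g 1 1 f0 G) Ht -/L; have := GE w; lra.
by apply/funext => v; rewrite /D; ring.
Qed.

Definition limit_variance := \int[P]_w (D (past_of w) ^+ 2).
Local Notation sigma2 := limit_variance.

Lemma limit_variance_ge0 : 0 <= sigma2.
Proof. by apply: Rintegral_ge0 => w _; exact: sqr_ge0. Qed.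

Let bmp (h : past E -> R) : bounded_measurable h ->
  bounded_measurable (fun w : config int E => h (past_of w)).
Proof. exact: (bounded_measurable_comp (@measurable_past_of E)). Qed.

Let bD : bounded_measurable D. Proof. by case: regular_martingale_difference. Qed.
Let bD2 : bounded_measurable (fun w => D w ^+ 2).
Proof. exact: (bounded_measurableM bD bD). Qed.

Let v := L (fun w => D w ^+ 2).

Let rD2 : regular_fun (fun w => D w ^+ 2).
Proof.
have rD := regular_martingale_difference.
exact: (regular_funM rD rD).
Qed.

Let rv : regular_fun v. Proof. by apply: regular_fun_transfer. Qed.

Lemma Rintegral_conditional_variance : \int[P]_w v (past_of w) = sigma2.
Proof. by rewrite /v /L (Rintegral_transfer gF gP bD2). Qed.

(** The increments are numbered backwards in time: [i = 0] is the most recent one, which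
    [martingaleS] peels off and [L] averages out. *)
Definition martingale n w := \sum_(i < n) D (iter i (@ptail E) w).
Local Notation M := martingale.

Lemma martingaleS n w : M n.+1 w = D w + M n (ptail w).
Proof.
rewrite /M big_ord_recl/=; congr (_ + _); apply: eq_bigr => i _.
by rewrite -iterS iterSr.
Qed.

Lemma martingale_split l n w : (l <= n)%N -> M n w = M l w + M (n - l) (iter l (@ptail E) w).
Proof.
elim: l n w => [|l IH] n w ln; first by rewrite /M big_ord0 add0r subn0.
case: n ln => // n ln; rewrite !martingaleS subSS (IH n)// iterSr addrA//.
Qed.

Lemma bounded_measurable_martingale n : bounded_measurable (M n).
Proof.
apply: bounded_measurable_sum => i.
exact: (bounded_measurable_comp (measurable_iter_ptail i) bD).
Qed.

Lemma martingale_le K n w : (forall w, `|D w| <= K) -> `|M n w| <= n%:R * K.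
Proof.
move=> DK; rewrite (le_trans (ler_norm_sum _ _ _))//.
apply: (@le_trans _ _ (\sum_(i < n) K)); first exact: ler_sum.
by rewrite sumr_const card_ord -[leLHS]mulr_natl.
Qed.

Let bcosM s th n : bounded_measurable (fun w => cos (s * M n w + th)).
Proof.
apply: bounded_measurable_cos; apply: measurable_funD => //.
by apply: measurable_funM => //; case: (bounded_measurable_martingale n).
Qed.

(** Expansion in the last increment: [L D = 0] removes the first-order term, the second-order term
    yields the conditional variance [v], and the third is controlled by the bound [K] on [D]. *)
Let transfer_cos_taylor K s th n w : (forall w, `|D w| <= K) ->
  `|L (fun w => cos (s * M n.+1 w + th)) w -
    cos (s * M n w + th) * (1 - s ^+ 2 * v w / 2)| <= 2 * (`|s| ^+ 3 * K ^+ 3).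
Proof.
move=> DK; set X := s * M n w + th.
have -> : cos X * (1 - s ^+ 2 * v w / 2) = L (fun p => 1 * (cos X * (1 - (s * D p) ^+ 2 / 2)) + (- (sin X * s)) * D p) w.
  rewrite /L transfer_linear -/L transfer_martingale_difference mulr0 addr0 mul1r.
  rewrite (_ : (fun p => _) = (fun p => cos X * 1 + (- (cos X * s ^+ 2 / 2)) * D p ^+ 2)).
    have Lv : transfer g (fun p => D p ^+ 2) w = v w by [].
    by rewrite /L transfer_linear transfer_cst// Lv; field.
  by apply/funext => p; field.
rewrite -sumrB (le_trans (ler_norm_sum _ _ _))//.
have -> : 2 * (`|s| ^+ 3 * K ^+ 3) = \sum_x g x w * (2 * (`|s| ^+ 3 * K ^+ 3)).
  by rewrite -[LHS](transfer_cst gF _ w).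
apply: ler_sum => x _; have g0 : 0 <= g x w by case: gF => _ /(_ x w)/andP[].
rewrite -mulrBr normrM (ger0_norm g0) ler_wpM2l// martingaleS.
have -> : s * (D (pcons x w) + M n (ptail (pcons x w))) + th = X + s * D (pcons x w).
  by rewrite /X (_ : ptail (pcons x w) = w)//; ring.
set d := D (pcons x w).
have := cos_add_taylor X (s * d).
have -> : 1 * (cos X * (1 - (s * d) ^+ 2 / 2)) + (- (sin X * s)) * d =
  cos X * (1 - (s * d) ^+ 2 / 2) - sin X * (s * d) by ring.
move=> /le_trans; apply; rewrite ler_pM2l// normrM exprMn ler_wpM2l ?exprn_ge0//.
have K0 : 0 <= K := le_trans (normr_ge0 _) (DK point).
by apply: lerXn2r; rewrite ?nnegrE//; exact: DK.
Qed.

Let c s th n := \int[P]_w cos (s * M n (past_of w) + th).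

(* The conditional variance [v] has mean [sigma2]; dropping the [l] most recent increments from
   the cosine, at cost [l * K * `|s|], lets mixing replace [v] by [sigma2] up to [e]. *)
Lemma martingale_characteristic_step e : 0 < e ->
  exists (C : R) (l : nat), 0 <= C /\ forall s th n, `|s| <= 1 ->
    `|c s th n.+1 - expR (- (s ^+ 2 * sigma2 / 2)) * c s th n| <=
      C * `|s| ^+ 3 + s ^+ 2 * e + (if (n < l)%N then C * s ^+ 2 else 0).
Proof.
move=> e0; have [_ [K DK]] := bD.
have K0 : 0 <= K := le_trans (normr_ge0 _) (DK point).
pose u w := v w - sigma2.
have ru : regular_fun u by apply: regular_funB => //; exact: regular_fun_cst.
have u0 : \int[P]_w u (past_of w) = 0.
  rewrite RintegralB//; last 2 first.
  - apply: bounded_measurable_integrable; exact: bmp rv.1.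
  - apply: bounded_measurable_integrable; exact: bounded_measurable_cst.
  by rewrite Rintegral_conditional_variance Rintegral_prob_cst subrr.
have [_ [K2 uK2]] := ru.1.
have K20 : 0 <= K2 := le_trans (normr_ge0 _) (uK2 point).
have [l Hl] := transfer_mixing gF gP a0 a_summable ru u0 e0.
have s20 := limit_variance_ge0.
(* In order: the Taylor remainder, the error in replacing [1 - x] by [exp (- x)], the cost of
   dropping [l] increments from the cosine, and the crude bound on [u] used when [n < l]. *)
pose C := 2 * K ^+ 3 + sigma2 ^+ 2 + l%:R * K * K2 + K2.
have C0 : 0 <= C by rewrite !addr_ge0 ?mulr_ge0 ?exprn_ge0 ?ler0n.
exists C, l; split=> // s th n s1.
have bcu m : bounded_measurable (fun w => cos (s * M m w + th) * u w).
  by apply: bounded_measurableM => //; exact: ru.1.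
have corr : `|\int[P]_w (cos (s * M n (past_of w) + th) * u (past_of w))| <=
    e + `|s| * (l%:R * K * K2) + (if (n < l)%N then K2 else 0).
  (* With fewer than [l] increments mixing cannot be used; the crude bound [K2] occurs for finitely
     many [n] only. *)
  have [nl|ln] := ltnP n l.
    apply: (@le_trans _ _ K2); last by rewrite lerDr addr_ge0 ?(ltW e0)// !mulr_ge0 ?ler0n.
    apply: Rintegral_norm_le; first exact: bmp (bcu n).
    by move=> w; rewrite normrM -[leRHS]mul1r ler_pM// cos_max.
  rewrite addr0.
  have bul : bounded_measurable (fun w => u w * cos (s * M (n - l) (iter l (@ptail E) w) + th)).
    apply: bounded_measurableM; first exact: ru.1.
    exact: (bounded_measurable_comp (measurable_iter_ptail l) (bcosM s th (n - l))).
  have h1 : `|\int[P]_w (u (past_of w) * cos (s * M (n - l) (iter l (@ptail E) (past_of w)) + th))| <= e.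
    rewrite (Rintegral_tail gF gP l ru.1 (bcosM s th (n - l))).
    apply: Rintegral_norm_le.
      apply: bounded_measurableM; last exact: bmp (bcosM s th (n - l)).
      apply: bmp; exact: bounded_measurable_iter_transfer ru.1.
    by move=> w; rewrite normrM -[leRHS]mulr1 ler_pM// ?cos_max// Hl.
  have h2 : `|\int[P]_w (cos (s * M n (past_of w) + th) * u (past_of w)) -
     \int[P]_w (u (past_of w) * cos (s * M (n - l) (iter l (@ptail E) (past_of w)) + th))| <=
      `|s| * (l%:R * K * K2).
    apply: Rintegral_dist_cst; [exact: bmp (bcu n)|exact: bmp bul|].
    move=> w; rewrite mulrC -mulrBr normrM mulrC mulrA ler_pM//.
    rewrite (le_trans (cos_lipschitz _ _))// (martingale_split _ ln).
    set x := M l _; set y := M _ _.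
    have -> : s * (x + y) + th - (s * y + th) = s * x by ring.
    by rewrite normrM ler_wpM2l// martingale_le.
  move: h1 h2; set x := \int[_]_w _; set y := \int[_]_w _ => h1 h2.
  by rewrite -[in leLHS](subrK x y) (le_trans (ler_normD _ _))// addrC lerD.
have step1 : `|c s th n.+1 - \int[P]_w (cos (s * M n (past_of w) + th) * (1 - s ^+ 2 * v (past_of w) / 2))|
    <= 2 * (`|s| ^+ 3 * K ^+ 3).
  rewrite /c -(Rintegral_transfer gF gP (bcosM s th n.+1)).
  apply: Rintegral_dist_cst.
  - by apply: bmp; apply: bounded_measurable_transfer.
  - apply: (bmp (h := fun w => cos (s * M n w + th) * (1 - s ^+ 2 * v w / 2))).
    apply: bounded_measurableM => //; apply: bounded_measurableB; first exact: bounded_measurable_cst.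
    rewrite (_ : (fun w => _) = (fun w => s ^+ 2 / 2 * v w)); last by apply/funext => w; ring.
    by apply: bounded_measurableZ; exact: rv.1.
  - by move=> w; exact: transfer_cos_taylor.
have step2 : \int[P]_w (cos (s * M n (past_of w) + th) * (1 - s ^+ 2 * v (past_of w) / 2)) =
    (1 - s ^+ 2 * sigma2 / 2) * c s th n +
    (- (s ^+ 2 / 2)) * \int[P]_w (cos (s * M n (past_of w) + th) * u (past_of w)).
  rewrite /c -Rintegral_linear; [|exact: bmp (bcosM s th n)|exact: bmp (bcu n)].
  by apply: eq_Rintegral => w _; rewrite /u; field.
have c1 : `|c s th n| <= 1.
  by apply: Rintegral_norm_le; [exact: bmp (bcosM s th n)|move=> w; exact: cos_max].
have step3 : `|(1 - s ^+ 2 * sigma2 / 2) * c s th n - expR (- (s ^+ 2 * sigma2 / 2)) * c s th n| <= `|s| ^+ 3 * sigma2 ^+ 2.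
  rewrite -mulrBl normrM -[leRHS]mulr1 ler_pM//.
  apply: le_trans (expRN_quad _) _; first by rewrite divr_ge0// mulr_ge0// sqr_ge0.
  rewrite -[s ^+ 2]real_normK ?num_real//; set r := `|s| in s1 *.
  have r0 : 0 <= r by exact: normr_ge0.
  have -> : (r ^+ 2 * sigma2 / 2) ^+ 2 = (r ^+ 3 * sigma2 ^+ 2) * (r / 4) by field.
  by rewrite ler_piMr ?mulr_ge0 ?exprn_ge0//; lra.
rewrite step2 in step1.
set x := c s th n.+1 in step1 *; set y := c s th n in step1 step3 *.
set z := \int[_]_w _ in corr step1; set q := expR _ in step3 *.
set t := s ^+ 2 * sigma2 / 2 in step1 step3; set A := l%:R * K * K2 in corr C C0 *.
set B := (if (n < l)%N then K2 else 0) in corr.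
have sz : `|- (s ^+ 2 / 2) * z| <= s ^+ 2 / 2 * (e + `|s| * A + B).
  by rewrite normrM normrN (ger0_norm (divr_ge0 (sqr_ge0 _) _))// ler_wpM2l// divr_ge0 ?sqr_ge0.
have -> : x - q * y = (x - ((1 - t) * y + - (s ^+ 2 / 2) * z)) + (((1 - t) * y - q * y) + - (s ^+ 2 / 2) * z).
  ring.
apply: le_trans (ler_normD _ _) _; apply: le_trans (lerD step1 (ler_normD _ _)) _.
apply: le_trans (lerD (lexx _) (lerD step3 sz)) _.
have sE : s ^+ 2 * `|s| = `|s| ^+ 3 by rewrite -[s ^+ 2]real_normK ?num_real// -exprSr.
have -> : s ^+ 2 / 2 * (e + `|s| * A + B) = s ^+ 2 * e / 2 + `|s| ^+ 3 * A / 2 + s ^+ 2 / 2 * B.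
  by rewrite -sE; field.
have k3 : 0 <= `|s| ^+ 3 by rewrite exprn_ge0.
have A0 : 0 <= A by rewrite !mulr_ge0 ?ler0n.
have s2 : 0 <= s ^+ 2 by exact: sqr_ge0.
have h1 : 0 <= s ^+ 2 * e by rewrite mulr_ge0// ltW.
have h2 : 0 <= `|s| ^+ 3 * A by rewrite mulr_ge0.
have h3 : 0 <= `|s| ^+ 3 * K2 by rewrite mulr_ge0.
have h4 : s ^+ 2 / 2 * B <= (if (n < l)%N then C * s ^+ 2 else 0).
  rewrite /B; case: ifP => _; last by rewrite mulr0.
  rewrite [leRHS]mulrC -mulrA ler_wpM2l// /C.
  have K30 : 0 <= K ^+ 3 by rewrite exprn_ge0.
  have := sqr_ge0 sigma2; lra.
have -> : C * `|s| ^+ 3 = 2 * (`|s| ^+ 3 * K ^+ 3) + `|s| ^+ 3 * sigma2 ^+ 2 + `|s| ^+ 3 * A + `|s| ^+ 3 * K2.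
  by rewrite /C; ring.
set I := (if _ then C * _ else 0) in h4 *; set BB := s ^+ 2 / 2 * B in h4 *.
set a1 := s ^+ 2 * e in h1 *; set a2 := `|s| ^+ 3 * A in h2 *; set a3 := `|s| ^+ 3 * K2 in h3 *.
set a4 := `|s| ^+ 3 * K ^+ 3; set a5 := `|s| ^+ 3 * sigma2 ^+ 2.
clear -h1 h2 h3 h4; clearbody I BB a1 a2 a3 a4 a5; lra.
Qed.

Lemma martingale_characteristic e : 0 < e ->
  exists C : R, 0 <= C /\ forall s th n, `|s| <= 1 ->
    `|c s th n - expR (- (n%:R * s ^+ 2 * sigma2 / 2)) * cos th| <=
      n%:R * (C * `|s| ^+ 3 + s ^+ 2 * e) + C * s ^+ 2.
Proof.
move=> e0; have [C [l [C0 HC]]] := martingale_characteristic_step e0.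
exists (l%:R * C + C); split=> [|s th n s1]; first by rewrite addr_ge0 ?mulr_ge0 ?ler0n.
have s20 := limit_variance_ge0; have ss := sqr_ge0 s.
have lC : 0 <= l%:R * C by rewrite mulr_ge0 ?ler0n.
have k3 : 0 <= `|s| ^+ 3 by rewrite exprn_ge0.
(* The strengthened bound counts the early steps, [minn n l] of them. Errors do not grow along the
   induction because the factor [q] is at most 1. *)
suff H : `|c s th n - expR (- (n%:R * s ^+ 2 * sigma2 / 2)) * cos th| <=
      n%:R * (C * `|s| ^+ 3 + s ^+ 2 * e) + (minn n l)%:R * (C * s ^+ 2).
  apply: le_trans H _; apply: lerD.
    by rewrite ler_wpM2l ?ler0n// lerD2r ler_wpM2r// lerDr.
  apply: (@le_trans _ _ (l%:R * (C * s ^+ 2))).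
    by apply: ler_wpM2r; [exact: mulr_ge0|rewrite ler_nat geq_minr].
  by rewrite mulrA ler_wpM2r// lerDl.
elim: n => [|n IH].
  rewrite /c min0n !mul0r oppr0 expR0 mul1r addr0.
  rewrite (_ : \int[P]_w _ = cos th) ?subrr ?normr0//.
  rewrite -[RHS](Rintegral_prob_cst P); apply: eq_Rintegral => w _.
  by rewrite /M big_ord0 mulr0 add0r.
have := HC s th n s1; set q := expR _.
have -> : expR (- (n.+1%:R * s ^+ 2 * sigma2 / 2)) = q * expR (- (n%:R * s ^+ 2 * sigma2 / 2)).
  by rewrite /q -expRD -natr1; congr expR; field.
set y := expR _ in IH *; move=> h1.
have q0 : 0 <= q by exact: expR_ge0.
have q1 : q <= 1.
  by rewrite /q -[leRHS]expR0 ler_expR oppr_le0 divr_ge0// mulr_ge0.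
have -> : c s th n.+1 - q * y * cos th = (c s th n.+1 - q * c s th n) + q * (c s th n - y * cos th) by ring.
apply: le_trans (ler_normD _ _) _.
have h2 : `|q * (c s th n - y * cos th)| <= `|c s th n - y * cos th|.
  by rewrite normrM (ger0_norm q0) ler_piMl.
apply: le_trans (lerD h1 (le_trans h2 IH)) _.
rewrite -natr1 mulrDl mul1r.
have : (if (n < l)%N then C * s ^+ 2 else 0) + (minn n l)%:R * (C * s ^+ 2) <=
    (minn n.+1 l)%:R * (C * s ^+ 2).
  have Cs : 0 <= C * s ^+ 2 by rewrite mulr_ge0.
  case: ltnP => nl.
    by rewrite (minn_idPl nl) -natr1 mulrDl mul1r addrC.
  by rewrite add0r (minn_idPr (leqW nl)).
lra.
Qed.

(** Orthogonality of the increments: [L] annihilates the cross term [2 D * M n]. This bound is the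
    source of tightness. *)
Lemma martingale_second_moment n : \int[P]_w (M n (past_of w) ^+ 2) = n%:R * sigma2.
Proof.
have bM2 m : bounded_measurable (fun w => M m w ^+ 2).
  exact: (bounded_measurableM (bounded_measurable_martingale m) (bounded_measurable_martingale m)).
elim: n => [|n IH].
  rewrite mul0r -[RHS](Rintegral_prob_cst P); apply: eq_Rintegral => w _.
  by rewrite /M big_ord0 expr0n.
rewrite -(Rintegral_transfer gF gP (bM2 n.+1)).
have -> : \int[P]_w transfer g (fun w => M n.+1 w ^+ 2) (past_of w) =
   \int[P]_w (1 * v (past_of w) + 1 * M n (past_of w) ^+ 2).
  apply: eq_Rintegral => w0 _; set w := past_of w0.
  rewrite (_ : (fun p => M n.+1 p ^+ 2) =
    (fun p => 1 * (1 * D p ^+ 2 + (2 * D p) * M n (ptail p)) + 1 * (1 * M n (ptail p) ^+ 2))); last first.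
    by apply/funext => p; rewrite martingaleS; ring.
  have e1 : transfer g (fun p => 1 * M n (ptail p) ^+ 2) w = M n w ^+ 2.
    by rewrite (transfer_tail g (fun=> 1) (fun p => M n p ^+ 2)) transfer_cst// mul1r.
  have e2 : transfer g (fun p => (2 * D p) * M n (ptail p)) w = 0.
    rewrite (transfer_tail g (fun p => 2 * D p) (M n)).
    rewrite (_ : (fun p => 2 * D p) = (fun p => 2 * D p + 0 * 0)); last by apply/funext => p; ring.
    by rewrite (transfer_linear g 2 0 D (fun=> 0)) -/L transfer_martingale_difference mulr0 mul0r addr0 mul0r.
  have e3 : transfer g (fun p => 1 * D p ^+ 2 + (2 * D p) * M n (ptail p)) w = v w.
    rewrite (_ : (fun p => _) = (fun p => 1 * D p ^+ 2 + 1 * ((2 * D p) * M n (ptail p)))).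
      by rewrite transfer_linear e2 mulr0 addr0 mul1r.
    by apply/funext => p; ring.
  by rewrite transfer_linear e1 e3.
rewrite Rintegral_linear; [|exact: bmp rv.1|exact: bmp (bM2 n)].
by rewrite Rintegral_conditional_variance IH -natr1; ring.
Qed.

(** A conditional variance: with [h = f0 + G] and [L h = G], the mean of [D^2] is that of
    [h^2 - (L h)^2], and [G^2] cancels. *)
Lemma limit_varianceE : sigma2 =
  \int[P]_w (f0 (past_of w) ^+ 2) + 2 * \int[P]_w (f0 (past_of w) * G (past_of w)).
Proof.
have bG := rG.1; have bf0 := rf0.1.
have bs := regular_funD rf0 rG.
have bq : bounded_measurable (fun w => (f0 w + G w) ^+ 2) by exact: (bounded_measurableM bs.1 bs.1).
have bG2 : bounded_measurable (fun w => G w ^+ 2) by exact: (bounded_measurableM bG bG).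
have bf2 : bounded_measurable (fun w => f0 w ^+ 2) by exact: (bounded_measurableM bf0 bf0).
have bfG : bounded_measurable (fun w => f0 w * G w) by exact: bounded_measurableM.
have Lq := bounded_measurable_transfer gF bq.
rewrite -Rintegral_conditional_variance.
have -> : \int[P]_w v (past_of w) =
    \int[P]_w (1 * transfer g (fun w => (f0 w + G w) ^+ 2) (past_of w) + (-1) * G (past_of w) ^+ 2).
  apply: eq_Rintegral => w0 _; set w := past_of w0.
  rewrite /v /L (_ : (fun w => D w ^+ 2) = (fun p => 1 * (1 * (f0 p + G p) ^+ 2 + ((-2) * (f0 p + G p)) * G (ptail p)) + 1 * (1 * G (ptail p) ^+ 2))); last first.
    by apply/funext => p; rewrite /D; ring.
  have e1 : transfer g (fun p => 1 * G (ptail p) ^+ 2) w = G w ^+ 2.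
    by rewrite (transfer_tail g (fun=> 1) (fun p => G p ^+ 2)) transfer_cst// mul1r.
  have e2 : transfer g (fun p => ((-2) * (f0 p + G p)) * G (ptail p)) w = (-2) * G w ^+ 2.
    rewrite (transfer_tail g (fun p => (-2) * (f0 p + G p)) G).
    rewrite (_ : (fun p => (-2) * (f0 p + G p)) = (fun p => (-2) * f0 p + (-2) * G p)); last by apply/funext => p; ring.
    by rewrite transfer_linear -/L -mulrDr -GE; ring.
  rewrite transfer_linear e1 (_ : (fun p => _) = (fun p => 1 * (f0 p + G p) ^+ 2 + 1 * (((-2) * (f0 p + G p)) * G (ptail p)))).
    by rewrite transfer_linear e2; ring.
  by apply/funext => p; ring.
rewrite Rintegral_linear; [|exact: bmp Lq|exact: bmp bG2].
rewrite (Rintegral_transfer gF gP bq).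
have -> : \int[P]_w ((f0 (past_of w) + G (past_of w)) ^+ 2) =
   \int[P]_w (1 * (1 * f0 (past_of w) ^+ 2 + 2 * (f0 (past_of w) * G (past_of w))) + 1 * G (past_of w) ^+ 2).
  by apply: eq_Rintegral => w _; ring.
rewrite Rintegral_linear; [|exact: (bmp (bounded_measurableD (bounded_measurableZ 1 bf2) (bounded_measurableZ 2 bfG)))|exact: bmp bG2].
rewrite Rintegral_linear; [|exact: bmp bf2|exact: bmp bfG].
ring.
Qed.

Lemma sum_coordinates_martingale n w :
  \sum_(i < n) f (w i) = M n w - G w + G (iter n (@ptail E) w).
Proof.
elim: n w => [|n IH] w; first by rewrite /M !big_ord0 add0r addNr.
by rewrite big_ord_recl /= (IH (ptail w)) martingaleS -iterS iterSr /D /f0; ring.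
Qed.

End martingale.

Lemma Rintegral_iter_shift n (h : config int E -> R) : bounded_measurable h ->
  \int[P]_w h (fun k => w (k + n%:Z)) = \int[P]_w h w.
Proof.
move=> bh; elim: n => [|n IH].
  apply: eq_Rintegral => w _; congr h; apply/funext => k; congr w; lia.
rewrite -IH; pose h' (w : config int E) := h (fun k => w (k + n%:Z)).
have bh' : bounded_measurable h'.
  pose T (w : config int E) : config int E := fun k => w (k + n%:Z).
  have mT : measurable_fun setT T.
    by apply: measurable_to_config => i B; exact: measurable_coordinate.
  exact: (bounded_measurable_comp mT bh).
rewrite -[RHS](Rintegral_shift gP bh'); apply: eq_Rintegral => w _.
rewrite /h' /config_shift; congr h; apply/funext => k; congr w; lia.
Qed.

Let S n (w : config int E) := \sum_(i < n) f (w i%:Z).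

(** Stationarity moves the sites [0, ..., n - 1] to [-n, ..., -1], where the transfer operator acts;
    the order of summation is reversed on the way. *)
Lemma Rintegral_partial_sum n (h : R -> R) : continuous h ->
  \int[P]_w h (S n w) = \int[P]_w h (\sum_(i < n) f (past_of w i)).
Proof.
move=> ch; pose F (p : past E) := \sum_(i < n) f (p i).
have bF : bounded_measurable F.
  by apply: bounded_measurable_sum => i; exact: bounded_measurable_coordinate.
have bhF : bounded_measurable (fun w : config int E => h (F (past_of w))).
  have [mF [K FK]] := bounded_measurable_comp (@measurable_past_of E) bF.
  split.
    by apply: measurableT_comp => //; exact: continuous_measurable_fun.
  (* [h] may be unbounded, as for the square, so a bound is taken on the range [[- K, K]] of the
     sum. *)
  have [||c _ cM] := @EVT_max R h (- K) K.
  - by have := le_trans (normr_ge0 _) (FK point); lra.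
  - exact: continuous_subspaceT.
  have [||c' _ cm] := @EVT_min R h (- K) K.
  - by have := le_trans (normr_ge0 _) (FK point); lra.
  - exact: continuous_subspaceT.
  exists (`|h c| + `|h c'|) => w.
  have Fw : F (past_of w) \in `[- K, K] by rewrite in_itv/= -ler_norml.
  have := cM _ Fw; have := cm _ Fw.
  rewrite ler_norml => h1 h2; apply/andP; split.
    by have := ler_norm (- h c'); rewrite normrN; have := normr_ge0 (h c); lra.
  by have := ler_norm (h c); have := normr_ge0 (h c'); lra.
rewrite -[RHS](Rintegral_iter_shift n bhF); apply: eq_Rintegral => w _; congr h.
rewrite /S /F (reindex_inj rev_ord_inj)/=; apply: eq_bigr => i _; congr (f _).
by rewrite /past_of; congr w; have := ltn_ord i; lia.
Qed.

(** Collects what is used of the chain afterwards, with [G] eliminated: the characteristic function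
    for the limit law and for the comparison with blocks, the second moment for tightness, and the
    correlation series. *)
Theorem g_chain_characteristic : exists sigma2 : R, [/\ 0 <= sigma2,
  gaussian_characteristic sigma2 (fun s th n => \int[P]_w cos (s * S n w + th)),
  exists C : R, forall n, \int[P]_w (S n w ^+ 2) <= C * n.+1%:R &
  (\sum_(1 <= i < n) \int[P]_w (f (w 0) * f (w i%:Z))) @[n --> \oo] -->
     (sigma2 - \int[P]_w (f (w 0) ^+ 2)) / 2].
Proof.
have [G [rG GE Glim]] := poisson_solution.
have bG := rG.1; have [_ [K GK]] := bG.
have K0 : 0 <= K := le_trans (normr_ge0 _) (GK point).
have bmp (h : past E -> R) : bounded_measurable h ->
  bounded_measurable (fun w : config int E => h (past_of w)).
  exact: (bounded_measurable_comp (@measurable_past_of E)).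
have bS n : bounded_measurable (fun p : past E => \sum_(i < n) f (p i)).
  by apply: bounded_measurable_sum => i; exact: bounded_measurable_coordinate.
have SM n p : `|\sum_(i < n) f (p i) - martingale G n p| <= K + K.
  rewrite (sum_coordinates_martingale G) addrAC [X in `|X + _|]addrAC subrr add0r addrC.
  by rewrite (le_trans (ler_normB _ _))// lerD.
have bM n := bounded_measurable_martingale rG n.
exists (limit_variance G); split.
- exact: limit_variance_ge0.
- move=> e e0; have [C [C0 HC]] := martingale_characteristic rG GE e0.
  exists (C + (K + K)); split=> [|s th n s1]; first by rewrite !addr_ge0.
  rewrite (@Rintegral_partial_sum n (fun x => cos (s * x + th))); last first.
    exact: (trigpoly_continuous (trigpoly_cos s th)).
  have bc (F : past E -> R) : bounded_measurable F -> bounded_measurable (fun w : config int E => cos (s * F (past_of w) + th)).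
    move=> bF; apply: bounded_measurable_cos; apply: measurable_funD => //.
    by apply: measurable_funM => //; exact: (bmp _ bF).1.
  have h1 := HC s th n s1.
  have h2 : `|\int[P]_w cos (s * (\sum_(i < n) f (past_of w i)) + th) -
      \int[P]_w cos (s * martingale G n (past_of w) + th)| <= `|s| * (K + K).
    apply: Rintegral_dist_cst; [exact: (bc _ (bS n))|exact: (bc _ (bM n))|].
    move=> w; rewrite (le_trans (cos_lipschitz _ _))//.
    by rewrite opprD addrACA subrr addr0 -mulrBr normrM ler_wpM2l.
  move: h1 h2; set x := \int[_]_w _; set y := \int[_]_w _; set z := expR _ * _ => h1 h2.
  have -> : y - z = (y - x) + (x - z) by ring.
  apply: le_trans (ler_normD _ _) _; apply: le_trans (lerD h2 h1) _.
  have ss : s ^+ 2 <= `|s|.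
    by rewrite -real_normK ?num_real// expr2 ler_piMl.
  have h3 : C * s ^+ 2 <= C * `|s| by rewrite ler_wpM2l.
  have h4 : n%:R * (C * `|s| ^+ 3 + s ^+ 2 * e) <= n%:R * ((C + (K + K)) * `|s| ^+ 3 + s ^+ 2 * e).
    by rewrite ler_wpM2l ?ler0n// lerD2r ler_wpM2r ?exprn_ge0// lerDl addr_ge0.
  move: h3 h4; set u := n%:R * _; set u' := n%:R * _ => h3 h4; lra.
- exists (2 * limit_variance G + 2 * (K + K) ^+ 2) => n.
  rewrite (@Rintegral_partial_sum n (fun x => x ^+ 2)); last exact: sqr_continuous.
  have bM2 : bounded_measurable (fun w => martingale G n w ^+ 2) by exact: (bounded_measurableM (bM n) (bM n)).
  apply: (@le_trans _ _ (\int[P]_w (2 * martingale G n (past_of w) ^+ 2 + 2 * (cst ((K + K) ^+ 2) w)))).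
    apply: Rintegral_le.
    - exact: (bmp _ (bounded_measurableM (bS n) (bS n))).
    - apply: bounded_measurableD; first exact: (bmp _ (bounded_measurableZ 2 bM2)).
      exact/bounded_measurableZ/bounded_measurable_cst.
    move=> w; rewrite /cst/=; have := SM n (past_of w).
    set x := \sum_(_ < _) _; set y := martingale _ _ _ => xy.
    have : (x - y) ^+ 2 <= (K + K) ^+ 2.
      by rewrite -real_normK ?num_real// lerXn2r ?nnegrE ?addr_ge0.
    (* [(x - 2 y)^2] is exactly [2 y^2 + 2 (x - y)^2 - x^2]. *)
    by have := sqr_ge0 (x - 2 * y); nra.
  rewrite Rintegral_linear; [|exact: bmp bM2|exact: bounded_measurable_cst].
  rewrite (martingale_second_moment rG GE) Rintegral_prob_cst -natr1.
  have := limit_variance_ge0 G; have := sqr_ge0 (K + K); have := ler0n R n.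
  by set sg := limit_variance _; set kk := (K + K) ^+ 2; nra.
(* A shift by [i + 1] brings sites [0] and [i] to [-1 - i] and [-1]; conditioning on the older site
   then produces the [i]-th iterate of [L]. *)
- have cov i : \int[P]_w (f (w 0) * f (w i%:Z)) =
      \int[P]_w (iter i L f0 (past_of w) * f0 (past_of w)).
    rewrite -(Rintegral_tail gF gP i rf0.1 rf0.1).
    have bff : bounded_measurable (fun w : config int E => f (w (-1)) * f (w (-1 - i%:Z))).
      by apply: bounded_measurableM; exact: bounded_measurable_coordinate.
    have iE (p : past E) : f0 (iter i (@ptail E) p) = f (p i).
      rewrite /f0; congr f; elim: i {bff} p => //= i IH p.
      by rewrite -iterS iterSr IH.
    under [RHS]eq_Rintegral do rewrite iE.
    have -> : \int[P]_w (f0 (past_of w) * f (past_of w i)) =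
       \int[P]_w (f (w (-1)) * f (w (-1 - i%:Z))).
      by apply: eq_Rintegral => w _; rewrite /f0 /past_of; congr (f (w _) * f (w _)); lia.
    rewrite -(Rintegral_iter_shift i.+1 bff); apply: eq_Rintegral => w _.
    by rewrite mulrC; congr (f (w _) * f (w _)); lia.
  rewrite (limit_varianceE rG GE).
  have -> : (\int[P]_w (f0 (past_of w) ^+ 2) + 2 * \int[P]_w (f0 (past_of w) * G (past_of w)) -
      \int[P]_w (f (w 0) ^+ 2)) / 2 = \int[P]_w (f0 (past_of w) * G (past_of w)).
    have -> : \int[P]_w (f (w 0) ^+ 2) = \int[P]_w (f0 (past_of w) ^+ 2).
      have := cov 0%N; rewrite /=.
      by under eq_Rintegral do rewrite -expr2; under [RHS]eq_Rintegral do rewrite -expr2.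
    by field.
  have bL m : bounded_measurable (iter m L f0).
    by apply: bounded_measurable_iter_transfer => //; exact: rf0.1.
  have [_ [F0 hF0]] := rf0.1.
  have F00 : 0 <= F0 := le_trans (normr_ge0 _) (hF0 point).
  have sumE n : \sum_(1 <= i < n.+1) \int[P]_w (f (w 0) * f (w i%:Z)) =
      \int[P]_w (f0 (past_of w) * \sum_(m < n) iter m.+1 L f0 (past_of w)).
    elim: n => [|n IH].
      rewrite big_geq// -[LHS](Rintegral_prob_cst P); apply: eq_Rintegral => w _.
      by rewrite big_ord0 mulr0.
    rewrite big_nat_recr//= IH cov -[X in X + _]mul1r -[X in _ + X]mul1r -Rintegral_linear.
    + by apply: eq_Rintegral => w _; rewrite big_ord_recr/=; ring.
    + apply: (bmp (fun p => f0 p * \sum_(m < n) iter m.+1 L f0 p)).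
      by apply: bounded_measurableM; [exact: rf0.1|apply: bounded_measurable_sum].
    + by apply: (bmp (fun p => iter n.+1 L f0 p * f0 p)); apply: bounded_measurableM => //; exact: rf0.1.
  (* The partial sums converge to [G] uniformly, so the limit passes through the integral against
     the bounded [f0]. *)
  apply/cvgrPdist_le => e e0.
  have e'0 : 0 < e / (F0 + 1) by rewrite divr_gt0// ltr_wpDl.
  have [N HN] := Glim _ e'0; exists N.+1 => // -[//|n]/= Nn; rewrite sumE.
  apply: Rintegral_dist_cst.
  + by apply: (bmp (fun p => f0 p * G p)); apply: bounded_measurableM => //; exact: rf0.1.
  + apply: (bmp (fun p => f0 p * \sum_(m < n) iter m.+1 L f0 p)).
    by apply: bounded_measurableM; [exact: rf0.1|apply: bounded_measurable_sum].
  move=> w; rewrite -mulrBr normrM.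
  apply: (@le_trans _ _ (F0 * (e / (F0 + 1)))).
    by apply: ler_pM => //; exact: HN.
  by rewrite mulrCA ler_piMr ?(ltW e0)// ler_pdivrMr ?ltr_wpDl// mul1r lerDl.
Qed.

End poisson_equation.

(** * From characteristic functions to the central limit theorem *)

Section clt.
Context d (W : measurableType d) (R : realType) (Q : probability W R).
Variables (S : nat -> W -> R) (sigma2 : R).
Hypothesis sigma2_ge0 : 0 <= sigma2.
Hypothesis bS : forall n, bounded_measurable (S n).
Hypothesis charS : gaussian_characteristic sigma2 (fun s th n => \int[Q]_w cos (s * S n w + th)).
Hypothesis S2 : exists C : R, forall n, \int[Q]_w (S n w ^+ 2) <= C * n.+1%:R.

Lemma clt_of_characteristic :
  cvg_in_distribution Q (fun n w => S n w / Num.sqrt n%:R) (centered_normal sigma2).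
Proof.
have mY n : measurable_fun setT (fun w => S n w / Num.sqrt n%:R).
  by apply: measurable_funM => //; case: (bS n).
apply: cvg_in_distribution_cos => // [e e0|t c].
  have [C HC] := S2.
  have C0 : 0 <= C.
    have := HC 0%N; rewrite mulr1; apply: le_trans; apply: Rintegral_ge0 => w _; exact: sqr_ge0.
  (* Chebyshev's inequality gives a tail of at most [2 C / A], using [n + 1 <= 2 n] and, since
     [A >= 1], [A <= A^2]. *)
  exists (2 * C / e + 1) => [|n].
    by rewrite ltr_wpDl// divr_ge0 ?(ltW e0)// mulr_ge0.
  set A := 2 * C / e + 1; have A1 : 1 <= A by rewrite lerDr divr_ge0 ?(ltW e0)// mulr_ge0.
  have A0 : 0 < A by lra.
  set B := [set w | _]; have mB : measurable B by exact: measurable_norm_gt.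
  rewrite -(Rintegral_indic Q mB) lee_fin.
  (* For [n = 0] the division by [sqrt 0] returns 0, so the event is empty. *)
  case: n => [|n] in B mB *.
    have -> : B = set0.
      by apply/seteqP; split=> w //; rewrite /B/= sqrtr0 invr0 mulr0 normr0; lra.
    by under eq_Rintegral do rewrite indicE in_set0; rewrite Rintegral_prob_cst ltW.
  have n0 : 0 < n.+1%:R :> R by rewrite ltr0n.
  have bS2 : bounded_measurable (fun w => S n.+1 w ^+ 2) by exact: (bounded_measurableM (bS _) (bS _)).
  apply: (@le_trans _ _ (\int[Q]_w ((A * n.+1%:R)^-1 * S n.+1 w ^+ 2))).
    apply: Rintegral_le; [exact: bounded_measurable_indic|exact: bounded_measurableZ|].
    move=> w; rewrite indicE; have [|_] := boolP (w \in B); last first.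
      by rewrite mulr_ge0 ?sqr_ge0// invr_ge0 mulr_ge0 ?ltW.
    rewrite inE /B/= => Aw; rewrite ler_pdivlMl ?mulr_gt0// mulr1.
    have s0 : 0 < Num.sqrt n.+1%:R :> R by rewrite sqrtr_gt0.
    have -> : S n.+1 w ^+ 2 = `|S n.+1 w / Num.sqrt n.+1%:R| ^+ 2 * n.+1%:R.
      rewrite real_normK ?num_real// exprMn exprVn sqr_sqrtr ?(ltW n0)//.
      by rewrite divfK// gt_eqF.
    rewrite ler_pM2r//; set y := `|_| in Aw *.
    by rewrite (le_trans (ltW Aw))// expr2 ler_peMl//; lra.
  rewrite RintegralZl//; last exact: bounded_measurable_integrable.
  rewrite mulrC ler_pdivrMr ?mulr_gt0//; apply: (le_trans (HC n.+1)).
  apply: (@le_trans _ _ (2 * C * n.+1%:R)).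
    rewrite -mulrA mulrCA ler_wpM2l// -[n.+2%:R]natr1 mulr_natl mulr2n lerD2l.
    by rewrite (ler_nat _ 1).
  rewrite mulrA ler_pM2r//.
  have -> : e * A = 2 * C + e by rewrite /A; field; rewrite gt_eqF.
  by rewrite lerDl ltW.
rewrite centered_normal_characteristic//.
apply/cvgrPdist_le => e e0.
pose e' := e / (2 * (t ^+ 2 + 1)).
have t2 : 0 <= t ^+ 2 := sqr_ge0 t.
have e'0 : 0 < e' by rewrite divr_gt0// mulr_gt0// ltr_wpDl.
have [C [C0 HC]] := charS e'0.
(* Once [sqrt n >= B], the frequency [t / sqrt n] is at most 1 in absolute value and the terms with
   [C] are at most [e / 2]. *)
pose B := (C * t ^+ 2 + C) * `|t| * (2 / e) + `|t| + 1.
have CB : 0 <= (C * t ^+ 2 + C) * `|t| * (2 / e).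
  by rewrite mulr_ge0 ?divr_ge0 ?(ltW e0)// mulr_ge0// addr_ge0// mulr_ge0.
have B0 : 0 < B by rewrite /B; have := normr_ge0 t; lra.
exists (Num.truncn (B ^+ 2)).+1 => // n /= Nn.
have n0 : 0 < n%:R :> R by rewrite ltr0n (leq_trans _ Nn).
set r := Num.sqrt n%:R; have r0 : 0 < r by rewrite sqrtr_gt0.
have r2 : r ^+ 2 = n%:R by rewrite sqr_sqrtr// ltW.
have Br : B <= r.
  rewrite -[leLHS](ger0_norm (ltW B0)) -sqrtr_sqr ler_sqrt ?(ltW n0)//.
  by apply/ltW; apply: lt_le_trans (truncnS_gt _) _; rewrite ler_nat.
have s1 : `|t / r| <= 1.
  rewrite normrM normfV (gtr0_norm r0) ler_pdivrMr// mul1r.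
  by move: Br; rewrite /B; lra.
have := HC (t / r) c n s1.
have -> : n%:R * (t / r) ^+ 2 = t ^+ 2 by rewrite -r2; field; rewrite gt_eqF.
rewrite [t ^+ 2 * sigma2]mulrC distrC.
under eq_Rintegral do rewrite mulrAC -mulrA.
move=> /le_trans; apply.
have -> : n%:R * (C * `|t / r| ^+ 3 + (t / r) ^+ 2 * e') + C * `|t / r| =
    (C * t ^+ 2 + C) * `|t| / r + t ^+ 2 * e'.
  rewrite normrM normfV (gtr0_norm r0) -[t ^+ 2]real_normK ?num_real// exprMn.
  rewrite [(t / r) ^+ 2]exprMn -[t ^+ 2]real_normK ?num_real// -r2; field; rewrite gt_eqF//.
rewrite (splitr e); apply: lerD.
  rewrite ler_pdivrMr// -ler_pdivrMl ?divr_gt0// invf_div mulrC.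
  by apply: le_trans Br; rewrite /B; have := normr_ge0 t; lra.
rewrite /e' mulrA ler_pdivrMr ?mulr_gt0 ?ltr_wpDl//; have := ltW e0; nra.
Qed.

End clt.

(** * Abel sums of characteristic functions *)

Section abel.
Context {R : realType}.

Lemma arithmetic_geometric_sum_le (r : R) n : 0 <= r < 1 ->
  \sum_(i < n) i%:R * r ^+ i <= (1 - r)^-1 ^+ 2.
Proof.
move=> r01; have /andP[r0 r1] := r01.
elim: n => [|n IH]; first by rewrite big_ord0 sqr_ge0.
rewrite big_ord_recl/= mul0r add0r.
have -> : \sum_(i < n) (bump 0 i)%:R * r ^+ (bump 0 i) =
    r * (\sum_(i < n) i%:R * r ^+ i + \sum_(i < n) r ^+ i).
  rewrite -big_split/= mulr_sumr; apply: eq_bigr => i _.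
  by rewrite /bump/= add1n exprS -natr1; ring.
apply: (@le_trans _ _ (r * ((1 - r)^-1 ^+ 2 + (1 - r)^-1))).
  by rewrite ler_wpM2l// lerD// geometric_sum_le.
have : 1 - r != 0 by lra.
set b := (1 - r)^-1 => r1'; have -> : r = 1 - b^-1 by rewrite /b invrK; ring.
have b0 : b != 0 by rewrite invr_eq0.
have -> : (1 - b^-1) * (b ^+ 2 + b) = b ^+ 2 - 1 by field.
by rewrite gerBl.
Qed.

(** The parameter is [m + 1] here and in [frequency], so that every index [m] is admissible. *)
Definition discount (m : nat) : R := expR (- m.+1%:R^-1).
Definition frequency (m : nat) : R := (Num.sqrt m.+1%:R)^-1.

Lemma discountX m k : discount m ^+ k = expR (- (k%:R / m.+1%:R)).
Proof. by rewrite /discount -expRM_natl mulrN. Qed.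

Lemma discount01 m : 0 <= discount m < 1.
Proof.
by rewrite expR_ge0/= -[ltRHS]expR0 ltr_expR oppr_lt0 invr_gt0 ltr0n.
Qed.

Lemma frequency_ge0 m : 0 <= frequency m.
Proof. by rewrite invr_ge0 sqrtr_ge0. Qed.

Lemma sqr_frequency m : m.+1%:R * frequency m ^+ 2 = 1.
Proof. by rewrite exprVn sqr_sqrtr ?ler0n// divff// pnatr_eq0. Qed.

Lemma cvg_frequency : frequency m @[m --> \oo] --> 0.
Proof.
apply/cvgrPdist_le => e e0; exists (Num.truncn (e^-1 ^+ 2)) => // n /= Nn.
have s0 : 0 < Num.sqrt n.+1%:R :> R by rewrite sqrtr_gt0 ltr0n.
rewrite sub0r normrN gtr0_norm ?invr_gt0//.
rewrite -[leRHS]invrK lef_pV2 ?posrE ?invr_gt0//.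
rewrite -[leLHS](ger0_norm (ltW (_ : 0 < e^-1))) ?invr_gt0// -sqrtr_sqr ler_sqrt ?ltr0n//.
apply/ltW; apply: lt_le_trans (truncnS_gt _) _; by rewrite ler_nat.
Qed.

Lemma one_minus_expRN_ge (m : nat) : (m.+1.+1%:R : R)^-1 <= 1 - expR (- m.+1%:R^-1).
Proof.
have m0 : 0 < m.+1%:R :> R by rewrite ltr0n.
rewrite lerBrDr -lerBrDl expRN.
have -> : 1 - (m.+2%:R)^-1 = (1 + m.+1%:R^-1)^-1 :> R.
  by rewrite -[m.+2%:R]natr1; field; rewrite gt_eqF//=; lra.
by rewrite lef_pV2 ?posrE ?expR_gt0 ?ltr_wpDr ?invr_ge0 ?(ltW m0)// expR_ge1Dx.
Qed.

Lemma discount_inv_le m : (1 - discount m)^-1 <= 2 * m.+1%:R.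
Proof.
apply: (@le_trans _ _ m.+2%:R).
  rewrite -[leRHS]invrK lef_pV2 ?posrE ?invr_gt0 ?ltr0n ?one_minus_expRN_ge//.
  by case/andP: (discount01 m); lra.
by rewrite -natrM ler_nat mul2n -addnn addSn addnS !ltnS leq_addr.
Qed.

Lemma cvg_one_minus_expRN (k : R) : 0 <= k ->
  m.+1%:R * (1 - expR (- (k / m.+1%:R))) @[m --> \oo] --> k.
Proof.
move=> k0; apply/cvgrPdist_le => e e0.
exists (Num.truncn (k ^+ 2 / e)) => // m /= Nm.
have m0 : 0 < m.+1%:R :> R by rewrite ltr0n.
have := expRN_quad (divr_ge0 k0 (ltW m0)).
set y := expR _; set x := k / _ => xy.
have -> : k - m.+1%:R * (1 - y) = - (m.+1%:R * (1 - x - y)).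
  by rewrite /x; field; rewrite gt_eqF.
rewrite normrN normrM gtr0_norm//.
apply: (@le_trans _ _ (m.+1%:R * x ^+ 2)); first by rewrite ler_pM2l.
have -> : m.+1%:R * x ^+ 2 = k ^+ 2 / m.+1%:R by rewrite /x; field; rewrite gt_eqF.
rewrite ler_pdivrMr// mulrC -ler_pdivrMr//.
by apply/ltW; apply: lt_le_trans (truncnS_gt _) _; rewrite ler_nat.
Qed.

Lemma cvg_expRN_nat (k : R) : 0 < k -> expR (- (k * m.+1%:R)) @[m --> \oo] --> 0.
Proof.
move=> k0; apply/cvgrPdist_le => e e0.
exists (Num.truncn (k * e)^-1) => // m /= Nm; rewrite sub0r normrN ger0_norm ?expR_ge0//.
rewrite expRN -[leRHS]invrK lef_pV2 ?posrE ?expR_gt0 ?invr_gt0//.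
apply: le_trans (expR_ge1Dx _); apply: (@le_trans _ _ (k * m.+1%:R)); last by rewrite lerDr.
rewrite -ler_pdivrMl// -invfM; apply/ltW; apply: lt_le_trans (truncnS_gt _) _.
by rewrite ler_nat.
Qed.

(** Against the Gaussian main term, [r^n] combines into the powers of [q m = exp (- k / (m + 1))], a
    geometric sum equivalent to [(m + 1) / k]. Stopping at [(m + 1)^2] terms costs a factor
    [1 - exp (- k (m + 1))], which tends to 1. *)
Lemma abel_limit (sigma2 : R) (c : R -> R -> nat -> R) th : 0 <= sigma2 ->
  gaussian_characteristic sigma2 c ->
  (\sum_(n < m.+1 * m.+1) discount m ^+ n * c (frequency m) th n) / m.+1%:R
    @[m --> \oo] --> cos th / (1 + sigma2 / 2).
Proof.
move=> s20 charc; pose k := 1 + sigma2 / 2; have k0 : 0 < k by rewrite /k; lra.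
pose q (m : nat) := expR (- (k / m.+1%:R)).
have main : (\sum_(n < m.+1 * m.+1) q m ^+ n) / m.+1%:R @[m --> \oo] --> k^-1.
  have -> : (fun m : nat => (\sum_(n < m.+1 * m.+1) q m ^+ n) / m.+1%:R) =
      (fun m : nat => (1 - expR (- (k * m.+1%:R))) * (m.+1%:R * (1 - q m))^-1).
    apply/funext => m; have m0 : 0 < m.+1%:R :> R by rewrite ltr0n.
    have q1 : q m < 1 by rewrite /q -[ltRHS]expR0 ltr_expR oppr_lt0 divr_gt0.
    have -> : expR (- (k * m.+1%:R)) = q m ^+ (m.+1 * m.+1).
      rewrite /q -expRM_natl natrM; congr expR; field; rewrite gt_eqF//.
    have := subrX1 (q m) (m.+1 * m.+1); set S := \sum_(_ < _) _ => H.
    have -> : 1 - q m ^+ (m.+1 * m.+1) = (1 - q m) * S by rewrite -[1 - q m]opprB mulNr -H opprB.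
    by field; rewrite gt_eqF//=; lra.
  rewrite -[X in _ --> X]mul1r; apply: cvgM.
    rewrite -[X in _ --> X]subr0; apply: cvgB; [exact: cvg_cst|exact: cvg_expRN_nat].
  by apply: cvgV; [rewrite gt_eqF|apply: cvg_one_minus_expRN; exact: ltW].
have {}main : (\sum_(n < m.+1 * m.+1) q m ^+ n) / m.+1%:R * cos th @[m --> \oo] --> cos th / k.
  by rewrite mulrC; apply: cvgMr_tmp.
apply/cvgrPdist_le => e e0.
(* The sum of [n r^n] is at most [4 (m + 1)^2] and [s^2 = 1 / (m + 1)], so [e / 16] becomes [e / 4]
   times [m + 1]. *)
have e80 : 0 < e / 16 by rewrite divr_gt0.
have [C [C0 HC]] := charc _ e80.
have e20 : 0 < e / 2 by rewrite divr_gt0.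
(* The terms in [C] add up to [6 C s (m + 1)]: 4 from the cubic error and 2 from the linear one.
   This bound on [s] makes [6 C s <= e / 4]. *)
have C6 : 0 < e / (4 * (6 * C + 1)) by rewrite divr_gt0// mulr_gt0//; lra.
have /cvgrPdist_le/(_ _ e20) H1 := main.
have /cvgrPdist_le/(_ _ C6) H2 := cvg_frequency.
near=> m.
have hs : `|0 - frequency m| <= e / (4 * (6 * C + 1)) by near: m; exact: H2.
have hm : `|cos th / k - (\sum_(n < m.+1 * m.+1) q m ^+ n) / m.+1%:R * cos th| <= e / 2.
  by near: m; exact: H1.
have m0 : 0 < m.+1%:R :> R by rewrite ltr0n.
set s := frequency m.
have s0 : 0 < s by rewrite invr_gt0 sqrtr_gt0.
have s2 : s ^+ 2 = m.+1%:R^-1 by rewrite /s exprVn sqr_sqrtr// ltW.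
have s1 : `|s| <= 1.
  rewrite gtr0_norm// invf_le1 ?sqrtr_gt0// -[leLHS]sqrtr1 ler_sqrt ?ltr0n//.
  by rewrite (ler_nat _ 1).
set r := discount m; have r01 : 0 <= r < 1 := discount01 m.
have /andP[r0 r1] := r01.
have rb : (1 - r)^-1 <= 2 * m.+1%:R := discount_inv_le m.
set N := (m.+1 * m.+1)%N.
have rq n : r ^+ n * expR (- (n%:R * s ^+ 2 * sigma2 / 2)) = q m ^+ n.
  rewrite /r /q /discount -!expRM_natl -expRD s2 /k; congr expR; field; rewrite gt_eqF//.
have near_geom : `|(\sum_(n < N) q m ^+ n) / m.+1%:R * cos th -
    (\sum_(n < N) r ^+ n * c s th n) / m.+1%:R| <= e / 2.
  rewrite mulrAC -mulrBl normrM normfV (gtr0_norm m0) ler_pdivrMr//.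
  rewrite mulr_suml -sumrB (le_trans (ler_norm_sum _ _ _))//.
  apply: (@le_trans _ _ (\sum_(n < N) (n%:R * r ^+ n * (C * s ^+ 3 + s ^+ 2 * (e / 16)) + C * s * r ^+ n))).
    apply: ler_sum => n _.
    have -> : q m ^+ n * cos th - r ^+ n * c s th n =
        r ^+ n * (expR (- (n%:R * s ^+ 2 * sigma2 / 2)) * cos th - c s th n).
      by rewrite -rq; ring.
    rewrite normrM (ger0_norm (exprn_ge0 _ r0)) distrC.
    apply: (le_trans (ler_wpM2l (exprn_ge0 _ r0) (HC s th n s1))).
    rewrite (gtr0_norm s0) le_eqVlt; apply/orP; left; apply/eqP; ring.
  rewrite big_split/= -mulr_suml -mulr_sumr.
  have h1 := arithmetic_geometric_sum_le N r01; have h2 := geometric_sum_le N r01.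
  set x := \sum_(i < N) _ in h1 *; set y := \sum_(i < N) _ in h2 *.
  have b0 : 0 <= (1 - r)^-1 by rewrite invr_ge0 subr_ge0 ltW.
  have x1 : x <= (2 * m.+1%:R) ^+ 2.
    by apply: (le_trans h1); rewrite lerXn2r ?nnegrE// mulr_ge0 ?ler0n.
  have cs0 : 0 <= C * s ^+ 3 + s ^+ 2 * (e / 16).
    apply: addr_ge0; apply: mulr_ge0 => //; by [exact: exprn_ge0 (ltW s0)|exact: ltW].
  apply: (@le_trans _ _ ((2 * m.+1%:R) ^+ 2 * (C * s ^+ 3 + s ^+ 2 * (e / 16)) + C * s * (2 * m.+1%:R))).
    apply: lerD; first by rewrite ler_wpM2r.
    by rewrite ler_wpM2l ?mulr_ge0 ?(ltW s0)// (le_trans h2).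
  have -> : (2 * m.+1%:R) ^+ 2 * (C * s ^+ 3 + s ^+ 2 * (e / 16)) + C * s * (2 * m.+1%:R)
     = (6 * C * s + e / 4) * m.+1%:R.
    by rewrite (exprS s 2) s2; field; rewrite gt_eqF.
  rewrite ler_pM2r//.
  have sC : s <= e / (4 * (6 * C + 1)).
    by move: hs; rewrite sub0r normrN gtr0_norm.
  have : 6 * C * s <= e / 4; last by lra.
  apply: (@le_trans _ _ (6 * C * (e / (4 * (6 * C + 1))))); first by rewrite ler_wpM2l// mulr_ge0.
  by rewrite mulrA ler_pdivrMr ?mulr_gt0 ?ltr_wpDl ?mulr_ge0//; have := ltW e0; lra.
move: hm near_geom; rewrite -/k -/N; set x := _ * cos th; set y := cos th / k; set z := _ / _ => hm hn.
by rewrite (le_trans (ler_distD x _ _))// (splitr e) lerD.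
Unshelve. all: by end_near. Qed.

End abel.

Arguments discount {R}.
Arguments frequency {R}.

Section discounted_words.
Context {R : realType} {E : Type}.
Variable f : E -> R.
Implicit Types (l : seq E) (r s th : R).

Definition word_sum l := \sum_(x <- l) f x.

(* [sum_(n < size l) r^n cos (th + s (f l_0 + ... + f l_(n-1)))] *)
Fixpoint discounted_cos r s l th : R :=
  if l is x :: l' then cos th + r * discounted_cos r s l' (th + s * f x) else 0.

Lemma discounted_cos_cat r s l l' th : discounted_cos r s (l ++ l') th =
  discounted_cos r s l th + r ^+ size l * discounted_cos r s l' (th + s * word_sum l).
Proof.
rewrite /word_sum; elim: l th => [|x l IH] th /=; first by rewrite big_nil mulr0 addr0 add0r mul1r.
by rewrite IH big_cons mulrDr addrA mulrA -exprS mulrDr addrA.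
Qed.

(** The phase [pi / 2] plays the imaginary part: this is multiplication by [exp (i y)] in real
    form. *)
Lemma discounted_cosD r s l th y : discounted_cos r s l (th + y) =
  cos y * discounted_cos r s l th + sin y * discounted_cos r s l (th + pi / 2).
Proof.
elim: l th => [|x l IH] th /=; first by rewrite !mulr0 addr0.
rewrite (addrAC th y) (addrAC th (pi / 2)) IH cosDpihalf cosD; ring.
Qed.

Lemma discounted_cosDpi r s l th : discounted_cos r s l (th + pi / 2 + pi / 2) = - discounted_cos r s l th.
Proof.
elim: l th => [|x l IH] th /=; first by rewrite oppr0.
have -> : th + pi / 2 + pi / 2 + s * f x = th + s * f x + pi / 2 + pi / 2 by ring.
by rewrite IH !cosDpihalf sinDpihalf; ring.
Qed.

Lemma discounted_cos_le_size r s l th : 0 <= r <= 1 -> `|discounted_cos r s l th| <= (size l)%:R.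
Proof.
move=> /andP[r0 r1]; elim: l th => [|x l IH] th /=; first by rewrite normr0.
rewrite (le_trans (ler_normD _ _))// -natr1 addrC lerD ?cos_max//.
by rewrite normrM (ger0_norm r0) -[leRHS]mul1r ler_pM.
Qed.

Lemma discounted_cos_le r s l th : 0 <= r < 1 -> `|discounted_cos r s l th| <= (1 - r)^-1.
Proof.
move=> /andP[r0 r1]; elim: l th => [|x l IH] th /=.
  by rewrite normr0 invr_ge0 subr_ge0 ltW.
rewrite (le_trans (ler_normD _ _))//.
apply: (@le_trans _ _ (1 + r * (1 - r)^-1)).
  by rewrite lerD ?cos_max// normrM (ger0_norm r0) ler_wpM2l.
by rewrite le_eqVlt; apply/orP; left; apply/eqP; field; lra.
Qed.

Lemma discounted_cos_take r s l th (N : nat) : 0 <= r < 1 -> (N <= size l)%N ->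
  `|discounted_cos r s l th - discounted_cos r s (take N l) th| <= r ^+ N * (1 - r)^-1.
Proof.
move=> r01 Nl; have /andP[r0 r1] := r01.
rewrite -{1}(cat_take_drop N l) discounted_cos_cat addrAC subrr add0r size_takel//.
by rewrite normrM ger0_norm ?exprn_ge0// ler_wpM2l ?exprn_ge0// discounted_cos_le.
Qed.

Lemma discounted_cos_path r s (x : nat -> E) N th :
  discounted_cos r s [seq x i | i <- iota 0 N] th =
  \sum_(n < N) r ^+ n * cos (s * (\sum_(i < n) f (x i)) + th).
Proof.
elim: N x th => [|N IH] x th; first by rewrite big_ord0.
rewrite big_ord_recl/= big_ord0 mulr0 add0r mul1r; congr (_ + _).
rewrite (iotaDl 1 0 N) -map_comp IH mulr_sumr; apply: eq_bigr => n _.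
rewrite exprS mulrA; congr (_ * cos _).
have -> : \sum_(i < bump 0 n) f (x i) = f (x 0%N) + \sum_(i < n) f (x (1 + i)%N).
  by rewrite big_ord_recl.
ring.
Qed.

End discounted_words.

(** * Regeneration blocks *)

Section independent_blocks.
Context d (W : measurableType d) (R : realType) (Q : probability W R).
Variables (V : Type) (Y : int -> W -> V).
Hypothesis mY : forall i (A : set V), measurable (Y i @^-1` A).
Hypothesis indY : discrete_independent Q Y.

Lemma measurable_discrete i (F : V -> R) : measurable_fun setT (fun w => F (Y i w)).
Proof. by move=> _ B _; rewrite setTI; exact: (mY i (F @^-1` B)). Qed.

Lemma bounded_measurable_discrete i (F : V -> R) M : (forall v, `|F v| <= M) ->
  bounded_measurable (fun w => F (Y i w)).
Proof. by move=> FM; split; [exact: measurable_discrete|exists M]. Qed.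

Lemma Rintegral_indic_preimage i (A : set V) :
  \int[Q]_w \1_A (Y i w) = fine (Q (Y i @^-1` A)).
Proof.
by rewrite -(Rintegral_indic Q (mY i A))/=; congr Rintegral; apply/funext => w.
Qed.

(** The passage from events to bounded functions in a single factor, by simple approximation of [F];
    iterating it gives product formulas. *)
Lemma Rintegral_mul_discrete i (F : V -> R) M (Z : W -> R) (z : R) :
  (forall v, `|F v| <= M) -> bounded_measurable Z ->
  (forall A : set V, \int[Q]_w (\1_A (Y i w) * Z w) = \int[Q]_w \1_A (Y i w) * z) ->
  \int[Q]_w (F (Y i w) * Z w) = \int[Q]_w F (Y i w) * z.
Proof.
move=> FM bZ indZ; have [_ [K ZK]] := bZ.
have K0 : 0 <= K := le_trans (normr_ge0 _) (ZK point).
have bF := bounded_measurable_discrete i FM.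
have i1 (A : set V) v : `|\1_A v : R| <= 1.
  by rewrite indicE; case: (_ \in _); rewrite ?normr1 ?normr0.
have bI (A : set V) := bounded_measurable_discrete i (i1 A).
apply: eq_of_dist_le => e e0; pose e' := e / (K + `|z| + 1).
have kz : 0 < K + `|z| + 1 by rewrite ltr_wpDl// addr_ge0.
have e'0 : 0 < e' by rewrite divr_gt0.
have [s Fs] := simple_approximation e'0 FM.
pose A (cA : R * interval R) : set V := F @^-1` [set` cA.2].
pose S (v : V) := \sum_(cA <- s) cA.1 * \1_(A cA) v.
have bS : bounded_measurable (fun w => S (Y i w)).
  by apply: bounded_measurable_sum => cA; exact: bounded_measurableZ.
have SE : \int[Q]_w (S (Y i w) * Z w) = \int[Q]_w S (Y i w) * z.
  rewrite /S; elim: s {Fs S bS} => [|cA s IH].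
    under eq_Rintegral do rewrite big_nil mul0r.
    by under [in RHS]eq_Rintegral do rewrite big_nil; rewrite Rintegral_prob_cst mul0r.
  have bs : bounded_measurable (fun w => \sum_(j <- s) j.1 * \1_(A j) (Y i w)).
    by apply: bounded_measurable_sum => cB; exact: bounded_measurableZ.
  under eq_Rintegral do rewrite big_cons mulrDl -mulrA -[X in _ + X]mul1r.
  rewrite Rintegral_linear; [|exact: bounded_measurableM|exact: bounded_measurableM].
  rewrite IH indZ mul1r; under [in RHS]eq_Rintegral do rewrite big_cons -[X in _ + X]mul1r.
  by rewrite Rintegral_linear//; ring.
have h1 : `|\int[Q]_w (F (Y i w) * Z w) - \int[Q]_w (S (Y i w) * Z w)| <= e' * K.
  apply: Rintegral_dist_cst; [exact: bounded_measurableM|exact: bounded_measurableM|].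
  by move=> w; rewrite -mulrBl normrM ler_pM//; exact: Fs.
have h2 : `|\int[Q]_w F (Y i w) * z - \int[Q]_w S (Y i w) * z| <= e' * `|z|.
  rewrite -mulrBl normrM ler_wpM2r//; apply: Rintegral_dist_cst => // w; exact: Fs.
move: h1 h2; rewrite SE; set x := _ * z; set y := \int[_]_w _; set u := _ * z => h1 h2.
have -> : y - u = (y - x) - (u - x) by ring.
rewrite (le_trans (ler_normB _ _))// (le_trans (lerD h1 h2))//.
rewrite -mulrDr /e' mulrAC ler_pdivrMr// ler_wpM2l ?(ltW e0)//; lra.
Qed.

Lemma bounded_measurable_prod (s : seq int) (F : int -> V -> R) M :
  (forall k v, `|F k v| <= M) -> bounded_measurable (fun w => \prod_(k <- s) F k (Y k w)).
Proof.
move=> FM; elim: s => [|k s IH].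
  rewrite (_ : (fun w => _) = cst 1); first exact: bounded_measurable_cst.
  by apply/funext => w; rewrite big_nil.
rewrite (_ : (fun w => _) = (fun w => F k (Y k w) * \prod_(j <- s) F j (Y j w))).
  by apply: bounded_measurableM => //; exact: bounded_measurable_discrete.
by apply/funext => w; rewrite big_cons.
Qed.

(** Indicators give way to functions one index at a time. The indices in [s2] still carry
    indicators, and for empty [s1] the claim is independence itself. *)
Lemma Rintegral_prod_independent_aux (s1 s2 : seq int) (F : int -> V -> R) (A : int -> set V) M :
  uniq (s1 ++ s2) -> (forall k v, `|F k v| <= M) ->
  \int[Q]_w (\prod_(k <- s1) F k (Y k w) * \prod_(k <- s2) \1_(A k) (Y k w)) =
  \prod_(k <- s1) \int[Q]_w F k (Y k w) * \prod_(k <- s2) \int[Q]_w \1_(A k) (Y k w).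
Proof.
have i1 (B : int -> set V) k v : `|\1_(B k) v : R| <= 1.
  by rewrite indicE; case: (_ \in _); rewrite ?normr1 ?normr0.
have EI (B : set V) k : ((\int[Q]_w \1_B (Y k w))%:E = Q (Y k @^-1` B))%E.
  by rewrite Rintegral_indic_preimage fineK// fin_num_measure.
move=> + FM; elim: s1 s2 A => [|i s1 IH] s2 A us.
  rewrite big_nil mul1r; apply: EFin_inj.
  under eq_Rintegral do rewrite big_nil mul1r.
  rewrite -prodEFin; under [RHS]eq_bigr do rewrite EI.
  rewrite -(indY A us) -Rintegral_indic; last first.
    apply: fin_bigcap_measurable => // k _; exact: mY.
  congr EFin; apply: eq_Rintegral => w _; rewrite indicE.
  elim: s2 {us} => [|k s2 IHs].
    by rewrite big_nil mem_set//= => i.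
  rewrite big_cons IHs indicE -natrM mulnb; congr (_%:R); congr nat_of_bool.
  apply/idP/idP.
    move=> /andP[]; rewrite !inE => kA H; move=> j /=; rewrite in_cons => /orP[/eqP ->//|js].
    exact: H.
  rewrite inE => H; apply/andP; split; rewrite inE.
    by apply: H; rewrite /= in_cons eqxx.
  by move=> j /= js; apply: H; rewrite /= in_cons js orbT.
rewrite big_cons; under eq_Rintegral do rewrite big_cons -mulrA.
rewrite -mulrA.
apply: (@Rintegral_mul_discrete i (F i) M) => //.
  by apply: bounded_measurableM; [exact: bounded_measurable_prod FM|exact: (@bounded_measurable_prod _ (fun k => \1_(A k)) 1)].
(* By the previous reduction the factor at [i] is now an indicator, so [i] joins [s2] and the
   induction hypothesis applies. *)
move=> B; pose A' k := if k == i then B else A k.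
have us' : uniq (s1 ++ i :: s2).
  by rewrite -(perm_uniq (permEl (perm_catCA [:: i] s1 s2))).
have is2 : i \notin s2.
  by move: us' => /=; rewrite cat_uniq => /and3P[_ _ /andP[]].
have A'E w : \prod_(k <- s2) \1_(A' k) (Y k w) = \prod_(k <- s2) \1_(A k) (Y k w) :> R.
  apply: eq_big_seq => k ks; rewrite /A'; case: eqP => // ki.
  by move: is2; rewrite -ki ks.
have := IH (i :: s2) A' us'.
under eq_Rintegral do rewrite big_cons A'E {1}/A' eqxx mulrCA.
move=> ->; rewrite mulrCA big_cons {1}/A' eqxx.
congr (_ * (_ * _)); apply: eq_big_seq => k ks; rewrite /A'; case: eqP => // ki.
by move: is2; rewrite -ki ks.
Qed.

Lemma Rintegral_prod_independent (s : seq int) (F : int -> V -> R) M :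
  uniq s -> (forall k v, `|F k v| <= M) ->
  \int[Q]_w (\prod_(k <- s) F k (Y k w)) = \prod_(k <- s) \int[Q]_w F k (Y k w).
Proof.
move=> us FM; have := @Rintegral_prod_independent_aux s [::] F (fun=> set0) M.
rewrite cats0 big_nil mulr1 => /(_ us FM) <-.
by apply: eq_Rintegral => w _; rewrite big_nil mulr1.
Qed.

Hypothesis idY : forall (i j : int) (A : set V), i != 0 -> j != 0 ->
  Q (Y i @^-1` A) = Q (Y j @^-1` A).

Lemma Rintegral_identically_distributed i j (F : V -> R) M : i != 0 -> j != 0 ->
  (forall v, `|F v| <= M) -> \int[Q]_w F (Y i w) = \int[Q]_w F (Y j w).
Proof.
move=> i0 j0 FM; apply: eq_of_dist_le => e e0.
have e20 : 0 < e / 2 by rewrite divr_gt0.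
have [s Fs] := simple_approximation e20 FM.
pose A (cA : R * interval R) : set V := F @^-1` [set` cA.2].
pose S (v : V) := \sum_(cA <- s) cA.1 * \1_(A cA) v.
have i1 (B : set V) v : `|\1_B v : R| <= 1.
  by rewrite indicE; case: (_ \in _); rewrite ?normr1 ?normr0.
have bS k : bounded_measurable (fun w => S (Y k w)).
  by apply: bounded_measurable_sum => cA; apply: bounded_measurableZ; exact: bounded_measurable_discrete (i1 _).
have SE k : \int[Q]_w S (Y k w) = \sum_(cA <- s) cA.1 * fine (Q (Y k @^-1` A cA)).
  rewrite /S; elim: s {Fs S bS} => [|cA s IH].
    by under eq_Rintegral do rewrite big_nil; rewrite big_nil Rintegral_prob_cst.
  under eq_Rintegral do rewrite big_cons -[X in _ + X]mul1r.
  rewrite Rintegral_linear; last 2 first.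
    exact: bounded_measurable_discrete (i1 _).
    by apply: bounded_measurable_sum => cB; apply: bounded_measurableZ; exact: bounded_measurable_discrete (i1 _).
  rewrite IH mul1r big_cons; congr (_ * _ + _).
  exact: Rintegral_indic_preimage.
have SS : \int[Q]_w S (Y i w) = \int[Q]_w S (Y j w).
  by rewrite !SE; apply: eq_bigr => cA _; rewrite (idY _ i0 j0).
have h k : `|\int[Q]_w F (Y k w) - \int[Q]_w S (Y k w)| <= e / 2.
  by apply: Rintegral_dist_cst; [exact: bounded_measurable_discrete FM|exact: bS|move=> w; exact: Fs].
have := h i; have := h j; rewrite SS.
set x := \int[_]_w _; set y := \int[_]_w S _; set z := \int[_]_w _ => h1 h2.
by rewrite (le_trans (ler_distD y _ _))// (splitr e) lerD// distrC.
Qed.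

End independent_blocks.

Section integral_limits.
Context d (W : measurableType d) (R : realType) (Q : probability W R).

Lemma Rintegral_dominated_cvg (h : nat -> W -> R) (h' k : W -> R) :
  (forall n, measurable_fun setT (h n)) -> Q.-integrable setT (EFin \o k) ->
  (forall n w, `|h n w| <= k w) -> (forall w, h n w @[n --> \oo] --> h' w) ->
  \int[Q]_w h n w @[n --> \oo] --> \int[Q]_w h' w.
Proof.
move=> mh ik hk hh'.
have mh' : measurable_fun setT h' by apply: measurable_fun_cvg mh _ => w _; exact: hh'.
have h'k w : `|h' w| <= k w.
  have : `|h n w| @[n --> \oo] --> `|h' w| by apply: cvg_norm; exact: hh'.
  move=> cn; rewrite -(cvg_lim _ cn)//; apply: limr_le; first by apply/cvg_ex; exists `|h' w|.
  by apply: nearW => n; exact: hk.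
have ih' : Q.-integrable setT (EFin \o h').
  apply: le_integrable ik => //; first exact/measurable_EFinP.
  by move=> w _ /=; rewrite lee_fin (le_trans (h'k w))// ler_norm.
have := @dominated_cvg _ _ _ Q setT measurableT (fun n => EFin \o h n) (EFin \o h') (EFin \o k).
move=> DC; have {DC} : (fun n => \int[Q]_w (h n w)%:E)%E @ \oo --> (\int[Q]_w (h' w)%:E)%E.
  apply: DC => //.
  - by move=> n; apply/measurable_EFinP.
  - by move=> w _; apply: cvg_EFin; [exact: nearW|exact: hh'].
  - by move=> n w _; rewrite /= lee_fin.
rewrite -(fineK (integrable_fin_num measurableT ih')) => /fine_cvgP[_]; exact.
Qed.

Lemma fatou_bounded_measurable (h : nat -> W -> R) (h' : W -> R) (L : R) :
  (forall n, bounded_measurable (h n)) -> (forall n w, 0 <= h n w) ->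
  (forall w, h n w @[n --> \oo] --> h' w) -> \int[Q]_w h n w @[n --> \oo] --> L ->
  (\int[Q]_w (h' w)%:E <= L%:E)%E.
Proof.
move=> bh h0 hh' hL.
have := @fatou _ _ _ Q setT measurableT (fun n w => (h n w)%:E).
have -> : (fun n => \int[Q]_w (h n w)%:E)%E = (fun n => (\int[Q]_w h n w)%:E).
  by apply/funext => n; rewrite RintegralE.
have e1 : limn_einf (fun n => (\int[Q]_w h n w)%:E) = L%:E.
  by apply: (cvg_limn_einf_sup _).1; apply: cvg_EFin => //; exact: nearW.
rewrite e1; under eq_integral => w _.
  rewrite (_ : limn_einf (fun n => (h n w)%:E) = (h' w)%:E); last first.
    by apply: (cvg_limn_einf_sup _).1; apply: cvg_EFin; [exact: nearW|exact: hh'].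
  over.
apply; first by move=> n; apply/measurable_EFinP; case: (bh n).
by move=> n w _; rewrite lee_fin.
Qed.

Lemma bounded_measurable_max (h k : W -> R) : bounded_measurable h -> bounded_measurable k ->
  bounded_measurable (fun w => Num.max (h w) (k w)).
Proof.
move=> [mh [M hM]] [mk [K kK]]; split; first exact: measurable_maxr.
exists (`|M| + `|K|) => w; rewrite maxEle; case: ifP => _.
  by rewrite (le_trans (kK w))// (le_trans (ler_norm _))// lerDr.
by rewrite (le_trans (hM w))// (le_trans (ler_norm _))// lerDl.
Qed.

Lemma Rintegral_ae_eq (h k : W -> R) : bounded_measurable h -> bounded_measurable k ->
  {ae Q, forall w, h w = k w} -> \int[Q]_w h w = \int[Q]_w k w.
Proof.
move=> bh bk hk; rewrite /Rintegral; congr fine; apply: ae_eq_integral => //.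
- by apply/measurable_EFinP; case: bh.
- by apply/measurable_EFinP; case: bk.
- by apply: filterS hk => w + _ => ->.
Qed.

Lemma Rintegral_dist_ae (h k b : W -> R) : bounded_measurable h -> bounded_measurable k ->
  bounded_measurable b -> {ae Q, forall w, `|h w - k w| <= b w} ->
  `|\int[Q]_w h w - \int[Q]_w k w| <= \int[Q]_w b w.
Proof.
move=> bh bk bb hkb.
(* Taking the maximum makes the inequality hold everywhere without changing the integral of [b]. *)
have bm : bounded_measurable (fun w => Num.max (b w) `|h w - k w|).
  by apply: bounded_measurable_max => //; apply: bounded_measurable_norm; exact: bounded_measurableB.
have -> : \int[Q]_w b w = \int[Q]_w Num.max (b w) `|h w - k w|.
  apply: Rintegral_ae_eq => //; apply: filterS hkb => w H.
  by rewrite (max_idPl H).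
by apply: Rintegral_dist => // w; rewrite le_max lexx orbT.
Qed.

Lemma measurable_countable_fibers (V : countType) (Z : W -> V) :
  (forall v, measurable [set w | Z w = v]) -> forall A : set V, measurable (Z @^-1` A).
Proof.
move=> mZ A; have -> : Z @^-1` A = \bigcup_v (if `[< A v >] then [set w | Z w = v] else set0).
  apply/seteqP; split=> w /=.
    by move=> Aw; exists (Z w) => //; rewrite asboolT.
  by move=> [v _]; case: asboolP => //= Av ->.
apply: countable_bigcupT_measurable => // v; case: ifP => // _.
Qed.

End integral_limits.

Section regeneration_blocks.
Context {R : realType} {E : pointedFinType}.
Variables (g : E -> past E -> R) (P : probability (config int E) R).
Context {d} {W : measurableType d} (Q : probability W R) (X : {RV Q >-> config int E}).
Variable T : int -> W -> int.
Hypothesis HR : is_regeneration g P X T.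

Let mT i n : measurable [set w | T i w = n]. Proof. by case: HR. Qed.

Let good w := [/\ forall i, T i w < T (i + 1) w, T 0 w <= 0 & 0 < T 1 w].

Let aegood : {ae Q, forall w, good w}. Proof. by case: HR. Qed.

Definition path_from (a : int) (n : nat) (v : config int E) : seq E :=
  [seq v (a + j%:Z) | j <- iota 0 n].

Lemma path_fromD a n p v :
  path_from a (n + p) v = path_from a n v ++ path_from (a + n%:Z) p v.
Proof.
rewrite /path_from iotaD map_cat add0n; congr (_ ++ _).
rewrite -[X in iota X p]addn0 iotaDl -map_comp; apply: eq_map => j /=; congr v; lia.
Qed.

Lemma measurable_path_from a n (A : set (seq E)) :
  measurable [set v : config int E | A (path_from a n v)].
Proof.
elim: n a A => [|n IH] a A.
  have [h|h] := pselect (A [::]).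
    by rewrite [X in measurable X](_ : _ = setT)//; apply/seteqP; split.
  by rewrite [X in measurable X](_ : _ = set0)//; apply/seteqP; split.
have -> : [set v : config int E | A (path_from a n.+1 v)] =
    \bigcup_(x : E) ([set v : config int E | v a = x] `&`
       [set v | [set l | A (x :: l)] (path_from (a + 1) n v)]).
  have pE v : path_from a n.+1 v = v a :: path_from (a + 1) n v.
    by rewrite -[n.+1]add1n path_fromD /=; congr (v _ :: _); lia.
  apply/seteqP; split=> v /=.
    by rewrite pE => Av; exists (v a).
  by rewrite pE => -[x _ [/= -> ]].
apply: countable_bigcupT_measurable => // x; apply: measurableI; last exact: IH.
exact: (measurable_coordinate a [set y | y = x]).
Qed.

Lemma measurable_block i (A : set (seq E)) : measurable (block X T i @^-1` A).
Proof.
have -> : block X T i @^-1` A = \bigcup_(t : int * int)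
   (([set w | T i w = t.1] `&` [set w | T (i + 1) w = t.2]) `&`
     (X @^-1` [set v | A (path_from t.1 `|t.2 - t.1|%N v)])).
  apply/seteqP; split=> w /=.
    by move=> Aw; exists (T i w, T (i + 1) w).
  by move=> [[a b] _ [[/= <- <-]]].
apply: countable_bigcupT_measurable => // t; apply: measurableI; first exact: measurableI.
rewrite -[X in measurable X]setTI; apply: measurable_funP => //; exact: measurable_path_from.
Qed.

(** Blocks are almost surely nonempty, so [N] of them cover at least [N] sites; a finite
    concatenation thus determines the discounted sum up to a multiple of [r^N]. *)
Fixpoint blocks (N : nat) (i : int) (w : W) : seq E :=
  if N is N'.+1 then block X T i w ++ blocks N' (i + 1) w else [::].

Lemma T_increasing w N i : good w -> N%:Z <= T (i + N%:Z) w - T i w.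
Proof.
move=> [Tlt _ _]; elim: N => [|N IH]; first by rewrite addr0 subrr.
have := Tlt (i + N%:Z); have -> : i + N%:Z + 1 = i + N.+1%:Z by lia.
lia.
Qed.

Lemma blocks_path w N i : good w ->
  blocks N i w = path_from (T i w) `|T (i + N%:Z) w - T i w|%N (X w).
Proof.
move=> gw; elim: N i => [|N IH] i; first by rewrite addr0 subrr.
rewrite /= IH /block -/(path_from (T i w) _ (X w)).
have h1 : T i w < T (i + 1) w by case: gw.
have h2 := T_increasing N (i + 1) gw.
have e : i + N.+1%:Z = i + 1 + N%:Z by lia.
rewrite e (_ : `|T (i + 1 + N%:Z) w - T i w|%N =
  (`|gap T i w| + `|T (i + 1 + N%:Z) w - T (i + 1) w|)%N); last by rewrite /gap; lia.
by rewrite path_fromD (_ : T i w + `|gap T i w|%N%:Z = T (i + 1) w)//; rewrite /gap; lia.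
Qed.

Lemma take_blocks w N i : good w -> take N (blocks N i w) = path_from (T i w) N (X w).
Proof.
move=> gw; rewrite blocks_path//; have h := T_increasing N i gw.
rewrite (_ : `|T (i + N%:Z) w - T i w|%N = (N + (`|T (i + N%:Z) w - T i w| - N))%N); last by lia.
by rewrite path_fromD take_size_cat// size_map size_iota.
Qed.

Lemma size_blocks w N i : good w -> (N <= size (blocks N i w))%N.
Proof.
move=> gw; rewrite blocks_path// size_map size_iota.
by have := T_increasing N i gw; lia.
Qed.

Lemma take_blocksS w N i : good w -> take N (blocks N.+1 i w) = path_from (T i w) N (X w).
Proof.
move=> gw; rewrite -(take_takel _ (leqnSn N)) take_blocks// -addn1 path_fromD.
by rewrite take_size_cat// size_map size_iota.
Qed.

Let mB := measurable_block.
Let indB : discrete_independent Q (block X T). Proof. by case: HR => _ _ _ _ []. Qed.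
Let idB (i j : int) (A : set (seq E)) : i != 0 -> j != 0 ->
  Q (block X T i @^-1` A) = Q (block X T j @^-1` A).
Proof. by case: HR => _ _ _ _ [_]; apply. Qed.

Variable f : E -> R.
Variables r s : R.
Hypothesis r01 : 0 <= r < 1.

Let z := discounted_cos f r s.
(** [fc] and [fs] are the real and imaginary parts of [r^tau exp (i s Y)] for a block of length
    [tau] and sum [Y]. *)
Let fc (l : seq E) : R := r ^+ size l * cos (s * word_sum f l).
Let fs (l : seq E) : R := r ^+ size l * sin (s * word_sum f l).

Let r0 : 0 <= r. Proof. by case/andP: r01. Qed.
Let r_le1 n : r ^+ n <= 1. Proof. by rewrite exprn_ile1//; case/andP: r01 => _ /ltW. Qed.

Let fc_le1 l : `|fc l| <= 1.
Proof. by rewrite normrM -[leRHS]mulr1 ler_pM// ?cos_max// ger0_norm ?exprn_ge0. Qed.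
Let fs_le1 l : `|fs l| <= 1.
Proof. by rewrite normrM -[leRHS]mulr1 ler_pM// ?sin_max// ger0_norm ?exprn_ge0. Qed.
Let z_le th l : `|z l th| <= (1 - r)^-1. Proof. exact: discounted_cos_le. Qed.

Let z_blocksS N i w th : z (blocks N.+1 i w) th =
  z (block X T i w) th + (fc (block X T i w) * z (blocks N (i + 1) w) th +
     fs (block X T i w) * z (blocks N (i + 1) w) (th + pi / 2)).
Proof. by rewrite /= /z discounted_cos_cat discounted_cosD /fc /fs; ring. Qed.

Lemma bounded_measurable_blocks N i th : bounded_measurable (fun w => z (blocks N i w) th).
Proof.
split; last by exists (1 - r)^-1 => w; exact: z_le.
elim: N i th => [|N IH] i th; first exact: measurable_cst.
rewrite (_ : (fun w => _) = (fun w => z (block X T i w) th + (fc (block X T i w) * z (blocks N (i + 1) w) th +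
     fs (block X T i w) * z (blocks N (i + 1) w) (th + pi / 2)))).
  apply: measurable_funD; first exact: (measurable_discrete mB i (fun l => z l th)).
  apply: measurable_funD; apply: measurable_funM => //.
    exact: (measurable_discrete mB i fc).
  exact: (measurable_discrete mB i fs).
by apply/funext => w; exact: z_blocksS.
Qed.

Let e N i th := \int[Q]_w z (blocks N i w) th.

Let ext (F : int -> seq E -> R) (i : int) (H : seq E -> R) (k : int) := if k == i then H else F k.

Let prod_ext (F : int -> seq E -> R) i H (s0 : seq int) w : i \notin s0 ->
  \prod_(k <- i :: s0) ext F i H k (block X T k w) =
  \prod_(k <- s0) F k (block X T k w) * H (block X T i w).
Proof.
move=> is0; rewrite big_cons {1}/ext eqxx mulrC; congr (_ * _).
apply: eq_big_seq => k ks; rewrite /ext; case: eqP => // ki.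
by move: is0; rewrite -ki ks.
Qed.

Let prod_ext_int (F : int -> seq E -> R) i H (s0 : seq int) : i \notin s0 ->
  \prod_(k <- i :: s0) \int[Q]_w ext F i H k (block X T k w) =
  \prod_(k <- s0) \int[Q]_w F k (block X T k w) * \int[Q]_w H (block X T i w).
Proof.
move=> is0; rewrite big_cons {1}/ext eqxx mulrC; congr (_ * _).
apply: eq_big_seq => k ks; rewrite /ext; case: eqP => // ki.
by move: is0; rewrite -ki ks.
Qed.

(** A function of several concatenated blocks is not a function of one of them, so independence is
    carried through the recursion by an arbitrary product over earlier blocks; each step adds the
    current block to that product. *)
Lemma Rintegral_prod_blocks N i (s0 : seq int) (F : int -> seq E -> R) M th :
  uniq s0 -> (forall k, k \in s0 -> k < i) -> (forall k l, `|F k l| <= M) ->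
  \int[Q]_w (\prod_(k <- s0) F k (block X T k w) * z (blocks N i w) th) =
  \prod_(k <- s0) \int[Q]_w F k (block X T k w) * e N i th.
Proof.
elim: N i s0 F M th => [|N IH] i s0 F M th us si FM.
  rewrite /e; under eq_Rintegral do rewrite mulr0.
  by rewrite !Rintegral_prob_cst mulr0.
have step (s1 : seq int) (F1 : int -> seq E -> R) M1 : uniq s1 -> (forall k, k \in s1 -> k < i) ->
    (forall k l, `|F1 k l| <= M1) ->
    \int[Q]_w (\prod_(k <- s1) F1 k (block X T k w) * z (blocks N.+1 i w) th) =
    \prod_(k <- s1) \int[Q]_w F1 k (block X T k w) *
     (\int[Q]_w z (block X T i w) th + (\int[Q]_w fc (block X T i w) * e N (i + 1) th +
        \int[Q]_w fs (block X T i w) * e N (i + 1) (th + pi / 2))).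
  move=> us1 si1 FM1.
  have is1 : i \notin s1 by apply/negP => /si1; rewrite ltxx.
  have usi : uniq (i :: s1) by rewrite /= is1.
  have sii k : k \in i :: s1 -> k < i + 1.
    by rewrite in_cons => /orP[/eqP ->|/si1]; lia.
  have M10 : 0 <= M1 := le_trans (normr_ge0 _) (FM1 0 [::]).
  have b0 : 0 <= (1 - r)^-1 by rewrite invr_ge0; case/andP: r01; lra.
  have bext (H : seq E -> R) K : 0 <= K -> (forall l, `|H l| <= K) ->
      forall k l, `|ext F1 i H k l| <= M1 + K.
    move=> K0 HK k l; rewrite /ext; case: ifP => _.
      by rewrite (le_trans (HK l))// lerDr.
    by rewrite (le_trans (FM1 k l))// lerDl.
  have bz := bext _ _ b0 (z_le th).
  have bc := bext _ _ ler01 fc_le1; have bs := bext _ _ ler01 fs_le1.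
  have Bz := bounded_measurable_blocks N (i + 1).
  have Bp F' M' := @bounded_measurable_prod _ _ R _ _ mB (i :: s1) F' M'.
  have -> : \int[Q]_w (\prod_(k <- s1) F1 k (block X T k w) * z (blocks N.+1 i w) th) =
    \int[Q]_w (1 * (\prod_(k <- i :: s1) ext F1 i (z ^~ th) k (block X T k w)) +
      1 * (1 * (\prod_(k <- i :: s1) ext F1 i fc k (block X T k w) * z (blocks N (i + 1) w) th) +
           1 * (\prod_(k <- i :: s1) ext F1 i fs k (block X T k w) * z (blocks N (i + 1) w) (th + pi / 2)))).
    apply: eq_Rintegral => w _; rewrite z_blocksS !prod_ext//; ring.
  have B2 := bounded_measurableM (Bp _ _ bc) (Bz th).
  have B3 := bounded_measurableM (Bp _ _ bs) (Bz (th + pi / 2)).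
  rewrite Rintegral_linear; [|exact: Bp bz|].
    rewrite Rintegral_linear//.
    rewrite (Rintegral_prod_independent mB indB usi bz).
    rewrite (IH (i + 1) (i :: s1) _ _ th usi sii bc) (IH (i + 1) (i :: s1) _ _ (th + pi / 2) usi sii bs).
    rewrite !prod_ext_int//; ring.
  by apply: bounded_measurableD; exact: bounded_measurableZ.
rewrite (step s0 F M us si FM); congr (_ * _).
(* With no earlier blocks the same identity shows that the bracket is [e N.+1 i th]. *)
have := step [::] F M isT (fun k H => match notF H with end) FM.
rewrite big_nil mul1r => <-; rewrite /e; apply: eq_Rintegral => w _.
by rewrite big_nil mul1r.
Qed.

(** The renewal equation: the first block is independent of the following ones, and its
    characteristic function rotates their phase. *)
Lemma Rintegral_blocksS N i th : e N.+1 i th = \int[Q]_w z (block X T i w) th +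
  (\int[Q]_w fc (block X T i w) * e N (i + 1) th +
   \int[Q]_w fs (block X T i w) * e N (i + 1) (th + pi / 2)).
Proof.
have Bz := bounded_measurable_blocks N (i + 1).
have Bc : bounded_measurable (fun w => fc (block X T i w)) by exact: bounded_measurable_discrete fc_le1.
have Bs : bounded_measurable (fun w => fs (block X T i w)) by exact: bounded_measurable_discrete fs_le1.
have Bb : bounded_measurable (fun w => z (block X T i w) th) by exact: bounded_measurable_discrete (z_le th).
have -> : e N.+1 i th = \int[Q]_w (1 * z (block X T i w) th + 1 * (
    1 * (fc (block X T i w) * z (blocks N (i + 1) w) th) +
    1 * (fs (block X T i w) * z (blocks N (i + 1) w) (th + pi / 2)))).
  by apply: eq_Rintegral => w _; rewrite z_blocksS; ring.
have B2 := bounded_measurableM Bc (Bz th).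
have B3 := bounded_measurableM Bs (Bz (th + pi / 2)).
rewrite Rintegral_linear//; last by apply: bounded_measurableD; exact: bounded_measurableZ.
rewrite Rintegral_linear// !mul1r; congr (_ + (_ + _)).
  have := @Rintegral_prod_blocks N (i + 1) [:: i] (fun=> fc) 1 th isT.
  rewrite big_seq1 => <-//; first by apply: eq_Rintegral => w _; rewrite big_seq1.
  by move=> k; rewrite inE => /eqP ->; lia.
have := @Rintegral_prod_blocks N (i + 1) [:: i] (fun=> fs) 1 (th + pi / 2) isT.
rewrite big_seq1 => <-//; first by apply: eq_Rintegral => w _; rewrite big_seq1.
by move=> k; rewrite inE => /eqP ->; lia.
Qed.

(** Positive indices stay positive along the recursion and so avoid block 0, whose law may
    differ. *)
Lemma Rintegral_blocks_shift N i j th : 0 < i -> 0 < j -> e N i th = e N j th.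
Proof.
elim: N i j th => [|N IH] i j th i0 j0 //.
have [i1 j1] : i != 0 /\ j != 0 by lia.
rewrite !Rintegral_blocksS (IH (i + 1) (j + 1)) ?(IH (i + 1) (j + 1) (th + pi / 2)); try lia.
congr (_ + (_ * _ + _ * _)).
- exact: (Rintegral_identically_distributed mB idB i1 j1 (z_le th)).
- exact: (Rintegral_identically_distributed mB idB i1 j1 fc_le1).
- exact: (Rintegral_identically_distributed mB idB i1 j1 fs_le1).
Qed.

End regeneration_blocks.

(** Moving the window by one site exchanges two terms. *)
Lemma shifted_sum_le (R : realType) (x : nat -> R) (F : R) (n t : nat) : (forall j, `|x j| <= F) ->
  `|\sum_(j < n) x (t + j)%N - \sum_(j < n) x j| <= 2 * F * t%:R.
Proof.
move=> xF; elim: t => [|t IH].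
  by under eq_bigr do rewrite add0n; rewrite subrr normr0 mulr0.
have -> : \sum_(j < n) x (t.+1 + j)%N = \sum_(j < n) x (t + j)%N + (x (t + n)%N - x t).
  have H : x t + \sum_(j < n) x (t + bump 0 j)%N = \sum_(j < n) x (t + j)%N + x (t + n)%N.
    by have := erefl (\sum_(j < n.+1) x (t + j)%N); rewrite {1}big_ord_recl big_ord_recr/= addn0.
  have -> : \sum_(j < n) x (t.+1 + j)%N = \sum_(j < n) x (t + bump 0 j)%N.
    by apply: eq_bigr => j _; rewrite /bump/= addnA addn1.
  by apply: (addrI (x t)); rewrite H; ring.
have -> : forall a b : R, a + b - \sum_(j < n) x j = (a - \sum_(j < n) x j) + b by move=> *; ring.
rewrite (le_trans (ler_normD _ _))//.
have := xF t; have := xF (t + n)%N; have := ler_normB (x (t + n)%N) (x t).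
by rewrite -[t.+1%:R]natr1; lra.
Qed.

Lemma Rintegral_sum d (W : measurableType d) (R : realType) (Q : probability W R)
    (h : nat -> W -> R) (c : nat -> R) n : (forall i, bounded_measurable (h i)) ->
  \int[Q]_w (\sum_(i < n) c i * h i w) = \sum_(i < n) c i * \int[Q]_w h i w.
Proof.
move=> bh; elim: n => [|n IH].
  by under eq_Rintegral do rewrite big_ord0; rewrite Rintegral_prob_cst big_ord0.
rewrite big_ord_recr/= -IH.
under eq_Rintegral do rewrite big_ord_recr/= -[X in X + _]mul1r.
rewrite Rintegral_linear ?mul1r//.
by apply: bounded_measurable_sum => i; exact: bounded_measurableZ.
Qed.

Section regeneration_comparison.
Context {R : realType} {E : pointedFinType}.
Variables (g : E -> past E -> R) (P : probability (config int E) R).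
Context {d} {W : measurableType d} (Q : probability W R) (X : {RV Q >-> config int E}).
Variable T : int -> W -> int.
Hypothesis HR : is_regeneration g P X T.

Let mT i n : measurable [set w | T i w = n]. Proof. by case: HR. Qed.

Let good w := [/\ forall i, T i w < T (i + 1) w, T 0 w <= 0 & 0 < T 1 w].

Let aegood : {ae Q, forall w, good w}. Proof. by case: HR. Qed.

Let mB := measurable_block HR.

Lemma gap_block i w : good w -> gap T i w = (size (block X T i w))%:Z.
Proof.
by move=> [/(_ i) Tlt _ _]; rewrite size_map size_iota /gap; lia.
Qed.

Lemma measurable_gap i : measurable_fun setT (fun w => (gap T i w)%:~R : R).
Proof.
move=> _ B _; rewrite setTI.
apply: (measurable_countable_fibers (Z := gap T i) _ [set n | B n%:~R]) => n.
have -> : [set w | gap T i w = n] = \bigcup_(k : int)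
    ([set w | T i w = k] `&` [set w | T (i + 1) w = k + n]).
  apply/seteqP; split=> w /=.
    by rewrite /gap => <-; exists (T i w) => //; split=> //=; lia.
  by move=> [k _ [/= Tk Tk1]]; rewrite /gap Tk Tk1; lia.
by apply: countable_bigcupT_measurable => // k; exact: measurableI.
Qed.

Lemma block_size_tail i (M : nat) : i != 0 ->
  \int[Q]_w (M < size (block X T i w))%:R = return_prob (a_coef g) M.
Proof.
move=> i0; case: HR => _ _ _ [_ /(_ i M.+1 i0 isT) gapM] _.
apply: EFin_inj; rewrite -[in RHS]gapM.
have mg : measurable [set w | M.+1%:Z <= gap T i w].
  have -> : [set w | M.+1%:Z <= gap T i w] = (fun w => (gap T i w)%:~R : R) @^-1` `[M.+1%:R, +oo[.
    by apply/seteqP; split=> w /=; rewrite in_itv/= andbT -(ler_int R).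
  by rewrite -[_ @^-1` _]setTI; exact: measurable_gap.
rewrite -Rintegral_indic//; congr EFin; apply: Rintegral_ae_eq.
- apply: (bounded_measurable_discrete mB i (F := fun l => (M < size l)%:R) (M := 1)) => l.
  by case: ltnP => _; rewrite ?normr1 ?normr0.
- exact: bounded_measurable_indic.
apply: filterS aegood => w gw; rewrite indicE; congr (nat_of_bool _)%:R.
by apply/idP/idP; rewrite inE/= gap_block// lez_nat.
Qed.

(** A layer-cake sum, truncated at [n] to remain within bounded integrands before the mean length is
    known to be finite. *)
Lemma block_size_mean_le i (n : nat) : i != 0 ->
  \int[Q]_w (minn (size (block X T i w)) n)%:R = \sum_(M < n) return_prob (a_coef g) M.
Proof.
move=> i0; under [RHS]eq_bigr do rewrite -(block_size_tail _ i0) -[Rintegral _ _ _]mul1r.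
rewrite -(Rintegral_sum Q (h := fun M w => (M < size (block X T i w))%:R) (fun=> 1)).
  apply: eq_Rintegral => w _; under eq_bigr do rewrite mul1r.
  set k := size _; elim: n => [|n IH]; first by rewrite big_ord0 minn0.
  rewrite big_ord_recr/= -IH -natrD; congr _%:R.
  by case: (ltnP n k) => /= nk; [rewrite !(minn_idPr _) ?addn1// ltnW|
    rewrite !(minn_idPl _) ?addn0// leqW].
move=> M; apply: (bounded_measurable_discrete mB i (F := fun l => (M < size l)%:R) (M := 1)) => l.
by case: ltnP => _; rewrite ?normr1 ?normr0.
Qed.

Hypothesis rho_summable : bounded_sums (return_prob (a_coef g)).

Let size1 w : R := (size (block X T 1 w))%:R.

Let msize1 : measurable_fun setT size1.
Proof. exact: (measurable_discrete mB 1 (fun l => (size l)%:R)). Qed.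

Lemma integrable_block_size : Q.-integrable setT (EFin \o size1).
Proof.
pose h (n : nat) w : R := (minn (size (block X T 1 w)) n)%:R.
have bh n : bounded_measurable (h n).
  apply: (bounded_measurable_discrete mB 1 (F := fun l => (minn (size l) n)%:R) (M := n%:R)) => l.
  by rewrite ger0_norm ?ler0n// ler_nat geq_minr.
have hcvg w : h n w @[n --> \oo] --> size1 w.
  apply: cvg_near_cst; exists (size (block X T 1 w)) => // n /= sn.
  by rewrite /h (minn_idPl sn).
have [S HS] := rho_summable.
have hE n : \int[Q]_w h n w = \sum_(M < n) return_prob (a_coef g) M by exact: block_size_mean_le.
have : cvgn (fun n => \int[Q]_w h n w).
  apply: nondecreasing_is_cvgn.
    move=> n n' nn'; apply: Rintegral_le => // w; rewrite ler_nat leq_min geq_minl/=.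
    by rewrite (leq_trans (geq_minr _ _)).
  by exists S => _ [n _ <-]; rewrite hE.
move=> /(fatou_bounded_measurable bh (fun n w => ler0n _ _) hcvg) fin.
apply/integrableP; split; first exact/measurable_EFinP.
under eq_integral do rewrite /= ger0_norm ?ler0n//.
exact: le_lt_trans fin (ltry _).
Qed.

Lemma block_size_mean_ge1 : 1 <= \int[Q]_w size1 w.
Proof.
have <- : \int[Q]_w (minn (size (block X T 1 w)) 1)%:R = 1.
  by rewrite block_size_mean_le// big_ord1.
apply: le_Rintegral => //; last by move=> w _; rewrite ler_nat geq_minl.
  apply: bounded_measurable_integrable.
  apply: (bounded_measurable_discrete mB 1 (F := fun l => (minn (size l) 1)%:R) (M := 1)) => l.
  by rewrite ger0_norm ?ler0n// (ler_nat _ _ 1) geq_minr.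
exact: integrable_block_size.
Qed.

Lemma expectation_gap : ('E_Q[fun w => (T 2 w - T 1 w)%:~R] = (\int[Q]_w size1 w)%:E)%E.
Proof.
rewrite unlock /Rintegral fineK; last exact: integrable_fin_num integrable_block_size.
apply: ae_eq_integral => //.
- exact/measurable_EFinP/(measurable_gap 1).
- by apply/measurable_EFinP; exact: msize1.
- apply: filterS aegood => w gw _; congr EFin.
  have := gap_block 1 gw; rewrite /gap /size1.
  by move=> H; rewrite [LHS](congr1 (fun z : int => z%:~R) H).
Qed.

Variable f : E -> R.
Variables r s F : R.
Hypothesis r01 : 0 <= r < 1.
Hypothesis s0 : 0 <= s.
Hypothesis fF : forall x, `|f x| <= F.

Let z := discounted_cos f r s.
Let e N th := \int[Q]_w z (blocks X T N 1 w) th.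

Let r0 : 0 <= r. Proof. by case/andP: r01. Qed.
Let b0 : 0 <= (1 - r)^-1. Proof. by rewrite invr_ge0; case/andP: r01; lra. Qed.

(** Both concatenations begin with the same [N] symbols, and each remainder carries a factor [r^N].
    Replacing [e N.+1] by [e N] closes the renewal equation up to this error. *)
Lemma blocks_step N th : `|e N.+1 th - e N th| <= 2 * (r ^+ N * (1 - r)^-1).
Proof.
have bz k := bounded_measurable_blocks HR f s r01 k 1 th.
rewrite -[leRHS](Rintegral_prob_cst Q); apply: Rintegral_dist_ae => //.
  exact: bounded_measurable_cst.
apply: filterS aegood => w gw.
have h1 := discounted_cos_take f s th r01 (size_blocks X N 1 gw).
have h2 := discounted_cos_take f s th r01 (ltnW (size_blocks X N.+1 1 gw)).
rewrite take_blocks// in h1; rewrite take_blocksS// in h2.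
rewrite (le_trans (ler_distD (discounted_cos f r s (path_from (T 1 w) N (X w)) th) _ _))//.
by rewrite mulr2n mulrDl mul1r lerD// distrC.
Qed.

Let start w : R := `|T 1 w|%N%:R.

Let mstart : measurable_fun setT start.
Proof.
move=> _ B _; rewrite setTI.
exact: (measurable_countable_fibers (mT 1) [set n : int | B (`|n|%N%:R)]).
Qed.

Let F0 : 0 <= F. Proof. exact: le_trans (normr_ge0 _) (fF point). Qed.

Lemma bounded_measurable_start : bounded_measurable (fun w => Num.min 2 (2 * F * s * start w)).
Proof.
split; first by apply: measurable_minr => //; exact: measurable_funM.
exists 2 => w; rewrite ger0_norm; first by rewrite ge_min lexx.
by rewrite le_min ler0n/= !mulr_ge0 ?ler0n.
Qed.

(** The first error is the truncation at [N] sites. The second comes from starting at [T 1] instead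
    of 0: partial sums then differ by at most [2 F T_1], and the minimum with 2 keeps the integrand
    bounded whatever the tail of [T 1]. *)
Lemma blocks_comparison N th :
  `|e N th - \sum_(n < N) r ^+ n * \int[P]_w cos (s * (\sum_(i < n) f (w i%:Z)) + th)| <=
  r ^+ N * (1 - r)^-1 + (1 - r)^-1 * \int[Q]_w Num.min 2 (2 * F * s * start w).
Proof.
pose h (n : nat) (v : config int E) := cos (s * (\sum_(i < n) f (v i%:Z)) + th).
have bh n : bounded_measurable (h n).
  apply: bounded_measurable_cos; apply: measurable_funD => //; apply: measurable_funM => //.
  have : bounded_measurable (fun v : config int E => \sum_(i < n) f (v i%:Z)).
    by apply: bounded_measurable_sum => i; exact: bounded_measurable_coordinate.
  by case.
have mX : measurable_fun setT X by exact: measurable_funP.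
have bhX n : bounded_measurable (fun w => h n (X w)) by exact: bounded_measurable_comp.
have XP A : measurable A -> Q (X @^-1` A) = P A by move=> mA; case: HR => /(_ A mA).
have -> : \sum_(n < N) r ^+ n * \int[P]_v cos (s * (\sum_(i < n) f (v i%:Z)) + th) =
    \int[Q]_w (\sum_(n < N) r ^+ n * h n (X w)).
  rewrite (Rintegral_sum Q (fun n => r ^+ n) N bhX).
  by apply: eq_bigr => n _; congr (_ * _); rewrite (Rintegral_pushforward mX XP (bh n)).
have bm := bounded_measurable_start.
have -> : r ^+ N * (1 - r)^-1 + (1 - r)^-1 * \int[Q]_w Num.min 2 (2 * F * s * start w) =
   \int[Q]_w ((r ^+ N * (1 - r)^-1) * 1 + (1 - r)^-1 * Num.min 2 (2 * F * s * start w)).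
  rewrite Rintegral_linear//; last exact: bounded_measurable_cst.
  by rewrite Rintegral_prob_cst mulr1.
apply: Rintegral_dist_ae.
- exact: (bounded_measurable_blocks HR f s r01 N 1 th).
- by apply: bounded_measurable_sum => n; exact: bounded_measurableZ.
- apply: bounded_measurableD; apply: bounded_measurableZ => //; exact: bounded_measurable_cst.
apply: filterS aegood => w gw.
have h1 := discounted_cos_take f s th r01 (size_blocks X N 1 gw).
rewrite take_blocks// in h1.
rewrite (le_trans (ler_distD (discounted_cos f r s (path_from (T 1 w) N (X w)) th) _ _))//.
rewrite mulr1 lerD// /path_from (discounted_cos_path f r s (fun j => X w (T 1 w + j%:Z))).
rewrite -sumrB (le_trans (ler_norm_sum _ _ _))//.
set m := Num.min _ _.
apply: (@le_trans _ _ (\sum_(n < N) r ^+ n * m)); last first.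
  rewrite -mulr_suml ler_wpM2r//; last exact: geometric_sum_le.
  by rewrite le_min ler0n/= !mulr_ge0 ?ler0n.
apply: ler_sum => n _; rewrite -mulrBr normrM ger0_norm ?exprn_ge0//.
rewrite ler_wpM2l ?exprn_ge0// le_min; apply/andP; split.
  rewrite (le_trans (ler_normB _ _))// mulr2n lerD//; exact: cos_max.
rewrite (le_trans (cos_lipschitz _ _))//.
have -> : forall a b : R, s * a + th - (s * b + th) = s * (a - b) by move=> *; ring.
rewrite normrM ger0_norm// mulrAC [leRHS]mulrC ler_wpM2l//.
have -> : \sum_(i < n) f (X w (T 1 w + i%:Z)) = \sum_(i < n) f (X w (`|T 1 w| + i)%N%:Z).
  apply: eq_bigr => i _; congr (f (X w _)).
  by case: gw => _ _ T1; rewrite PoszD gez0_abs// ltW.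
exact: (shifted_sum_le (x := fun j => f (X w j%:Z)) n `|T 1 w| (fun j => fF _)).
Qed.

End regeneration_comparison.

(** * Limits as the discount tends to 1 *)

Section discount_limits.
Context {R : realType}.

Lemma cvg_discountX k : discount m ^+ k @[m --> \oo] --> (1 : R).
Proof.
suff d1 : discount m @[m --> \oo] --> (1 : R).
  elim: k => [|k IH]; first exact: cvg_cst.
  have -> : (fun m => discount m ^+ k.+1) = (fun m => discount m * discount m ^+ k : R).
    by apply/funext => m; rewrite exprS.
  by have -> : 1 = 1 * 1 :> R by [rewrite mulr1]; exact: cvgM.
rewrite -expR0 /discount; apply: continuous_cvg; first exact: continuous_expR.
rewrite -oppr0; apply: cvgN.
have -> : (fun m => m.+1%:R^-1) = (fun m => frequency m * frequency m : R).
  by apply/funext => m; rewrite /frequency -expr2 exprVn sqr_sqrtr ?ler0n.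
by have -> : 0 = 0 * 0 :> R by [rewrite mulr0]; apply: cvgM; exact: cvg_frequency.
Qed.

Lemma cvg_discount_remainder :
  m.+1%:R * expR (- m.+1%:R) @[m --> \oo] --> (0 : R).
Proof.
have h : 2 * expR (- (2^-1 * m.+1%:R)) @[m --> \oo] --> (0 : R).
  by rewrite -[X in _ --> X](mulr0 2); apply: cvgM; [exact: cvg_cst|exact: cvg_expRN_nat].
apply: (squeeze_cvgr _ (cvg_cst 0) h); apply: nearW => m.
rewrite mulr_ge0 ?expR_ge0//=; set x := m.+1%:R.
have -> : - x = - (2^-1 * x) + - (2^-1 * x) by field.
rewrite expRD mulrA ler_wpM2r ?expR_ge0// expRN ler_pdivrMr ?expR_gt0//.
by have := expR_ge1Dx (2^-1 * x); lra.
Qed.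

Lemma cvg_discounted_cos (E : Type) (f : E -> R) l (th : nat -> R) (th0 : R) :
  th m @[m --> \oo] --> th0 ->
  discounted_cos f (discount m) (frequency m) l (th m) @[m --> \oo] --> (size l)%:R * cos th0.
Proof.
elim: l th => [|x l IH] th hth /=; first by rewrite mul0r; exact: cvg_cst.
rewrite -natr1 mulrDl mul1r addrC; apply: cvgD.
  by apply: continuous_cvg => //; exact: continuous_cos.
rewrite -[X in _ --> X]mul1r; apply: cvgM; first exact: (cvg_discountX 1).
apply: IH; rewrite -[th0]addr0 -[X in _ + X](mul0r (f x)); apply: cvgD => //.
by apply: cvgM; [exact: cvg_frequency|exact: cvg_cst].
Qed.

Lemma cvg_scaled_cos (y : R) :
  m.+1%:R * (1 - cos (frequency m * y)) @[m --> \oo] --> y ^+ 2 / 2.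
Proof.
have h : `|y| ^+ 3 * frequency m @[m --> \oo] --> 0.
  by rewrite -[X in _ --> X](mulr0 (`|y| ^+ 3)); apply: cvgM; [exact: cvg_cst|exact: cvg_frequency].
apply/cvgrPdist_le => e e0; have /cvgrPdist_le/(_ _ e0) := h.
apply: filterS => m; rewrite sub0r normrN; apply: le_trans.
rewrite (ger0_norm (mulr_ge0 (exprn_ge0 3 (normr_ge0 y)) (frequency_ge0 m))).
have := cos_taylor (frequency m * y).
rewrite normrM (ger0_norm (frequency_ge0 m)) => H.
have m0 : 0 < m.+1%:R :> R by rewrite ltr0n.
have : m.+1%:R * frequency m ^+ 2 = 1 :> R := sqr_frequency m.
set s := frequency m in H *; set c := cos _ in H * => sE.
have -> : y ^+ 2 / 2 - m.+1%:R * (1 - c) = m.+1%:R * (c - (1 - (s * y) ^+ 2 / 2)).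
  by have := congr1 (fun t => t * y ^+ 2 / 2) sE; rewrite mul1r => <-; field.
rewrite normrM gtr0_norm//.
have -> : `|y| ^+ 3 * s = m.+1%:R * (s * `|y|) ^+ 3.
  by have := congr1 (fun t => `|y| ^+ 3 * t * s) sE; rewrite mulr1 => <-; ring.
by rewrite ler_pM2l.
Qed.

Lemma scaled_one_minus_discountX m k : 0 <= m.+1%:R * (1 - (discount m : R) ^+ k) <= k%:R.
Proof.
have m0 : 0 < m.+1%:R :> R by rewrite ltr0n.
rewrite discountX; apply/andP; split.
  by rewrite mulr_ge0 ?(ltW m0)// subr_ge0 -[leRHS]expR0 ler_expR oppr_le0 divr_ge0 ?ler0n.
rewrite mulrC -ler_pdivlMr//; set q := k%:R / _.
by have : 1 + - q <= expR (- q) := expR_ge1Dx _; lra.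
Qed.

Lemma cvg_scaled_one_minus_discountX k :
  m.+1%:R * (1 - discount m ^+ k) @[m --> \oo] --> (k%:R : R).
Proof.
under eq_fun do rewrite discountX; exact: cvg_one_minus_expRN (ler0n _ _).
Qed.

(* With [U = u + iv], the hypotheses read [(p + iq) U = a + ib], so [p] is the real part of [(a + ib) / U]. *)
Lemma cvg_rotation_solution (p q u v a b : nat -> R) (x y : R) : x != 0 ->
  (forall m, p m * u m - q m * v m = a m) -> (forall m, p m * v m + q m * u m = b m) ->
  u m @[m --> \oo] --> x -> v m @[m --> \oo] --> 0 ->
  a m @[m --> \oo] --> y -> b m @[m --> \oo] --> 0 ->
  p m @[m --> \oo] --> y / x.
Proof.
move=> x0 ea eb cu cv ca cb.
have c1 : (a m * u m + b m * v m) / (u m ^+ 2 + v m ^+ 2) @[m --> \oo] --> (y * x + 0 * 0) / (x ^+ 2 + 0 ^+ 2).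
  apply: cvgM; first by apply: cvgD; exact: cvgM.
  apply: cvgV; first by rewrite expr0n addr0 expf_neq0.
  by apply: cvgD; rewrite expr2; under eq_fun do rewrite expr2; exact: cvgM.
have <- : (y * x + 0 * 0) / (x ^+ 2 + 0 ^+ 2) = y / x.
  by rewrite expr0n/= mulr0 !addr0; field.
apply: cvg_trans c1; apply: near_eq_cvg.
have /cvgrPdist_lt/(_ `|x|) := cu; rewrite normr_gt0 => /(_ x0).
apply: filterS => m um; have {um} um : u m != 0.
  by apply: contraTneq um => ->; rewrite subr0 ltxx.
rewrite -ea -eb; field; apply: lt0r_neq0.
by have := sqr_ge0 (v m); have : 0 < u m ^+ 2; [rewrite exprn_even_gt0|lra].
Qed.

End discount_limits.

Section regeneration_variance.
Context {R : realType} {E : pointedFinType}.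
Variables (g : E -> past E -> R) (P : probability (config int E) R).
Context {d} {W : measurableType d} (Q : probability W R) (X : {RV Q >-> config int E}).
Variable T : int -> W -> int.
Hypothesis HR : is_regeneration g P X T.
Hypothesis rho_summable : bounded_sums (return_prob (a_coef g)).
Variables (f : E -> R) (sigma2 : R).
Hypothesis sigma2_ge0 : 0 <= sigma2.
Hypothesis charP : gaussian_characteristic sigma2
  (fun s th n => \int[P]_w cos (s * (\sum_(i < n) f (w i%:Z)) + th)).

Let mT i n : measurable [set w | T i w = n]. Proof. by case: HR. Qed.
Let mB := measurable_block HR.

Let F := \sum_x `|f x|.
Let fF x : `|f x| <= F.
Proof. by rewrite /F (bigD1 x)//= lerDl sumr_ge0. Qed.
Let F0 : 0 <= F. Proof. exact: le_trans (normr_ge0 _) (fF point). Qed.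

Let size1 w : R := (size (block X T 1 w))%:R.
Let sum1 w : R := word_sum f (block X T 1 w).
Let mu := \int[Q]_w size1 w.
Let isize1 : Q.-integrable setT (EFin \o size1).
Proof. exact: integrable_block_size HR rho_summable. Qed.
Let mu1 : 1 <= mu. Proof. exact: block_size_mean_ge1 HR rho_summable. Qed.
Let msize1 : measurable_fun setT size1.
Proof. exact: (measurable_discrete mB 1 (fun l => (size l)%:R)). Qed.
Let msum1 : measurable_fun setT sum1.
Proof. exact: (measurable_discrete mB 1 (word_sum f)). Qed.

Let z m := discounted_cos f (discount m) (frequency m).
Let e k m th := \int[Q]_w z m (blocks X T k 1 w) th.
Let N m := (m.+1 * m.+1)%N.

Let discountN m : discount m ^+ N m = expR (- m.+1%:R) :> R.
Proof. by rewrite discountX natrM mulfK// pnatr_eq0. Qed.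

Let remainder_le m :
  discount m ^+ N m * (1 - discount m)^-1 <= 2 * (m.+1%:R * expR (- m.+1%:R)) :> R.
Proof.
by rewrite discountN mulrA mulrC ler_wpM2r ?expR_ge0// discount_inv_le.
Qed.

Let start w : R := `|T 1 w|%N%:R.

Lemma cvg_start_effect :
  \int[Q]_w Num.min 2 (2 * F * frequency m * start w) @[m --> \oo] --> 0.
Proof.
rewrite -[X in _ --> X](Rintegral_prob_cst Q).
have min0 m w : 0 <= Num.min 2 (2 * F * frequency m * start w).
  by rewrite le_min ler0n/= !mulr_ge0 ?ler0n ?frequency_ge0.
apply: (@Rintegral_dominated_cvg _ _ _ Q (fun m w => Num.min 2 (2 * F * frequency m * start w)) _ (cst 2)).
- by move=> m; case: (bounded_measurable_start HR (frequency_ge0 m) fF).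
- by apply: bounded_measurable_integrable; exact: bounded_measurable_cst.
- by move=> m w; rewrite ger0_norm// ge_min lexx.
- move=> w.
  have h : 2 * F * frequency m * start w @[m --> \oo] --> 0.
    have -> : 0 = 2 * F * 0 * start w by rewrite mulr0 mul0r.
    by do 2 (apply: cvgM; last exact: cvg_cst || exact: cvg_frequency); exact: cvg_cst.
  apply: (squeeze_cvgr _ (cvg_cst 0) h); apply: nearW => m.
  by rewrite min0/= ge_min lexx orbT.
Qed.

Lemma cvg_blocks th : e (N m) m th / m.+1%:R @[m --> \oo] --> cos th / (1 + sigma2 / 2).
Proof.
have H := @abel_limit R sigma2 _ th sigma2_ge0 charP.
suff h : e (N m) m th / m.+1%:R - (\sum_(n < N m) discount m ^+ n *
    \int[P]_w cos (frequency m * (\sum_(i < n) f (w i%:Z)) + th)) / m.+1%:R @[m --> \oo] --> 0.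
  rewrite -[cos th / _]add0r; apply: cvg_trans (cvgD h H); apply: near_eq_cvg.
  by apply: nearW => m; rewrite /= subrK.
have b1 : 2 * expR (- (1 * m.+1%:R)) + 2 * \int[Q]_w Num.min 2 (2 * F * frequency m * start w)
    @[m --> \oo] --> 0.
  rewrite -[X in _ --> X](addr0 0); apply: cvgD.
    by rewrite -[X in _ --> X](mulr0 2); apply: cvgM; [exact: cvg_cst|exact: cvg_expRN_nat].
  by rewrite -[X in _ --> X](mulr0 2); apply: cvgM; [exact: cvg_cst|exact: cvg_start_effect].
apply/cvgrPdist_le => eps eps0; have /cvgrPdist_le/(_ _ eps0) := b1.
apply: filterS => m; rewrite !sub0r !normrN => /(le_trans (ler_norm _)); apply: le_trans.
have m0 : 0 < m.+1%:R :> R by rewrite ltr0n.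
rewrite -mulrBl normrM normfV (gtr0_norm m0) ler_pdivrMr//.
apply: (le_trans (blocks_comparison HR (discount01 m) (frequency_ge0 m) fF (N m) th)).
rewrite [leRHS]mulrDl; apply: lerD.
  by rewrite (le_trans (remainder_le m))// mul1r -mulrA [expR _ * _]mulrC.
rewrite [leRHS]mulrAC ler_wpM2r ?discount_inv_le//; apply: Rintegral_ge0 => w _.
by rewrite le_min ler0n/= !mulr_ge0 ?ler0n ?frequency_ge0.
Qed.

Lemma cvg_blocks_step th : e (N m).+1 m th - e (N m) m th @[m --> \oo] --> 0.
Proof.
have h : 4 * (m.+1%:R * expR (- m.+1%:R)) @[m --> \oo] --> (0 : R).
  by rewrite -[X in _ --> X](mulr0 4); apply: cvgM; [exact: cvg_cst|exact: cvg_discount_remainder].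
apply/cvgrPdist_le => eps eps0; have /cvgrPdist_le/(_ _ eps0) := h.
apply: filterS => m; rewrite !sub0r !normrN => /(le_trans (ler_norm _)); apply: le_trans.
apply: (le_trans (blocks_step HR f (frequency m) (discount01 m) (N m) th)).
by have := remainder_le m; lra.
Qed.

Lemma cvg_first_block th :
  \int[Q]_w z m (block X T 1 w) th @[m --> \oo] --> mu * cos th.
Proof.
have -> : mu * cos th = \int[Q]_w (size1 w * cos th).
  by under eq_Rintegral do rewrite mulrC; rewrite RintegralZl// mulrC.
apply: (@Rintegral_dominated_cvg _ _ _ Q (fun m w => z m (block X T 1 w) th) _ size1) => //.
- by move=> m; exact: (measurable_discrete mB 1 (fun l => z m l th)).
- move=> m w; apply: discounted_cos_le_size.
  by case/andP: (discount01 (R := R) m) => -> /ltW.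
- by move=> w; apply: cvg_discounted_cos; exact: cvg_cst.
Qed.

Let fc m (l : seq E) : R := discount m ^+ size l * cos (frequency m * word_sum f l).
Let fs m (l : seq E) : R := discount m ^+ size l * sin (frequency m * word_sum f l).
Let phic m := \int[Q]_w fc m (block X T 1 w).
Let phis m := \int[Q]_w fs m (block X T 1 w).

Let blocksS k m th : e k.+1 m th = \int[Q]_w z m (block X T 1 w) th +
  (phic m * e k m th + phis m * e k m (th + pi / 2)).
Proof.
rewrite /e (Rintegral_blocksS HR f (frequency m) (discount01 m) k 1 th).
by rewrite !(Rintegral_blocks_shift HR f (frequency m) (discount01 m) k (i := 1 + 1) (j := 1)).
Qed.

(** The phases [0] and [pi / 2] suffice to close the renewal equation, since a phase [pi] only
    changes the sign ([eN]). The resulting rotation system is solved for [m + 1] times the defect,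
    with [mu] as the limit of the first-block term. *)
Lemma cvg_characteristic_defect :
  m.+1%:R * (1 - phic m) @[m --> \oo] --> mu * (1 + sigma2 / 2).
Proof.
have k0 : 1 + sigma2 / 2 != 0 by rewrite gt_eqF// ltr_wpDr// divr_ge0.
have eN k m : e k m (pi / 2 + pi / 2) = - e k m 0.
  have -> : pi / 2 + pi / 2 = 0 + pi / 2 + pi / 2 :> R by rewrite add0r.
  rewrite /e /z; under eq_Rintegral do rewrite discounted_cosDpi -mulN1r.
  by rewrite RintegralZl ?mulN1r//; apply: bounded_measurable_integrable;
    exact: (bounded_measurable_blocks HR f (frequency m) (discount01 m)).
have cB th : \int[Q]_w z m (block X T 1 w) th - (e (N m).+1 m th - e (N m) m th)
    @[m --> \oo] --> mu * cos th - 0.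
  by apply: cvgB; [exact: cvg_first_block|exact: cvg_blocks_step].
(* The limit is written as [y / x] with [y = mu] and [x = 1 / (1 + sigma2 / 2)]. *)
rewrite -[1 + _]invrK.
apply: (cvg_rotation_solution (q := fun m => m.+1%:R * phis m)
  (u := fun m => e (N m) m 0 / m.+1%:R) (v := fun m => e (N m) m (pi / 2) / m.+1%:R)
  (a := fun m => \int[Q]_w z m (block X T 1 w) 0 - (e (N m).+1 m 0 - e (N m) m 0))
  (b := fun m => \int[Q]_w z m (block X T 1 w) (pi / 2) -
     (e (N m).+1 m (pi / 2) - e (N m) m (pi / 2)))).
- by rewrite invr_eq0.
- move=> m; rewrite blocksS add0r; have : m.+1%:R != 0 :> R by rewrite pnatr_eq0.
  by move: m.+1%:R => c c0; field.
- move=> m; rewrite blocksS eN; have : m.+1%:R != 0 :> R by rewrite pnatr_eq0.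
  by move: m.+1%:R => c c0; field.
- by have := @cvg_blocks 0; rewrite cos0 mul1r.
- by have := @cvg_blocks (pi / 2); rewrite cos_pihalf mul0r.
- by have := cB 0; rewrite cos0 mulr1 subr0.
- by have := cB (pi / 2); rewrite cos_pihalf mulr0 subr0.
Qed.

(** What remains of the scaled [1 - r^tau cos (s Y)] once the scaled [1 - r^tau] is removed:
    nonnegative, with pointwise limit [Y^2 / 2]. *)
Let H m w := m.+1%:R * (discount m ^+ size (block X T 1 w) * (1 - cos (frequency m * sum1 w))).

Let dX1 m k : 0 <= (discount m : R) ^+ k <= 1.
Proof.
case/andP: (discount01 (R := R) m) => d0 d1.
by rewrite exprn_ge0//= exprn_ile1// ltW.
Qed.

Let cos1 (x : R) : 0 <= 1 - cos x. Proof. by rewrite subr_ge0 cos_le1. Qed.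

Let H_ge0 m w : 0 <= H m w.
Proof. by rewrite !mulr_ge0//; case/andP: (dX1 m (size (block X T 1 w))). Qed.

Let bH m : bounded_measurable (H m).
Proof.
apply: (bounded_measurable_discrete mB 1
  (F := fun l => m.+1%:R * (discount m ^+ size l * (1 - cos (frequency m * word_sum f l))))
  (M := m.+1%:R * 2)) => l.
rewrite ger0_norm; last by rewrite !mulr_ge0//; case/andP: (dX1 m (size l)).
rewrite ler_wpM2l// -[leRHS]mul1r; case/andP: (dX1 m (size l)) => d0 d1.
by apply: ler_pM => //; have := cos_geN1 (frequency m * word_sum f l); lra.
Qed.

Let cvg_H w : H m w @[m --> \oo] --> sum1 w ^+ 2 / 2.
Proof.
rewrite -[_ / 2]mul1r.
have -> : H ^~ w = (fun m => discount m ^+ size (block X T 1 w) *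
    (m.+1%:R * (1 - cos (frequency m * sum1 w)))).
  by apply/funext => m; rewrite /H mulrCA.
by apply: cvgM; [exact: cvg_discountX|exact: cvg_scaled_cos].
Qed.

Lemma cvg_Rintegral_cos_defect : \int[Q]_w H m w @[m --> \oo] --> mu * sigma2 / 2.
Proof.
have c1 : \int[Q]_w (m.+1%:R * (1 - discount m ^+ size (block X T 1 w))) @[m --> \oo] --> mu.
  apply: (@Rintegral_dominated_cvg _ _ _ Q
    (fun m w => m.+1%:R * (1 - discount m ^+ size (block X T 1 w))) _ size1) => //.
  - move=> m; exact: (measurable_discrete mB 1 (fun l => m.+1%:R * (1 - discount m ^+ size l))).
  - by move=> m w; case/andP: (scaled_one_minus_discountX (R := R) m (size (block X T 1 w))) => h0 h1; rewrite ger0_norm.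
  - by move=> w; exact: cvg_scaled_one_minus_discountX.
have -> : mu * sigma2 / 2 = mu * (1 + sigma2 / 2) - mu by ring.
apply: cvg_trans (cvgB cvg_characteristic_defect c1); apply: near_eq_cvg; apply: nearW => m.
rewrite [LHS](_ : _ = m.+1%:R * (1 - phic m) -
  \int[Q]_w (m.+1%:R * (1 - discount m ^+ size (block X T 1 w))))//.
have bd : bounded_measurable (fun w => (discount m : R) ^+ size (block X T 1 w)).
  apply: (bounded_measurable_discrete mB 1 (F := fun l => (discount m : R) ^+ size l) (M := 1)) => l.
  by case/andP: (dX1 m (size l)) => d0 d1; rewrite ger0_norm.
have bc : bounded_measurable (fun w => fc m (block X T 1 w)).
  apply: (bounded_measurable_discrete mB 1 (M := 1)) => l.
  rewrite normrM -[leRHS]mulr1; case/andP: (dX1 m (size l)) => d0 d1.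
  by rewrite ler_pM ?cos_max// ger0_norm.
have -> : \int[Q]_w (m.+1%:R * (1 - discount m ^+ size (block X T 1 w))) =
    m.+1%:R * (1 - \int[Q]_w discount m ^+ size (block X T 1 w)).
  have b1 : bounded_measurable (fun _ : W => 1 : R) by exact: bounded_measurable_cst.
  have := Rintegral_linear Q m.+1%:R (- m.+1%:R) b1 bd.
  by rewrite Rintegral_prob_cst mulrBr mulNr => <-; apply: eq_Rintegral => w _; rewrite /cst; ring.
have -> : \int[Q]_w H m w = m.+1%:R * \int[Q]_w discount m ^+ size (block X T 1 w) + - m.+1%:R * phic m.
  rewrite /phic -(Rintegral_linear Q _ _ bd bc); apply: eq_Rintegral => w _.
  by rewrite /H /fc /sum1; ring.
by rewrite /=; ring.
Qed.

(** Fatou's lemma makes [Y^2 / 2] integrable. As [cos_ge_quad] bounds every [H m] by [Y^2 / 2],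
    dominated convergence then turns the inequality into an equality. *)
Lemma block_sum_second_moment :
  Q.-integrable setT (EFin \o (fun w => sum1 w ^+ 2)) /\ \int[Q]_w (sum1 w ^+ 2) = mu * sigma2.
Proof.
have ms2 : measurable_fun setT (fun w => sum1 w ^+ 2 / 2).
  exact: (measurable_discrete mB 1 (fun l => word_sum f l ^+ 2 / 2)).
have fat := fatou_bounded_measurable bH H_ge0 cvg_H cvg_Rintegral_cos_defect.
have i2 : Q.-integrable setT (EFin \o (fun w => sum1 w ^+ 2 / 2)).
  apply/integrableP; split; first exact/measurable_EFinP.
  under eq_integral => w _.
    by rewrite /= ger0_norm ?divr_ge0 ?sqr_ge0//; over.
  exact: le_lt_trans fat (ltry _).
have lim : \int[Q]_w H m w @[m --> \oo] --> \int[Q]_w (sum1 w ^+ 2 / 2).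
  apply: (Rintegral_dominated_cvg _ i2) => [m|m w|w]; [by case: (bH m)| |exact: cvg_H].
  rewrite ger0_norm// /H; case/andP: (dX1 m (size (block X T 1 w))) => d0 d1.
  apply: (@le_trans _ _ (m.+1%:R * (1 - cos (frequency m * sum1 w)))).
    by rewrite ler_wpM2l// ler_piMl.
  have -> : sum1 w ^+ 2 / 2 = m.+1%:R * ((frequency m * sum1 w) ^+ 2 / 2).
    by have := congr1 (fun t => t * sum1 w ^+ 2 / 2) (sqr_frequency (R := R) m); rewrite mul1r => <-; field.
  by rewrite ler_wpM2l//; have := cos_ge_quad (frequency m * sum1 w); lra.
have half : \int[Q]_w (sum1 w ^+ 2 / 2) = mu * sigma2 / 2.
  by apply: cvg_unique lim cvg_Rintegral_cos_defect.
have dbl w : sum1 w ^+ 2 = 2 * (sum1 w ^+ 2 / 2) by field.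
split.
  have := integrableZl measurableT 2 i2; apply: eq_integrable => // w _ /=.
  by rewrite -EFinM -dbl.
by under eq_Rintegral do rewrite dbl; rewrite RintegralZl// half; field.
Qed.

Lemma regeneration_variance :
  let EY2 := ('E_Q[fun w => ((\sum_(x <- block X T 1 w) f x) ^+ 2)%R])%E in
  let Egap := ('E_Q[fun w => ((T 2 w - T 1 w)%:~R)%R])%E in
  [/\ (EY2 < +oo)%E, (Egap < +oo)%E & (sigma2%:E = EY2 / Egap)%E].
Proof.
move=> EY2 Egap; have [i2 m2] := block_sum_second_moment.
have mu0 : mu != 0 by apply: lt0r_neq0; exact: lt_le_trans mu1.
have e1 : EY2 = (mu * sigma2)%:E.
  by rewrite /EY2 unlock -m2 /Rintegral fineK//; exact: integrable_fin_num i2.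
have e2 : Egap = mu%:E by exact: expectation_gap HR rho_summable.
by rewrite e1 e2 !ltry inver (negbTE mu0) -EFinM; split=> //; congr EFin; field.
Qed.

End regeneration_variance.

Theorem corollary1 (R : realType) (E : pointedFinType) (g : E -> past E -> R)
    (P : probability (config int E) R) (a b C : R) (K : nat) (f : E -> R) :
  g_function g -> regular g -> consistent g P ->
  1 <= b -> 0 < C -> (2 <= K)%N ->
  (forall k : nat, (K <= k)%N ->
     1 - C * (ln k%:R `^ a / k%:R `^ b) <= a_coef g k) ->
  ('E_P[fun w => (f (w 0))%R] = 0)%E ->
  (1 < b \/ a < -1 /\ b = 1 ->
     exists sigma2 : R,
       [/\ 0 <= sigma2,
           forall (d : measure_display) (W : measurableType d)
             (Q : probability W R) (X : {RV Q >-> config int E})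
             (T : int -> W -> int),
             is_regeneration g P X T ->
             let EY2 :=
               ('E_Q[fun w => ((\sum_(x <- block X T 1 w) f x) ^+ 2)%R])%E in
             let Egap := ('E_Q[fun w => ((T 2 w - T 1 w)%:~R)%R])%E in
             [/\ (EY2 < +oo)%E, (Egap < +oo)%E & (sigma2%:E = EY2 / Egap)%E]
         & cvg_in_distribution P (normalized_sum f) (centered_normal sigma2)]) /\
  (2 < b \/ a < -1 /\ b = 2 ->
     let cov i := fine ('E_P[fun w => (f (w 0) * f (w i))%R])%E in
     exists sigma2 : R,
       [/\ 0 <= sigma2,
           cvgn (fun n : nat => \sum_(1 <= i < n) cov i%:Z),
           sigma2 = fine ('E_P[fun w => (f (w 0) ^+ 2)%R])%E +
             2 * limn (fun n : nat => \sum_(1 <= i < n) cov i%:Z)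
         & cvg_in_distribution P (normalized_sum f) (centered_normal sigma2)]).
Proof.
move=> gF [gC gA] gP b1 C0 K2 ak meanf.
have f_mean0 : \int[P]_w f (w 0) = 0 by rewrite /Rintegral; move: meanf; rewrite unlock => ->.
have a_nd := a_coef_nondecreasing gF; have a_1 := a_coef_le1 gF; have a0 := a_coef_gt0 gF gA.
have main : 1 < b \/ a < -1 /\ b = 1 -> bounded_sums (fun k => 1 - a_coef g k).
  move=> ab; apply: (bounded_sums_log _ _ C0 K2 ab) => [k|k|k Kk].
  - by rewrite subr_ge0.
  - by rewrite lerD2l lerN2.
  - by have := ak k Kk; lra.
have bS n : bounded_measurable (fun w : config int E => \sum_(i < n) f (w i%:Z)).
  by apply: bounded_measurable_sum => i; exact: bounded_measurable_coordinate.
split=> [ab|b2].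
  have a_summable := main ab.
  have [sigma2 [s0 charP S2 _]] := g_chain_characteristic gF gC gP a0 a_summable f_mean0.
  exists sigma2; split=> //; last exact: clt_of_characteristic.
  have rho_summable := return_prob_summable a_nd a0 a_1 a_summable.
  by move=> d W Q X T HR; exact: (regeneration_variance HR rho_summable s0 charP).
have a_summable : bounded_sums (fun k => 1 - a_coef g k).
  by apply: main; left; case: b2 => [|[_ ->]]; lra.
have [sigma2 [s0 charP S2 covP]] := g_chain_characteristic gF gC gP a0 a_summable f_mean0.
have E2 : fine ('E_P[fun w => (f (w 0) ^+ 2)%R])%E = \int[P]_w (f (w 0) ^+ 2) by rewrite unlock.
have covE i : fine ('E_P[fun w => (f (w 0) * f (w i))%R])%E = \int[P]_w (f (w 0) * f (w i)).
  by rewrite unlock.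
move=> cov; have cvgcov : (\sum_(1 <= i < n) cov i%:Z) @[n --> \oo] -->
    (sigma2 - \int[P]_w (f (w 0) ^+ 2)) / 2.
  have -> : (fun n => \sum_(1 <= i < n) cov i%:Z) =
     (fun n => \sum_(1 <= i < n) \int[P]_w (f (w 0) * f (w i%:Z))).
    by apply/funext => n; apply: eq_bigr => i _; exact: covE.
  exact: covP.
exists sigma2; split=> //; last exact: clt_of_characteristic.
- by apply/cvg_ex; eexists; exact: cvgcov.
- by rewrite E2 (cvg_lim _ cvgcov)//; field.
Qed.
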